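(* Let $p_1, p_2, \gamma_1, \gamma_2$ be non-zero constants with $\gamma_1 \neq \gamma_2$. Let $$U^*(z,f)=\sum_{j=0}^{m} d_j f(z+k_j)$$ be a linear difference polynomial in $f$, where the shifts $k_j$ are complex constants and the coefficients $d_j$ $(j=0,1,\dots,m)$ are constants (hence small functions of $f$). If $f$ is a transcendental entire solution, with hyper-order $\rho_2(f)<1$, of the equation $$f^2(z)f'(z)+U^*(z,f)=p_1e^{\gamma_1 z}+p_2e^{\gamma_2 z},$$ then the order of $f$ is $\rho(f)=1$, and one of the following holds: (i) $2T(r,f)\leq 3N\left(r,\frac{1}{f}\right)+S(r,f)$; (ii) $f(z)=c_1e^{\gamma_1 z/3}$, where $c_1=\left(\frac{3p_1}{\gamma_1}\right)^{1/3}$ is a constant, $p_2=\sum_{j=0}^{m}d_jc_1e^{\gamma_1 k_j/3}$, and $\frac{\gamma_1}{\gamma_2}=3$; (iii) $f(z)=c_2e^{\gamma_2 z/3}$, where $c_2=\left(\frac{3p_2}{\gamma_2}\right)^{1/3}$ is a constant, $p_1=\sum_{j=0}^{m}d_jc_2e^{\gamma_2 k_j/3}$, and $\frac{\gamma_2}{\gamma_1}=3$.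
   Context: Standard Nevanlinna theory notation is used: $T(r,f)$ is the Nevanlinna characteristic and $N(r,1/f)$ is the integrated counting function of zeros of $f$ (with multiplicity). The order and hyper-order are $\rho(f)=\limsup_{r\to\infty}\frac{\log T(r,f)}{\log r}$ and $\rho_2(f)=\limsup_{r\to\infty}\frac{\log\log T(r,f)}{\log r}$. $S(r,f)$ denotes any quantity satisfying $S(r,f)=o(T(r,f))$ as $r\to\infty$ outside a possible exceptional set of finite linear measure (not necessarily the same at each occurrence). A meromorphic function $g$ is a small function of $f$ if $T(r,g)=S(r,f)$. The cube roots $(3p_i/\gamma_i)^{1/3}$ denote some cube root. *)

(* Defs.v *)
From HB Require Import structures.
From mathcomp Require Import all_boot all_order all_algebra.
From mathcomp Require Import all_classical all_reals all_analysis.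
From mathcomp Require Export complex.
Set Implicit Arguments.
Unset Strict Implicit.
Unset Printing Implicit Defensive.
Import Order.TTheory GRing.Theory Num.Theory.
Import numFieldNormedType.Exports.
Import Normc.
Local Open Scope classical_set_scope.
Local Open Scope complex_scope.
Local Open Scope ring_scope.

Section ComplexFunctions.
Context {R : realType}.
Implicit Types (f g : R[i] -> R[i]) (z w : R[i]) (r t : R).

Definition cexp z : R[i] :=
  (expR (complex.Re z))%:C * (cos (complex.Im z) +i* sin (complex.Im z)).

(* [R[i]^o] is R[i] as a normed module over itself, so that derivability is
   complex differentiability. *)
Definition entire f : Prop := forall z, derivable (f : R[i]^o -> R[i]^o) z 1.

Definition transcendental_entire f : Prop :=
  entire f /\ ~ exists p : {poly R[i]}, forall z, f z = p.[z].

(* U^*(z, f) *)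
Definition linear_difference m (d k : 'I_m.+1 -> R[i]) f z : R[i] :=
  \sum_(j < m.+1) d j * f (z + k j).

(* [has_order f z n]: f is meromorphic at z with leading Laurent exponent n.
   The value of f at z itself is irrelevant, so that this applies to functions
   with poles (and to pointwise inverses) in spite of totality. *)
Definition has_order f z (n : int) : Prop :=
  exists g, [/\ \forall w \near (z : R[i]^o),
                  derivable (g : R[i]^o -> R[i]^o) w 1,
                g z != 0 &
                \forall w \near (z : R[i]^o)^', f w = (w - z) ^ n * g w].

(* Multiplicity of z as a pole of f; it is 0 if z is not a pole. *)
Definition pole_mult f z : nat :=
  xget 0%N [set n : nat | has_order f z (- n%:Z)].

(* n(t, f).  The sum has finite support when f is meromorphic in the plane. *)
Definition npoles f t : R :=
  \sum_(z \in [set z : R[i] | normc z <= t]) ((pole_mult f z)%:R : R).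

(* N(r, f), with poles counted with multiplicity.  Thus N(r, 1/f), the
   integrated counting function of the zeros of f, is
   [Ncount (fun z => (f z)^-1) r]. *)
Definition Ncount f r : R :=
  \int[lebesgue_measure]_(t in `]0, r]) ((npoles f t - npoles f 0) / t)
  + npoles f 0 * ln r.

(* log^+; ln 0 = 0, hence logp 0 = 0. *)
Definition logp (x : R) : R := Num.max 0 (ln x).

(* m(r, f) *)
Definition proximity f r : R :=
  (2 * pi)^-1 * \int[lebesgue_measure]_(theta in `[0, 2 * pi])
    logp (normc (f (r%:C * cexp (0 +i* theta)))).

(* T(r, f) *)
Definition Tchar f r : R := proximity f r + Ncount f r.

(* Since T(r, f) tends to +oo for every nonconstant entire f, the convention
   ln x = 0 for x <= 0 does not affect the two upper limits below. *)
Definition growth_order f : \bar R :=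
  limf_esup (fun r => (ln (Tchar f r) / ln r)%:E) (pinfty_nbhs R).

Definition hyper_order f : \bar R :=
  limf_esup (fun r => (ln (ln (Tchar f r)) / ln r)%:E) (pinfty_nbhs R).

(* [small_error f S]: S(r) = S(r, f), i.e., S(r) = o(T(r, f)) as r tends to
   +oo outside some set E of finite linear measure. *)
Definition small_error f (S : R -> R) : Prop :=
  exists E : set R,
    [/\ measurable E, (lebesgue_measure E < +oo)%E &
        forall eps : R, 0 < eps ->
          \forall r \near +oo, ~ E r -> `|S r| <= eps * Tchar f r].

End ComplexFunctions.

(* Main.v *)
(* Let L = (D - gamma1)(D - gamma2), which annihilates the right-hand side, so that H = L(f^2 f') = - L(U^* f).
   Integrating the equation gives M(r)^3 <= C + C r (e^(C r) + M(r + K)) for the maximum modulus M; if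
   M(r) > e^(A r) with A large, then M(r + n K) >= e^(2^n) for all n, against hyper-order < 1.
   Thus T(r, f) = O(r), while the right-hand side forces T(r, f) >= c r; hence the order is 1.

   If H <> 0, choose a radius R slightly larger than r. The Poisson integral of ln |f| over |z| = R yields E >= 0 on
   |z| = r with |f(z + c)| <= |f(z)| e^E(z) for all bounded c, and the mean of E over |z| = r is o(r). Cauchy's estimates
   then give |H| <= C |f| e^E and |H| <= C |f|^3 e^(3E), that is,
   ln |H| <= C + 3 E + min(ln |f|, 3 ln |f|) = C + 3 E + 3 ln |f| - 2 log^+ |f|.
   Taking means over |z| = r and using Jensen's formula, 2 T(r, f) <= 3 N(r, 1/f) + o(r).

   If H = 0, then D(f^2 f') - gamma_i f^2 f' is a multiple of an exponential and vanishes at every zero of f; a zero of f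
   would make f^2 f' vanish identically. So f has no zeros and finite exponential type, f = c e^(a z), and linear
   independence of exponentials determines a and c. *)
Require Import Defs.
From mathcomp Require Import all_boot all_order all_algebra.
From mathcomp Require Import all_classical all_reals all_analysis.
From mathcomp Require Import ring lra.
Set Implicit Arguments.
Unset Strict Implicit.
Unset Printing Implicit Defensive.
Import Order.TTheory GRing.Theory Num.Theory.
Import numFieldNormedType.Exports.
Import Normc.
Local Open Scope classical_set_scope.
Local Open Scope complex_scope.
Local Open Scope ring_scope.

(** * Complex differentiability and integrals of real functions *)

Section ComplexModulus.
Context {R : realType}.
Implicit Types (x y z w : R[i]) (a b : R).
Local Notation nm := (@normc R).

(** The mean of [E] is o(r) because the larger radius R is chosen with R - r between e r / 2 and e
    r, for a fixed small e. Since f has finite exponential type, it has O(r) zeros in a disc of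
    radius O(r), so by Jensen's formula the mean of ln |f| grows by only O(e r) from r to R; the
    oscillation of the Poisson integral under translations of bounded length is O(1 / e^2), a bound
    free of r. The condition H <> 0 enters through the mean of ln |H|, which is nondecreasing in r
    and hence bounded below. The lower bound T(r, f) >= c r then turns an error o(r) into S(r, f).
    Since ln 0 = 0 makes ln |f| discontinuous at the zeros of f, these means are taken only over
    circles that avoid the zeros of f and H. The excluded radii are countable, which gives a null
    exceptional set. The lower bound on T is likewise obtained only on zero-free radii, and their
    density suffices for an upper limit. *)

Lemma nmD x y : nm (x + y) <= nm x + nm y.
Proof. exact: le_normcD. Qed.

Lemma nmN x : nm (- x) = nm x.
Proof. exact: (normcN x). Qed.

Lemma nmM x y : nm (x * y) = nm x * nm y.
Proof. exact: normcM. Qed.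

Lemma nmV x : nm x^-1 = (nm x)^-1.
Proof. exact: normcV. Qed.

Lemma nm0 : nm 0 = 0. Proof. exact: normc0. Qed.
Lemma nm1 : nm 1 = 1. Proof. exact: normc1. Qed.

Lemma nmB x y : nm (x - y) <= nm x + nm y.
Proof. by rewrite -[nm y]nmN nmD. Qed.

Lemma nm_distC x y : nm (x - y) = nm (y - x).
Proof. by rewrite -nmN opprB. Qed.

Lemma nm_ge0 x : 0 <= nm x.
Proof. by case: x => a b; rewrite sqrtr_ge0. Qed.

Lemma nm_eq0 x : (nm x == 0) = (x == 0).
Proof.
by apply/eqP/eqP => [/eq0_normc //|->]; exact: nm0.
Qed.

Lemma nm_gt0 x : (0 < nm x) = (x != 0).
Proof. by rewrite lt_def nm_ge0 andbT nm_eq0. Qed.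

Lemma nmR a : nm a%:C = `|a|.
Proof. by rewrite /= expr0n /= addr0 sqrtr_sqr. Qed.

Lemma nm_Re z : `|complex.Re z| <= nm z.
Proof.
by case: z => a b /=; rewrite -sqrtr_sqr ler_wsqrtr // lerDl sqr_ge0.
Qed.

Lemma nm_Im z : `|complex.Im z| <= nm z.
Proof.
by case: z => a b /=; rewrite -sqrtr_sqr ler_wsqrtr // lerDr sqr_ge0.
Qed.

Lemma nm_ReIm z : nm z <= `|complex.Re z| + `|complex.Im z|.
Proof.
case: z => a b /=; rewrite -[leRHS]ger0_norm ?addr_ge0 // -sqrtr_sqr ler_wsqrtr //.
rewrite -(real_normK (num_real a)) -(real_normK (num_real b)).
have := normr_ge0 a; have := normr_ge0 b; nra.
Qed.

Lemma nm_sqr z : nm z ^+ 2 = complex.Re z ^+ 2 + complex.Im z ^+ 2.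
Proof. by case: z => a b /=; rewrite sqr_sqrtr // addr_ge0 ?sqr_ge0. Qed.

Lemma nmX x n : nm (x ^+ n) = nm x ^+ n.
Proof. by elim: n => [|n IH]; rewrite ?nm1 // !exprS nmM IH. Qed.

Lemma nmJ z : nm z^* = nm z.
Proof. by case: z => a b /=; rewrite sqrrN. Qed.

Lemma nm_lerB x y : nm x - nm y <= nm (x - y).
Proof. by rewrite lerBlDr -{1}(subrK y x) nmD. Qed.

Lemma nm_lerBD x y : nm x - nm y <= nm (x + y).
Proof. by rewrite -(nmN y) -{2}(opprK y) nm_lerB. Qed.

Lemma nm_dist_norm x y : `|nm x - nm y| <= nm (x - y).
Proof.
by have h := nm_lerB y x; rewrite nm_distC in h; rewrite ler_norml nm_lerB andbT; lra.
Qed.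

Lemma nm_sum (I : Type) (r : seq I) (F : I -> R[i]) :
  nm (\sum_(i <- r) F i) <= \sum_(i <- r) nm (F i).
Proof.
elim/big_rec2: _ => [|i y1 y2 _ h]; first by rewrite nm0.
by rewrite (le_trans (nmD _ _)) // lerD2l.
Qed.

Lemma nm_prod (I : Type) (r : seq I) (F : I -> R[i]) :
  nm (\prod_(i <- r) F i) = \prod_(i <- r) nm (F i).
Proof.
elim/big_rec2: _ => [|i y1 y2 _ h]; first by rewrite nm1.
by rewrite nmM h.
Qed.

Lemma mulJ z : z * z^* = (nm z ^+ 2)%:C.
Proof.
rewrite nm_sqr; case: z => a b /=; apply/eqP; rewrite eq_complex /=.
by apply/andP; split; apply/eqP; ring.
Qed.

Lemma reM x y : complex.Re (x * y) =
  complex.Re x * complex.Re y - complex.Im x * complex.Im y.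
Proof. by case: x => a b; case: y. Qed.

Lemma imM x y : complex.Im (x * y) =
  complex.Re x * complex.Im y + complex.Im x * complex.Re y.
Proof. by case: x => a b; case: y. Qed.

Lemma reD x y : complex.Re (x + y) = complex.Re x + complex.Re y.
Proof. by case: x => a b; case: y. Qed.
Lemma imD x y : complex.Im (x + y) = complex.Im x + complex.Im y.
Proof. by case: x => a b; case: y. Qed.
Lemma reN x : complex.Re (- x) = - complex.Re x.
Proof. by case: x. Qed.
Lemma imN x : complex.Im (- x) = - complex.Im x.
Proof. by case: x. Qed.

Lemma complex_eq x y : complex.Re x = complex.Re y -> complex.Im x = complex.Im y ->
  x = y.
Proof. by case: x => a b; case: y => c d /= -> ->. Qed.

Lemma realC_D a b : (a + b)%:C = a%:C + b%:C.
Proof. by rewrite -complexr0; apply: complex_eq; rewrite /= ?addr0. Qed.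
Lemma realC_M a b : (a * b)%:C = a%:C * b%:C.
Proof. by apply: complex_eq => /=; ring. Qed.
Lemma realC_N a : (- a)%:C = - a%:C.
Proof. by apply: complex_eq => /=; ring. Qed.
Lemma realC_B a b : (a - b)%:C = a%:C - b%:C.
Proof. by rewrite realC_D realC_N. Qed.
Lemma realC_eq0 a : (a%:C == 0) = (a == 0).
Proof. by rewrite -nm_eq0 nmR normr_eq0. Qed.
Lemma realC_V a : (a^-1)%:C = a%:C^-1.
Proof.
have [->|a0] := eqVneq a 0; first by rewrite !invr0.
have a0' : a%:C != 0 by rewrite realC_eq0.
by apply: (mulfI a0'); rewrite mulfV // -realC_M mulfV.
Qed.

End ComplexModulus.

(** * Continuity and complex differentiability with real bounds *)

Section Derivatives.
Context {R : realType}.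
Local Notation nm := (@normc R).
Implicit Types (f g h : R[i] -> R[i]) (z w l : R[i]).

(** The norm of [R[i]] takes its values in [R[i]], whereas [nm] is real. Real bounds keep every
    estimate in [R]; [cderiv_derivable] and [derivable_cderiv] relate [cderiv] to [derivable]. *)
Definition ccont f z := forall e : R, 0 < e ->
  exists2 d, 0 < d & forall w, nm (w - z) < d -> nm (f w - f z) < e.

Definition cderiv f z l := forall e : R, 0 < e ->
  exists2 d, 0 < d & forall w, nm (w - z) < d ->
    nm (f w - f z - l * (w - z)) <= e * nm (w - z).

Definition rderiv (p : R -> R) t (l : R) := forall e : R, 0 < e ->
  exists2 d, 0 < d & forall s, `|s - t| < d ->
    `|p s - p t - l * (s - t)| <= e * `|s - t|.

Definition pderiv (p : R -> R[i]) t l := forall e : R, 0 < e ->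
  exists2 d, 0 < d & forall s, `|s - t| < d ->
    nm (p s - p t - l * (s - t)%:C) <= e * `|s - t|.

Lemma ccont_near f g z : (exists2 d : R, 0 < d & forall w, nm (w - z) < d -> f w = g w) ->
  ccont f z -> ccont g z.
Proof.
move=> [d0 d00 fg] fc e /fc [d dp h]; exists (Num.min d d0); first by rewrite lt_min dp d00.
move=> w; rewrite lt_min => /andP[h1 h2]; rewrite -!fg //; first exact: h.
by rewrite subrr nm0.
Qed.

Lemma ccont_cst c z : ccont (fun=> c) z.
Proof. by move=> e e0; exists 1 => // w _; rewrite subrr nm0. Qed.

Lemma ccont_id z : ccont id z.
Proof. by move=> e e0; exists e. Qed.

Lemma ccontD f g z : ccont f z -> ccont g z -> ccont (fun w => f w + g w) z.
Proof.
move=> fc gc e e0; have e2 : 0 < e / 2 by lra.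
have [d1 d1p h1] := fc _ e2; have [d2 d2p h2] := gc _ e2.
exists (Num.min d1 d2); first by rewrite lt_min d1p.
move=> w; rewrite lt_min => /andP[/h1 k1 /h2 k2].
rewrite opprD addrACA; apply: (le_lt_trans (nmD _ _)); lra.
Qed.

Lemma ccontM f g z : ccont f z -> ccont g z -> ccont (fun w => f w * g w) z.
Proof.
move=> fc gc e e0; pose K := nm (f z) + nm (g z) + 2.
have f0 := nm_ge0 (f z); have g0 := nm_ge0 (g z).
have K0 : 0 < K by rewrite /K; lra.
have eK : 0 < Num.min 1 (e / K) by rewrite lt_min ltr01 divr_gt0.
have [d1 d1p h1] := fc _ eK; have [d2 d2p h2] := gc _ eK.
exists (Num.min d1 d2); first by rewrite lt_min d1p.
move=> w; rewrite lt_min => /andP[/h1 + /h2]; rewrite !lt_min => /andP[k1 k2] /andP[l1 l2].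
have -> : f w * g w - f z * g z = (f w - f z) * (g w - g z) + (f w - f z) * g z + f z * (g w - g z) by ring.
have p0 := nm_ge0 (f w - f z); have q0 := nm_ge0 (g w - g z).
apply: (le_lt_trans (nmD _ _)); apply: (le_lt_trans (lerD (nmD _ _) (lexx _))).
rewrite !nmM; move: k2 l2; rewrite !ltr_pdivlMr // /K; nra.
Qed.

Lemma ccontN f z : ccont f z -> ccont (fun w => - f w) z.
Proof.
by move=> fc e /fc [d dp h]; exists d => // w /h; rewrite -opprD nmN.
Qed.

Lemma ccontV f z : f z != 0 -> ccont f z -> ccont (fun w => (f w)^-1) z.
Proof.
move=> fz0 fc e e0; have k0 : 0 < nm (f z) by rewrite nm_gt0.
have m0 : 0 < Num.min (nm (f z) / 2) (e * nm (f z) ^+ 2 / 2).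
  by rewrite lt_min; apply/andP; split; rewrite !(divr_gt0, mulr_gt0, exprn_gt0).
have [d dp h] := fc _ m0; exists d => // w /h; rewrite lt_min => /andP[h1 h2].
have k1 : nm (f z) / 2 < nm (f w).
  have := nm_lerB (f z) (f w); rewrite nm_distC; lra.
have fw0 : f w != 0 by rewrite -nm_gt0; lra.
have -> : (f w)^-1 - (f z)^-1 = (f z - f w) * ((f w)^-1 * (f z)^-1).
  by field; rewrite fz0 fw0.
rewrite !nmM !nmV nm_distC -invfM ltr_pdivrMr; last by rewrite mulr_gt0 //; lra.
apply: (lt_trans h2); rewrite expr2 -mulrA ltr_pM2l //; nra.
Qed.

Lemma ccont_comp f g z : ccont f z -> ccont g (f z) -> ccont (fun w => g (f w)) z.
Proof.
move=> fc gc e /gc [d /fc [d' d'p h'] h]; exists d' => // w /h' /h; exact.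
Qed.

Lemma ccont_conj z : ccont (@conjc R) z.
Proof.
by move=> e e0; exists e => // w; rewrite -[nm (w - z)]nmJ rmorphB.
Qed.

Lemma ccont_bound f z : ccont f z -> exists2 d : R, 0 < d & forall w, nm (w - z) < d -> nm (f w) < nm (f z) + 1.
Proof.
move=> /(_ 1 ltr01) [d dp h]; exists d => // w /h k; have := nm_lerB (f w) (f z); lra.
Qed.

Lemma cderiv_near f g z l : (exists2 d : R, 0 < d & forall w, nm (w - z) < d -> f w = g w) ->
  cderiv f z l -> cderiv g z l.
Proof.
move=> [d0 d00 fg] fc e /fc [d dp h]; exists (Num.min d d0); first by rewrite lt_min dp d00.
move=> w; rewrite lt_min => /andP[h1 h2]; rewrite -!fg //; first exact: h.
by rewrite subrr nm0.
Qed.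

(** Caratheodory's criterion: [k] is the difference quotient, completed by [l] at [z]. It reduces
    the rules of differentiation to identities between continuous functions. *)
Lemma cderivP f z l :
  cderiv f z l <-> exists k, [/\ ccont k z, k z = l & forall w, f w = f z + k w * (w - z)].
Proof.
split=> [h|[k [kc kz fk]] e e0].
  exists (fun w => if w == z then l else (f w - f z) / (w - z)); split; rewrite ?eqxx //.
    move=> e e0; have e2 : 0 < e / 2 by lra.
    have [d dp hd] := h _ e2; exists d => // w wd; rewrite eqxx.
    have [wz|wz] := eqVneq w z; first by rewrite subrr nm0.
    have wz0 : w - z != 0 by rewrite subr_eq0.
    have n0 : 0 < nm (w - z) by rewrite nm_gt0.
    have -> : (f w - f z) / (w - z) - l = (f w - f z - l * (w - z)) / (w - z).
      by rewrite [RHS]mulrBl mulfK.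
    rewrite nmM nmV ltr_pdivrMr //; apply: le_lt_trans (hd _ wd) _; nra.
  move=> w; have [->|wz] := eqVneq w z; first by rewrite subrr mulr0 addr0.
  by rewrite mulfVK ?subr_eq0 // addrC subrK.
have [d dp h] := kc _ e0; exists d => // w wd.
have -> : f w - f z - l * (w - z) = (k w - k z) * (w - z) by rewrite fk kz; ring.
by rewrite nmM ler_wpM2r ?nm_ge0 // ltW //; exact: h.
Qed.

Lemma cderiv_cont f z l : cderiv f z l -> ccont f z.
Proof.
move=> /cderivP [k [kc _ fk]].
apply: (@ccont_near (fun w => f z + k w * (w - z))); first by exists 1 => // w _; rewrite -fk.
apply: ccontD; first exact: ccont_cst.
apply: ccontM => //; apply: ccontD; [exact: ccont_id|exact: ccont_cst].
Qed.

Lemma cderiv_cst c z : cderiv (fun=> c) z 0.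
Proof.
by move=> e e0; exists 1 => // w _; rewrite subrr mul0r subrr nm0 mulr_ge0 ?nm_ge0 // ltW.
Qed.

Lemma cderiv_id z : cderiv id z 1.
Proof.
by move=> e e0; exists 1 => // w _; rewrite mul1r subrr nm0 mulr_ge0 ?nm_ge0 // ltW.
Qed.

Lemma cderivD f g z l m : cderiv f z l -> cderiv g z m ->
  cderiv (fun w => f w + g w) z (l + m).
Proof.
move=> /cderivP [a [ac az fa]] /cderivP [b [bc bz gb]]; apply/cderivP.
exists (fun w => a w + b w); split; [exact: ccontD|by rewrite az bz|move=> w].
by rewrite fa gb; ring.
Qed.

Lemma cderivM f g z l m : cderiv f z l -> cderiv g z m ->
  cderiv (fun w => f w * g w) z (l * g z + f z * m).
Proof.
move=> df dg; move: (df) (dg) => /cderivP [a [ac az fa]] /cderivP [b [bc bz gb]]; apply/cderivP.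
exists (fun w => a w * g w + f z * b w); split; first last.
- by move=> w; rewrite mulrDl mulrAC -[f z * b w * _]mulrA; rewrite {1}fa gb; ring.
- by rewrite az bz.
- apply: ccontD; apply: ccontM => //; [exact: cderiv_cont dg|exact: ccont_cst].
Qed.

Lemma cderivN f z l : cderiv f z l -> cderiv (fun w => - f w) z (- l).
Proof.
move=> /cderivP [a [ac az fa]]; apply/cderivP.
exists (fun w => - a w); split; [exact: ccontN|by rewrite az|move=> w].
by rewrite fa; ring.
Qed.

Lemma cderivB f g z l m : cderiv f z l -> cderiv g z m ->
  cderiv (fun w => f w - g w) z (l - m).
Proof. by move=> df /cderivN dg; exact: (cderivD df dg). Qed.

Lemma cderivZ c f z l : cderiv f z l -> cderiv (fun w => c * f w) z (c * l).
Proof.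
by move=> df; rewrite -[c * l]add0r -[X in X + _](mul0r (f z)); apply: cderivM => //; exact: cderiv_cst.
Qed.

Lemma cderivV f z l : f z != 0 -> cderiv f z l ->
  cderiv (fun w => (f w)^-1) z (- l / f z ^+ 2).
Proof.
move=> fz0 df; have fc := cderiv_cont df.
move: (df) => /cderivP [a [ac az fa]].
have kz : 0 < nm (f z) by rewrite nm_gt0.
have [d0 d0p h0] := fc _ kz.
apply: (@cderiv_near (fun w => (f z)^-1 + (- a w * ((f w)^-1 * (f z)^-1)) * (w - z))).
  exists d0 => // w /h0 hw; have fw0 : f w != 0.
    apply/negP => /eqP fw; move: hw; rewrite fw sub0r nmN; lra.
  have -> : - a w * ((f w)^-1 / f z) * (w - z) = (f z - f w) * ((f w)^-1 / f z).
    by rewrite (fa w); ring.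
  by field; rewrite fz0 fw0.
apply/cderivP; exists (fun w => - a w * ((f w)^-1 * (f z)^-1)); split.
- apply: ccontM; first exact: ccontN.
  by apply: ccontM; [exact: ccontV|exact: ccont_cst].
- by rewrite az expr2 invfM.
- by move=> w; rewrite subrr mulr0 addr0.
Qed.

Lemma cderiv_comp f g z l m : cderiv f z l -> cderiv g (f z) m ->
  cderiv (fun w => g (f w)) z (m * l).
Proof.
move=> df dg; move: (df) (dg) => /cderivP [a [ac az fa]] /cderivP [b [bc bz gb]]; apply/cderivP.
exists (fun w => b (f w) * a w); split; first last.
- move=> w; rewrite (gb (f w)); have -> : f w - f z = a w * (w - z) by rewrite fa; ring.
  by ring.
- by rewrite az bz.
- by apply: ccontM => //; apply: ccont_comp => //; exact: cderiv_cont df.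
Qed.

Lemma cderiv_uniq f z l m : cderiv f z l -> cderiv f z m -> l = m.
Proof.
move=> h1 h2; apply/eqP; rewrite -subr_eq0 -nm_eq0; apply/negP => /negP n0.
have e0 : 0 < nm (l - m) / 4 by rewrite divr_gt0 // lt_def n0 nm_ge0.
have [d1 d1p k1] := h1 _ e0; have [d2 d2p k2] := h2 _ e0.
pose d := Num.min d1 d2; have dp : 0 < d by rewrite lt_min d1p.
have dw : nm ((z + (d / 2)%:C) - z) = d / 2 by rewrite addrAC subrr add0r nmR gtr0_norm //; lra.
have l1 := k1 (z + (d / 2)%:C); have l2 := k2 (z + (d / 2)%:C); rewrite dw in l1 l2.
have dd1 : d / 2 < d1.
  by have : d <= d1 by [rewrite /d ge_min lexx]; lra.
have dd2 : d / 2 < d2.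
  by have : d <= d2 by [rewrite /d ge_min lexx orbT]; lra.
have {}l1 := l1 dd1; have {}l2 := l2 dd2.
set D := f _ - f z in l1 l2; set W := z + _ - z in l1 l2 dw.
have : nm ((l - m) * W) <= nm (D - l * W) + nm (D - m * W).
  have -> : (l - m) * W = (D - m * W) - (D - l * W) by ring.
  by rewrite [leRHS]addrC nmB.
rewrite nmM dw; nra.
Qed.

End Derivatives.

(** * Oriented integrals of continuous real functions *)

Section RealIntegral.
Context {R : realType}.
Local Notation nm := (@normc R).
Local Notation mu := (@lebesgue_measure R).
Implicit Types (p q : R -> R) (a b t : R).

Lemma rcontP p : (forall t, forall e : R, 0 < e -> exists2 d, 0 < d &
    forall s, `|s - t| < d -> `|p s - p t| < e) <-> continuous p.
Proof.
split=> [h t|h t e e0].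
  apply/cvgrPdist_lt => e /(h t) [d d0 k]; near=> s; rewrite distrC; apply: k.
  by rewrite distrC; near: s; exact: cvgr_dist_lt.
have /cvgrPdist_lt/(_ _ e0) := h t.
move=> /nbhs_ballP [d /= d0 k]; exists d => // s st; rewrite distrC; apply: k.
by rewrite /ball /= distrC.
Unshelve. all: by end_near. Qed.

Lemma rderivP p t l : rderiv p t l <-> is_derive t 1 p l.
Proof.
split=> [h|[dp dl] e e0].
  suff k : (h^-1 *: (p (h *: 1 + t) - p t) @[h --> 0^'] --> l).
    by apply: DeriveDef; [exact: cvgP k|exact: cvg_lim k].
  apply/cvgrPdist_le => e /h [d d0 k]; near=> s.
  have s0 : s != 0 by near: s; exact: nbhs_dnbhs_neq.
  have sd : `|s| < d by near: s; exact: dnbhs0_lt.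
  have := k (s + t); rewrite addrK => /(_ sd) {}k.
  have sp : 0 < `|s| by rewrite normr_gt0.
  rewrite -(ler_pM2r sp) -normrM; apply: le_trans k; rewrite -normrN /GRing.scale /=.
  by rewrite mulr1 le_eqVlt; apply/orP; left; apply/eqP; congr (`|_|); field.
have k : (h^-1 *: (p (h *: 1 + t) - p t) @[h --> 0^'] --> l).
  by rewrite -dl; exact: dp.
have /cvgrPdist_le/(_ _ e0) := k.
move=> /nbhs_ballP [d /= d0 kk]; exists d => // s st.
have [->|snt] := eqVneq s t; first by rewrite !subrr mulr0 subrr normr0 mulr0.
have s0 : s - t != 0 by rewrite subr_eq0.
have := kk (s - t); rewrite /ball /= sub0r normrN => /(_ st s0).
have sp : 0 < `|s - t| by rewrite normr_gt0.
rewrite -(ler_pM2r sp) -normrM; apply: le_trans.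
rewrite -normrN /GRing.scale /= mulr1 subrK.
by rewrite le_eqVlt; apply/orP; left; apply/eqP; congr (`|_|); field.
Unshelve. all: by end_near. Qed.

Definition btw a b t := (a <= t <= b) || (b <= t <= a).

Lemma btwC a b t : btw a b t = btw b a t.
Proof. by rewrite /btw orbC. Qed.

Lemma rderiv_mono p p' a b : a <= b -> (forall t, a <= t <= b -> rderiv p t (p' t)) ->
  (forall t, a <= t <= b -> 0 <= p' t) -> p a <= p b.
Proof.
move=> ab dp p0.
have [||c] := @MVT_segment R p p' a b ab.
- move=> x; rewrite in_itv /= => /andP[x1 x2]; apply/rderivP/dp.
  by rewrite (ltW x1) ltW.
- apply: derivable_within_continuous => x; rewrite in_itv /= => /dp /rderivP []; done.
by rewrite in_itv /= => /p0 c0 e; rewrite -subr_ge0 e mulr_ge0 // subr_ge0.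
Qed.

Lemma rderivD p q t l m : rderiv p t l -> rderiv q t m -> rderiv (fun s => p s + q s) t (l + m).
Proof. by move=> /rderivP h1 /rderivP h2; apply/rderivP; exact: is_deriveD. Qed.

Lemma rderivZ c p t l : rderiv p t l -> rderiv (fun s => c * p s) t (c * l).
Proof. by move=> /rderivP h1; apply/rderivP; exact: (is_deriveZ c). Qed.

Lemma rderivB p q t l m : rderiv p t l -> rderiv q t m -> rderiv (fun s => p s - q s) t (l - m).
Proof. by move=> /rderivP h1 /rderivP h2; apply/rderivP; exact: is_deriveB. Qed.

Lemma rderiv_cst (c : R) t : rderiv (fun=> c) t 0.
Proof. by apply/rderivP; exact: is_derive_cst. Qed.

Lemma rderiv_id t : rderiv (fun s : R => s) t 1.
Proof. by apply/rderivP; exact: is_derive_id. Qed.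

Lemma rderiv_near p q t l : (exists2 d : R, 0 < d & forall s, `|s - t| < d -> p s = q s) ->
  rderiv p t l -> rderiv q t l.
Proof.
move=> [d0 d00 pq] h e /h [d dp k]; exists (Num.min d d0); first by rewrite lt_min dp d00.
move=> w; rewrite lt_min => /andP[h1 h2]; rewrite -!pq //; first exact: k.
by rewrite subrr normr0.
Qed.

(** One of the two intervals is empty or a point, so this is the primitive vanishing at 0 on both
    half-lines. Hence [rint] is an oriented integral, and Chasles' relation is an identity between
    differences. *)
Definition rprim p x := (\int[mu]_(t in `[0, x]) p t - \int[mu]_(t in `[x, 0]) p t)%R.

Definition rint p a b := rprim p b - rprim p a.

Lemma cont_integrable p a b : continuous p -> mu.-integrable `[a, b] (EFin \o p).
Proof.
move=> pc; apply: continuous_compact_integrable; first exact: segment_compact.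
exact: continuous_subspaceT.
Qed.

Lemma cont_Rintegral_sub p a b c : continuous p -> a <= b -> b <= c ->
  (\int[mu]_(t in `[a, c]) p t - \int[mu]_(t in `[a, b]) p t = \int[mu]_(t in `[b, c]) p t)%R.
Proof.
move=> pc ab bc; rewrite Rintegral_itvB //; last exact: cont_integrable.
rewrite Rintegral_itv_obnd_cbnd //.
apply: integrableS (cont_integrable b c pc) => //.
by apply: subset_itvr; rewrite bnd_simp.
Qed.

Lemma rprimE p a x : continuous p -> a <= 0 -> a <= x ->
  rprim p x = (\int[mu]_(t in `[a, x]) p t - \int[mu]_(t in `[a, 0]) p t)%R.
Proof.
move=> pc a0 ax; rewrite /rprim; have [x0|x0] := leP 0 x.
  rewrite (cont_Rintegral_sub pc a0 x0).
  move: x0; rewrite le_eqVlt => /orP[/eqP <-|x0].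
    by rewrite set_itv1 Rintegral_set1 subrr.
  rewrite [X in _ - X](_ : _ = 0) ?subr0 //.
  by rewrite set_itv_ge ?Rintegral_set0 // bnd_simp -ltNge.
rewrite -(cont_Rintegral_sub pc ax (ltW x0)).
rewrite [X in X - _](_ : _ = 0); first by rewrite sub0r opprB.
by rewrite set_itv_ge ?Rintegral_set0 // bnd_simp -ltNge.
Qed.

(** The fundamental theorem is applied with a fixed left end [a], placed to the left of both [t] and
    0, so that near [t] the primitive is a single integral minus a constant. *)
Lemma rprim_deriv p t : continuous p -> rderiv (rprim p) t (p t).
Proof.
move=> pc; pose a := - (`|t| + 1).
have ta : a < t by have := ler_norm (- t); rewrite normrN /a; lra.
have a0 : a <= 0 by have := normr_ge0 t; rewrite /a; lra.
apply: (@rderiv_near (fun x => (\int[mu]_(t in `[a, x]) p t - \int[mu]_(t in `[a, 0]) p t)%R)).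
  exists (t - a); first by rewrite subr_gt0.
  move=> s st; rewrite (@rprimE p a) //.
  by have := ler_norm (- (s - t)); rewrite normrN; lra.
rewrite -[p t]subr0; apply: rderivB; last exact: rderiv_cst.
apply/rderivP.
have tt : t < t + 1 by rewrite ltrDl.
have := @continuous_FTC1 R p (BLeft a) t (t + 1) tt (cont_integrable a (t + 1) pc).
have bt : (a%:E < t%:E)%E by rewrite lte_fin.
move=> /= /(_ bt (pc t)) [h1 h2].
by apply: DeriveDef; [exact: h1|rewrite -derive1E; exact: h2].
Qed.

Lemma Rintegral_rint p a b : continuous p -> a <= b ->
  (\int[mu]_(t in `[a, b]) p t = rint p a b)%R.
Proof.
move=> pc ab; pose c := Num.min a 0.
have ca : c <= a by rewrite ge_min lexx.
have c0 : c <= 0 by rewrite ge_min lexx orbT.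
rewrite /rint (rprimE pc c0 ca) (rprimE pc c0 (le_trans ca ab)).
rewrite -(cont_Rintegral_sub pc ca ab); ring.
Qed.

Lemma rint_FTC p F a b : continuous p -> (forall t, btw a b t -> rderiv F t (p t)) ->
  rint p a b = F b - F a.
Proof.
move=> pc; wlog ab : a b / a <= b.
  move=> h dF; have [ab|/ltW ba] := leP a b; first exact: h.
  have hh : rint p b a = F a - F b by apply: h => // t; rewrite btwC; exact: dF.
  by move: hh; rewrite /rint; lra.
move=> dF.
(* The difference of the two primitives has derivative 0; monotonicity of it and of its opposite
   makes it constant. *)
have D t : a <= t <= b -> rderiv (fun s => rprim p s - F s) t (p t - p t).
  by move=> tab; apply: rderivB; [exact: rprim_deriv|apply: dF; rewrite /btw tab].
have h1 : rprim p a - F a <= rprim p b - F b.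
  by apply: (rderiv_mono ab D) => t _; rewrite subrr.
have h2 : -1 * (rprim p a - F a) <= -1 * (rprim p b - F b).
  apply: (@rderiv_mono (fun s => -1 * (rprim p s - F s)) (fun t => -1 * (p t - p t)) a b ab).
    by move=> t /D; exact: rderivZ.
  by move=> t _; rewrite subrr mulr0.
rewrite /rint; lra.
Qed.

Lemma rint_chasles p b a c : rint p a c = rint p a b + rint p b c.
Proof. by rewrite /rint; ring. Qed.

Lemma rintxx p a : rint p a a = 0.
Proof. by rewrite /rint subrr. Qed.

Lemma rintD p q a b : continuous p -> continuous q ->
  rint (fun t => p t + q t) a b = rint p a b + rint q a b.
Proof.
move=> pc qc; rewrite (@rint_FTC _ (fun x => rprim p x + rprim q x)); first by rewrite /rint; ring.
  by move=> x; apply: cvgD; [exact: pc|exact: qc].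
by move=> t _; apply: rderivD; exact: rprim_deriv.
Qed.

Lemma rintZ c p a b : continuous p ->
  rint (fun t => c * p t) a b = c * rint p a b.
Proof.
move=> pc; rewrite (@rint_FTC _ (fun x => c * rprim p x)); first by rewrite /rint; ring.
  by move=> x; apply: cvgMr; exact: pc.
by move=> t _; apply: rderivZ; exact: rprim_deriv.
Qed.

Lemma rint_cst (c : R) a b : rint (fun=> c) a b = c * (b - a).
Proof.
rewrite (@rint_FTC _ (fun x => c * x)); first by ring.
  by move=> x; exact: cvg_cst.
by move=> t _; rewrite -[X in rderiv _ _ X]mulr1; apply: rderivZ; exact: rderiv_id.
Qed.

Lemma rint_ext p q a b : p =1 q -> rint p a b = rint q a b.
Proof. by move=> /funext ->. Qed.

Lemma rintB p q a b : continuous p -> continuous q ->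
  rint (fun t => p t - q t) a b = rint p a b - rint q a b.
Proof.
move=> pc qc; rewrite (@rint_ext _ (fun t => p t + (-1) * q t)); last by move=> t; ring.
rewrite rintD // ?rintZ //; first by ring.
by move=> x; apply: cvgMr; exact: qc.
Qed.

Lemma rint_le p q a b : continuous p -> continuous q -> a <= b ->
  (forall t, a <= t <= b -> p t <= q t) -> rint p a b <= rint q a b.
Proof.
move=> pc qc ab pq; rewrite -subr_ge0 /rint.
have : rprim q a - rprim p a <= rprim q b - rprim p b.
  apply: (@rderiv_mono (fun s => rprim q s - rprim p s) (fun s => q s - p s) a b ab).
    by move=> t _; apply: rderivB; exact: rprim_deriv.
  by move=> t /pq; rewrite subr_ge0.
lra.
Qed.

End RealIntegral.

(** * Goursat's theorem and primitives *)

#[local] Arguments normc : simpl never.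

Section PathIntegral.
Context {R : realType}.
Local Notation nm := (@normc R).
Implicit Types (p q : R -> R[i]) (a b d t : R) (c l z : R[i]).

Definition pcont p := forall t, forall e : R, 0 < e ->
  exists2 d, 0 < d & forall s, `|s - t| < d -> nm (p s - p t) < e.

Definition cint p a b : R[i] :=
  rint (fun t => complex.Re (p t)) a b +i* rint (fun t => complex.Im (p t)) a b.

Lemma pcont_Re p : pcont p -> continuous (fun t => complex.Re (p t)).
Proof.
move=> pc; apply/rcontP => t e /(pc t) [d dp h]; exists d => // s /h.
by apply: le_lt_trans; rewrite -reN -reD nm_Re.
Qed.

Lemma pcont_Im p : pcont p -> continuous (fun t => complex.Im (p t)).
Proof.
move=> pc; apply/rcontP => t e /(pc t) [d dp h]; exists d => // s /h.
by apply: le_lt_trans; rewrite -imN -imD nm_Im.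
Qed.

Lemma pcont_nm p : pcont p -> continuous (fun t => nm (p t)).
Proof.
move=> pc; apply/rcontP => t e /(pc t) [d dp h]; exists d => // s /h.
by apply: le_lt_trans; exact: nm_dist_norm.
Qed.

Lemma pcont_comp (F : R[i] -> R[i]) p : (forall t, ccont F (p t)) -> pcont p -> pcont (fun t => F (p t)).
Proof.
move=> Fc pc t e /(Fc t) [d /(pc t) [d' d'p h'] h]; exists d' => // s /h' /h; exact.
Qed.

Lemma pcont_cst c : pcont (fun=> c).
Proof. by move=> t e e0; exists 1 => // s _; rewrite subrr nm0. Qed.

Lemma pcontD p q : pcont p -> pcont q -> pcont (fun t => p t + q t).
Proof.
move=> fc gc t e e0; have e2 : 0 < e / 2 by lra.
have [d1 d1p h1] := fc t _ e2; have [d2 d2p h2] := gc t _ e2.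
exists (Num.min d1 d2); first by rewrite lt_min d1p.
move=> w; rewrite lt_min => /andP[/h1 k1 /h2 k2].
rewrite opprD addrACA; apply: (le_lt_trans (nmD _ _)); lra.
Qed.

Lemma pcontM p q : pcont p -> pcont q -> pcont (fun t => p t * q t).
Proof.
move=> fc gc t e e0; pose K := nm (p t) + nm (q t) + 2.
have f0 := nm_ge0 (p t); have g0 := nm_ge0 (q t).
have K0 : 0 < K by rewrite /K; lra.
have eK : 0 < Num.min 1 (e / K) by rewrite lt_min ltr01 divr_gt0.
have [d1 d1p h1] := fc t _ eK; have [d2 d2p h2] := gc t _ eK.
exists (Num.min d1 d2); first by rewrite lt_min d1p.
move=> w; rewrite lt_min => /andP[/h1 + /h2]; rewrite !lt_min => /andP[k1 k2] /andP[l1 l2].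
have -> : p w * q w - p t * q t = (p w - p t) * (q w - q t) + (p w - p t) * q t + p t * (q w - q t) by ring.
have p0 := nm_ge0 (p w - p t); have q0 := nm_ge0 (q w - q t).
apply: (le_lt_trans (nmD _ _)); apply: (le_lt_trans (lerD (nmD _ _) (lexx _))).
rewrite !nmM; move: k2 l2; rewrite !ltr_pdivlMr // /K; nra.
Qed.

Lemma pcont_real (u : R -> R) : continuous u -> pcont (fun t => (u t)%:C).
Proof.
move=> /rcontP uc t e /(uc t) [d dp h]; exists d => // s /h.
by rewrite -realC_B nmR.
Qed.

Lemma pderiv_cont p l t : pderiv p t l -> forall e : R, 0 < e ->
  exists2 d, 0 < d & forall s, `|s - t| < d -> nm (p s - p t) < e.
Proof.
move=> h e e0; have [d dp k] := h 1 ltr01.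
have l0 := nm_ge0 l; have m0 : 0 < nm l + 2 by lra.
exists (Num.min d (e / (nm l + 2))); first by rewrite lt_min dp divr_gt0.
move=> s; rewrite lt_min ltr_pdivlMr // => /andP[/k k1 k2].
have := nm_lerB (p s - p t) (l * (s - t)%:C); rewrite nmM nmR.
have := normr_ge0 (s - t); nra.
Qed.

Lemma pderiv_pcont p p' : (forall t, pderiv p t (p' t)) -> pcont p.
Proof. by move=> h t; exact: (pderiv_cont (h t)). Qed.

Lemma pderiv_Re p t l : pderiv p t l -> rderiv (fun s => complex.Re (p s)) t (complex.Re l).
Proof.
move=> h e /h [d dp k]; exists d => // s /k; apply: le_trans.
apply: le_trans (nm_Re _); rewrite !reD !reN reM /=.
by rewrite mulr0 subr0.
Qed.

Lemma pderiv_Im p t l : pderiv p t l -> rderiv (fun s => complex.Im (p s)) t (complex.Im l).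
Proof.
move=> h e /h [d dp k]; exists d => // s /k; apply: le_trans.
apply: le_trans (nm_Im _); rewrite !imD !imN imM /=.
by rewrite mulr0 add0r.
Qed.

Lemma pderiv_ReIm p t l : rderiv (fun s => complex.Re (p s)) t (complex.Re l) ->
  rderiv (fun s => complex.Im (p s)) t (complex.Im l) -> pderiv p t l.
Proof.
move=> hr hi e e0; have e2 : 0 < e / 2 by lra.
have [d1 d1p h1] := hr _ e2; have [d2 d2p h2] := hi _ e2.
exists (Num.min d1 d2); first by rewrite lt_min d1p.
move=> s; rewrite lt_min => /andP[/h1 k1 /h2 k2].
apply: (le_trans (nm_ReIm _)); rewrite !reD !reN reM !imD !imN imM /=.
rewrite !mulr0 subr0 add0r; lra.
Qed.

Lemma pderiv_comp (F : R[i] -> R[i]) p t l m : cderiv F (p t) m -> pderiv p t l ->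
  pderiv (fun s => F (p s)) t (m * l).
Proof.
move=> dF dp e e0.
have l0 := nm_ge0 l; have m0 := nm_ge0 m.
pose e1 := Num.min 1 (e / (nm l + nm m + 2)).
have K0 : 0 < nm l + nm m + 2 by lra.
have e10 : 0 < e1 by rewrite lt_min ltr01 divr_gt0.
have e11 : e1 <= 1 by rewrite ge_min lexx.
have e1e : e1 * (nm l + nm m + 2) <= e.
  by rewrite -ler_pdivlMr // ge_min lexx orbT.
have [d dp0 h] := dF _ e10.
have [d1 d1p h1] := dp _ e10.
have [d2 d2p h2] := pderiv_cont dp dp0.
exists (Num.min d1 d2); first by rewrite lt_min d1p.
move=> s; rewrite lt_min => /andP[/h1 k1 /h2 k2].
have k3 := h _ k2.
have n1 : nm (p s - p t) <= (nm l + 1) * `|s - t|.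
  have := nm_lerB (p s - p t) (l * (s - t)%:C); rewrite nmM nmR.
  have := normr_ge0 (s - t); nra.
have -> : F (p s) - F (p t) - m * l * (s - t)%:C =
  (F (p s) - F (p t) - m * (p s - p t)) + m * (p s - p t - l * (s - t)%:C) by ring.
apply: (le_trans (nmD _ _)); rewrite nmM.
have s0 := normr_ge0 (s - t).
have : e1 * (nm l + nm m + 2) * `|s - t| <= e * `|s - t| by rewrite ler_wpM2r.
nra.
Qed.

Lemma pderiv_segment z c t : pderiv (fun s => z + s%:C * c) t c.
Proof.
move=> e e0; exists 1 => // s _; rewrite realC_B.
have -> : z + s%:C * c - (z + t%:C * c) - c * (s%:C - t%:C) = 0 by ring.
by rewrite nm0 mulr_ge0 // ltW.
Qed.

Lemma cint_FTC p F a b : pcont p -> (forall t, btw a b t -> pderiv F t (p t)) ->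
  cint p a b = F b - F a.
Proof.
move=> pc dF; apply: complex_eq; rewrite /= ?reD ?reN ?imD ?imN.
  apply: (@rint_FTC _ _ (fun t => complex.Re (F t))); first exact: pcont_Re.
  by move=> t /dF; exact: pderiv_Re.
apply: (@rint_FTC _ _ (fun t => complex.Im (F t))); first exact: pcont_Im.
by move=> t /dF; exact: pderiv_Im.
Qed.

Lemma cint_chasles p b a d : cint p a d = cint p a b + cint p b d.
Proof. by apply: complex_eq; rewrite ?reD ?imD /=; exact: rint_chasles. Qed.

Lemma cintxx p a : cint p a a = 0.
Proof. by apply: complex_eq; rewrite /= rintxx. Qed.

Lemma cint_ext p q a b : p =1 q -> cint p a b = cint q a b.
Proof. by move=> /funext ->. Qed.

Lemma cintD p q a b : pcont p -> pcont q ->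
  cint (fun t => p t + q t) a b = cint p a b + cint q a b.
Proof.
move=> pc qc; apply: complex_eq; rewrite ?reD ?imD /= -rintD; try exact: pcont_Re; try exact: pcont_Im.
  by apply: rint_ext => t; rewrite reD.
by apply: rint_ext => t; rewrite imD.
Qed.

Lemma cintZ c p a b : pcont p ->
  cint (fun t => c * p t) a b = c * cint p a b.
Proof.
move=> pc; have pr := pcont_Re pc; have pi := pcont_Im pc.
have cZ (k : R) (u : R -> R) : continuous u -> continuous (fun t => k * u t).
  by move=> uc x; apply: cvgMr; exact: uc.
apply: complex_eq; rewrite ?reM ?imM /= -!rintZ //.
  rewrite -rintB; [|exact: cZ..].
  by apply: rint_ext => t; rewrite reM.
rewrite -rintD; [|exact: cZ..].
by apply: rint_ext => t; rewrite imM.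
Qed.

Lemma cintB p q a b : pcont p -> pcont q ->
  cint (fun t => p t - q t) a b = cint p a b - cint q a b.
Proof.
move=> pc qc; rewrite (@cint_ext _ (fun t => p t + (-1) * q t)); last by move=> t; ring.
rewrite cintD // ?cintZ //; first by ring.
by apply: pcontM => //; exact: pcont_cst.
Qed.

Lemma cint_cst c a b : cint (fun=> c) a b = c * (b - a)%:C.
Proof.
apply: complex_eq; rewrite /= rint_cst ?reM ?imM /=; ring.
Qed.

(** Multiplication by the conjugate of the integral [D] makes it real: |D|^2 is the integral of the
    real part of [D^* * p t], which is at most |D| times the integral of [u]. *)
Lemma cint_nm_le p (u : R -> R) a b : pcont p -> continuous u -> a <= b ->
  (forall t, a <= t <= b -> nm (p t) <= u t) -> nm (cint p a b) <= rint u a b.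
Proof.
move=> pc uc ab pu; set D := cint p a b.
have [->|D0] := eqVneq D 0.
  rewrite nm0 -[0](mul0r (b - a)) -rint_cst; apply: rint_le => //.
    by move=> x; exact: cvg_cst.
  by move=> t /pu; apply: le_trans; exact: nm_ge0.
have n0 : 0 < nm D by rewrite nm_gt0.
rewrite -(ler_pM2l n0) -rintZ // -expr2.
have -> : nm D ^+ 2 = complex.Re (D^* * D) by rewrite mulrC mulJ.
have pc' : pcont (fun t => D^* * p t) by apply: pcontM => //; exact: pcont_cst.
rewrite {2}/D -cintZ //=; apply: rint_le => //.
- exact: pcont_Re.
- by move=> x; apply: cvgMr; exact: uc.
move=> t /pu h; apply: le_trans (ler_norm _) _; apply: le_trans (nm_Re _) _.
by rewrite nmM nmJ ler_pM2l.
Qed.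

Lemma cintN_orient p a b : cint p a b = - cint p b a.
Proof. by apply: complex_eq; rewrite ?reN ?imN /= /rint; ring. Qed.

Lemma cint_nm_bound p (B : R) a b : pcont p ->
  (forall t, btw a b t -> nm (p t) <= B) -> nm (cint p a b) <= B * `|b - a|.
Proof.
move=> pc; wlog ab : a b / a <= b.
  move=> h pB; have [ab|/ltW ba] := leP a b; first exact: h.
  by rewrite cintN_orient nmN distrC; apply: h => // t; rewrite btwC; exact: pB.
move=> pB; rewrite ger0_norm ?subr_ge0 // -rint_cst; apply: cint_nm_le => //.
  by move=> x; exact: cvg_cst.
by move=> t tab; apply: pB; rewrite /btw tab.
Qed.

End PathIntegral.

(** * Goursat's theorem for rectangles *)

Section Goursat.
Context {R : realType}.
Local Notation nm := (@normc R).
Local Notation ii := ((0 +i* 1) : R[i]).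
Implicit Types (h k : R[i] -> R[i]) (a b c d x y t : R) (l z w p : R[i]).

Lemma pderiv_hline y t : pderiv (fun s : R => s +i* y) t 1.
Proof.
move=> e e0; exists 1 => // s _.
have -> : (s +i* y) - (t +i* y) - 1 * (s - t)%:C = 0 by apply: complex_eq => /=; ring.
by rewrite nm0 mulr_ge0 ?(ltW e0).
Qed.

Lemma pderiv_vline x t : pderiv (fun s : R => x +i* s) t ii.
Proof.
move=> e e0; exists 1 => // s _.
have -> : (x +i* s) - (x +i* t) - ii * (s - t)%:C = 0 by apply: complex_eq => /=; ring.
by rewrite nm0 mulr_ge0 ?(ltW e0).
Qed.

Lemma pcont_hline h y : (forall z, ccont h z) -> pcont (fun t => h (t +i* y)).
Proof. by move=> hc; apply: pcont_comp => //; apply: pderiv_pcont => t; exact: pderiv_hline. Qed.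

Lemma pcont_vline h x : (forall z, ccont h z) -> pcont (fun t => h (x +i* t)).
Proof. by move=> hc; apply: pcont_comp => //; apply: pderiv_pcont => t; exact: pderiv_vline. Qed.

(** The integral of h dz along the boundary, counterclockwise for [a <= b] and [c <= d]. For other
    orders of the corners the sign follows, so subdivisions at arbitrary points add up. *)
Definition rect h a b c d : R[i] :=
  cint (fun t => h (t +i* c)) a b + ii * cint (fun t => h (b +i* t)) c d
  - cint (fun t => h (t +i* d)) a b - ii * cint (fun t => h (a +i* t)) c d.

#[local] Arguments rect : simpl never.

Lemma rect_splitx h x a b c d : rect h a b c d = rect h a x c d + rect h x b c d.
Proof.
rewrite /rect (@cint_chasles _ (fun t => h (t +i* c)) x a b).
by rewrite (@cint_chasles _ (fun t => h (t +i* d)) x a b); ring.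
Qed.

Lemma rect_splity h y a b c d : rect h a b c d = rect h a b c y + rect h a b y d.
Proof.
rewrite /rect (@cint_chasles _ (fun t => h (a +i* t)) y c d).
by rewrite (@cint_chasles _ (fun t => h (b +i* t)) y c d); ring.
Qed.

Lemma rect_swapx h a b c d : rect h b a c d = - rect h a b c d.
Proof.
rewrite /rect (@cintN_orient _ (fun t => h (t +i* c)) b a).
by rewrite (@cintN_orient _ (fun t => h (t +i* d)) b a); ring.
Qed.

Lemma rect_swapy h a b c d : rect h a b d c = - rect h a b c d.
Proof.
rewrite /rect (@cintN_orient _ (fun t => h (a +i* t)) d c).
by rewrite (@cintN_orient _ (fun t => h (b +i* t)) d c); ring.
Qed.

Lemma rectxx h a c d : rect h a a c d = 0.
Proof. by rewrite /rect !cintxx; ring. Qed.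

Lemma rectyy h a b c : rect h a b c c = 0.
Proof. by rewrite /rect !cintxx; ring. Qed.

Lemma rect_prim h F a b c d : (forall z, ccont h z) -> (forall z, cderiv F z (h z)) ->
  rect h a b c d = 0.
Proof.
move=> hc dF.
have H y u v : cint (fun t => h (t +i* y)) u v = F (v +i* y) - F (u +i* y).
  apply: (@cint_FTC _ _ (fun t => F (t +i* y))); first exact: pcont_hline.
  move=> t _; rewrite -[h _]mulr1; apply: pderiv_comp (pderiv_hline y t); exact: dF.
have V x u v : ii * cint (fun t => h (x +i* t)) u v = F (x +i* v) - F (x +i* u).
  rewrite -cintZ; last exact: pcont_vline.
  apply: (@cint_FTC _ _ (fun t => F (x +i* t))).
    by apply: pcontM; [exact: pcont_cst|exact: pcont_vline].
  move=> t _; rewrite mulrC; apply: pderiv_comp (pderiv_vline x t); exact: dF.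
by rewrite /rect !H !V; ring.
Qed.

Lemma rectB h k a b c d : (forall z, ccont h z) -> (forall z, ccont k z) ->
  rect (fun z => h z - k z) a b c d = rect h a b c d - rect k a b c d.
Proof.
move=> hc kc; rewrite /rect !cintB; try exact: pcont_hline; try exact: pcont_vline.
by ring.
Qed.

Definition inrect a b c d z := btw a b (complex.Re z) && btw c d (complex.Im z).

Lemma btwl a b : btw a b a.
Proof. by rewrite /btw lexx /= orbC; case: leP => //= /ltW ->. Qed.

Lemma btwr a b : btw a b b.
Proof. by rewrite btwC btwl. Qed.

Lemma btw_dist a b x t : 0 <= b -> a <= x -> x <= a + b -> btw a (a + b) t -> `|t - x| <= b.
Proof.
move=> b0 ax xb; rewrite /btw => /orP[] /andP[h1 h2]; rewrite ler_norml; apply/andP; split; lra.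
Qed.

Lemma rect_bound h (B : R) a b c d : (forall z, ccont h z) ->
  (forall z, inrect a b c d z -> nm (h z) <= B) ->
  nm (rect h a b c d) <= 2 * B * (`|b - a| + `|d - c|).
Proof.
move=> hc hB.
have i1 : nm ii = 1 by rewrite /normc expr0n /= add0r expr1n sqrtr1.
have H1 y : btw c d y -> nm (cint (fun t => h (t +i* y)) a b) <= B * `|b - a|.
  move=> yb; apply: cint_nm_bound; first exact: pcont_hline.
  by move=> t tab; apply: hB; rewrite /inrect /= tab yb.
have H2 x : btw a b x -> nm (ii * cint (fun t => h (x +i* t)) c d) <= B * `|d - c|.
  move=> xb; rewrite nmM i1 mul1r; apply: cint_nm_bound; first exact: pcont_vline.
  by move=> t tab; apply: hB; rewrite /inrect /= tab xb.
have k1 := H1 c (btwl _ _); have k2 := H1 d (btwr _ _).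
have k3 := H2 a (btwl _ _); have k4 := H2 b (btwr _ _).
apply: (le_trans (nmB _ _)); apply: (le_trans (lerD (nmB _ _) (lexx _))).
apply: (le_trans (lerD (lerD (nmD _ _) (lexx _)) (lexx _))); lra.
Qed.

Lemma pow2_gt (x : R) : exists n, x < 2 ^+ n.
Proof.
have [n hn] : exists n, x < n%:R by exists (Num.bound `|x|); apply: le_lt_trans (ler_norm _) (archi_boundP _).
exists n; apply: (lt_le_trans hn); rewrite -natrX ler_nat; exact: ltnW (ltn_expl _ _).
Qed.

Lemma goursat_le h a b c d : (forall z, ccont h z) -> a <= b -> c <= d ->
  (forall z, inrect a b c d z -> exists l, cderiv h z l) -> rect h a b c d = 0.
Proof.
move=> hc ab cd hd; apply/eqP; rewrite -nm_eq0; apply/negPn/negP => n0.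
have r0 : 0 < nm (rect h a b c d) by rewrite lt_def n0 nm_ge0.
pose W := b - a; pose V := d - c.
have W0 : 0 <= W by rewrite subr_ge0.
have V0 : 0 <= V by rewrite subr_ge0.
have L0 : 0 < W + V.
  rewrite lt_def addr_ge0 // andbT; apply/negP => /eqP e.
  by move: n0; rewrite (_ : b = a) ?rectxx ?nm0 ?eqxx // ; rewrite /W in e W0 *; lra.
(* With this [e] the given rectangle is bad: its integral is 2 e (W + V)^2. *)
pose e := nm (rect h a b c d) / (2 * (W + V) ^+ 2).
have e0 : 0 < e by rewrite divr_gt0 // mulr_gt0 // exprn_gt0.
(* A rectangle with corner (u, v) and sides W / 2^n, V / 2^n is bad if its integral exceeds e times
   the square of half its perimeter. By subadditivity a bad rectangle has a bad quarter, and [step]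
   moves to the corner of one. *)
pose bad u v n := e * ((W + V) / 2 ^+ n) ^+ 2 < nm (rect h u (u + W / 2 ^+ n) v (v + V / 2 ^+ n)).
pose step (p : R * R) n := let w := W / 2 ^+ n.+1 in let v := V / 2 ^+ n.+1 in
  if bad p.1 p.2 n.+1 then p else if bad (p.1 + w) p.2 n.+1 then (p.1 + w, p.2)
  else if bad p.1 (p.2 + v) n.+1 then (p.1, p.2 + v) else (p.1 + w, p.2 + v).
pose q := fix q n := if n is m.+1 then step (q m) m else (a, c).
have half n : (2 ^+ n.+1)^-1 = (2 ^+ n)^-1 / 2 :> R by rewrite exprS invfM mulrC.
have badq n : bad (q n).1 (q n).2 n.
  elim: n => [|n IH].
    rewrite /bad /= expr0 !divr1.
    have -> : a + W = b by rewrite /W addrC subrK.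
    have -> : c + V = d by rewrite /V addrC subrK.
    have -> : e * (W + V) ^+ 2 = nm (rect h a b c d) / 2 by rewrite /e; field; rewrite gt_eqF.
    lra.
  rewrite /= /step; case: (q n) IH => u v /= IH.
  case: ifPn => // b1; case: ifPn => // b2; case: ifPn => // b3 /=.
  rewrite /bad ltNge; apply/negP => b4.
  move: b1 b2 b3 IH; rewrite /bad -!leNgt => b1 b2 b3.
  rewrite ltNge => /negP; apply.
  set w2 := W / 2 ^+ n.+1 in b1 b2 b3 b4 *; set v2 := V / 2 ^+ n.+1 in b1 b2 b3 b4 *.
  have -> : W / 2 ^+ n = w2 + w2 by rewrite /w2 half; field; rewrite ?expf_neq0 // ?pnatr_eq0.
  have -> : V / 2 ^+ n = v2 + v2 by rewrite /v2 half; field; rewrite ?expf_neq0 // ?pnatr_eq0.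
  rewrite (rect_splitx _ (u + w2)) (rect_splity _ (v + v2) u) (rect_splity _ (v + v2) (u + w2)).
  have tri (A B C D : R[i]) : nm (A + B + (C + D)) <= nm A + nm B + (nm C + nm D).
    by apply: (le_trans (nmD _ _)); apply: lerD; exact: nmD.
  apply: (le_trans (tri _ _ _ _)).
  have -> : e * ((W + V) / 2 ^+ n) ^+ 2 = 4 * (e * ((W + V) / 2 ^+ n.+1) ^+ 2).
    by rewrite half; field; rewrite ?expf_neq0 // ?pnatr_eq0.
  move: b1 b2 b3 b4; rewrite -!(addrA u w2) -!(addrA v v2).
  move: (e * _ ^+ 2) (nm _) (nm _) (nm _) (nm _) => E x1 x2 x3 x4; lra.
have mono n : (q n).1 <= (q n.+1).1 /\ (q n.+1).1 + W / 2 ^+ n.+1 <= (q n).1 + W / 2 ^+ n /\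
   (q n).2 <= (q n.+1).2 /\ (q n.+1).2 + V / 2 ^+ n.+1 <= (q n).2 + V / 2 ^+ n.
  have hW : W / 2 ^+ n = W / 2 ^+ n.+1 + W / 2 ^+ n.+1 by rewrite half; field; rewrite ?expf_neq0 // ?pnatr_eq0.
  have hV : V / 2 ^+ n = V / 2 ^+ n.+1 + V / 2 ^+ n.+1 by rewrite half; field; rewrite ?expf_neq0 // ?pnatr_eq0.
  have w0 : 0 <= W / 2 ^+ n.+1 by rewrite divr_ge0 // exprn_ge0.
  have v0 : 0 <= V / 2 ^+ n.+1 by rewrite divr_ge0 // exprn_ge0.
  rewrite /= /step; case: (q n) => u v /=; move: w0 v0 hW hV.
  move: (W / 2 ^+ n.+1) (V / 2 ^+ n.+1) (W / 2 ^+ n) (V / 2 ^+ n) => w2 v2 w1 v1 w0 v0 -> ->.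
  by case: ifP => _ /=; [|case: ifP => _ /=; [|case: ifP => _ /=]]; do ?split; lra.
have lim (s : nat -> R) (X : R) : 0 <= X -> (forall n, s n <= s n.+1 /\ s n.+1 + X / 2 ^+ n.+1 <= s n + X / 2 ^+ n) ->
    exists x, forall n, s n <= x <= s n + X / 2 ^+ n.
  move=> X0 hs; have s1 m n : (m <= n)%N -> s m <= s n.
    elim: n => [|n IH]; first by rewrite leqn0 => /eqP ->.
    rewrite leq_eqVlt => /orP[/eqP -> //|]; rewrite ltnS => /IH /le_trans; apply; exact: (hs n).1.
  have s2 m n : (m <= n)%N -> s n + X / 2 ^+ n <= s m + X / 2 ^+ m.
    elim: n => [|n IH]; first by rewrite leqn0 => /eqP ->.
    rewrite leq_eqVlt => /orP[/eqP -> //|]; rewrite ltnS => /IH; apply: le_trans; exact: (hs n).2.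
  have s3 m n : s m <= s n + X / 2 ^+ n.
    have [/s1 mn|/ltnW nm] := leqP m n.
      by apply: le_trans mn _; rewrite lerDl divr_ge0 // exprn_ge0.
    by apply: le_trans (s2 _ _ nm); rewrite lerDl divr_ge0 // exprn_ge0.
  exists (sup (range s)) => n; apply/andP; split.
    apply: ub_le_sup; last by exists n.
    by exists (s 0 + X / 2 ^+ 0) => _ [m _ <-]; exact: s3.
  apply: ge_sup; first by exists (s 0), 0.
  by move=> _ [m _ <-]; exact: s3.
have [x hx] := lim (fun n => (q n).1) W W0 (fun n => conj (mono n).1 (mono n).2.1).
have [y hy] := lim (fun n => (q n).2) V V0 (fun n => conj (mono n).2.2.1 (mono n).2.2.2).
have [l hl] : exists l, cderiv h (x +i* y) l.
  apply: hd; rewrite /inrect /btw /=; apply/andP; split; apply/orP; left.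
    by move: (hx 0); rewrite /= expr0 divr1 /W addrC subrK.
  by move: (hy 0); rewrite /= expr0 divr1 /V addrC subrK.
have e2 : 0 < e / 2 by lra.
have [dl dl0 hdl] := hl _ e2.
have [n hn] := pow2_gt ((W + V) / dl).
pose w := W / 2 ^+ n; pose v := V / 2 ^+ n.
have p2 : 0 < (2 : R) ^+ n by rewrite exprn_gt0.
have wv : w + v < dl.
  by rewrite /w /v -mulrDl ltr_pdivrMr // mulrC -ltr_pdivrMr.
have w0 : 0 <= w by rewrite divr_ge0 // ltW.
have v0 : 0 <= v by rewrite divr_ge0 // ltW.
have := badq n; rewrite /bad -/w -/v; move: (hx n) (hy n); rewrite -/w -/v.
move: (q n).1 (q n).2 => u u' /andP[x1 x2] /andP[y1 y2].
rewrite mulrDl -/w -/v ltNge => /negP; apply.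
set z0 := x +i* y in hl hdl.
(* The affine part of [h] at the limit point has a primitive, so it can be subtracted. The remainder
   is at most (e / 2) (w + v) on the rectangle, and [rect_bound] then gives e (w + v)^2, against
   [bad]. *)
pose g z := h z0 + l * (z - z0).
have gc z : ccont g z.
  apply: ccontD; first exact: ccont_cst.
  by apply: ccontM; [exact: ccont_cst|apply: ccontD; [exact: ccont_id|exact: ccont_cst]].
have g0 : rect g u (u + w) u' (u' + v) = 0.
  apply: (@rect_prim _ (fun z => h z0 * z + (l / 2) * ((z - z0) * (z - z0)))) => // z.
  have -> : g z = h z0 * 1 + l / 2 * ((1 - 0) * (z - z0) + (z - z0) * (1 - 0)).
    by rewrite /g; field.
  apply: cderivD; first by apply: cderivZ; exact: cderiv_id.
  apply: cderivZ; apply: cderivM; apply: cderivB; try exact: cderiv_id; exact: cderiv_cst.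
rewrite -[rect h _ _ _ _]subr0 -g0 -rectB //.
have -> : e * (w + v) ^+ 2 = 2 * (e / 2 * (w + v)) * (`|u + w - u| + `|u' + v - u'|).
  by rewrite !(addrAC _ _ (- _)) !subrr !add0r !ger0_norm //; field.
apply: rect_bound.
  by move=> z; apply: ccontD => //; apply: ccontN.
move=> z /andP[zr zi].
have zn : nm (z - z0) <= w + v.
  apply: (le_trans (nm_ReIm _)); rewrite reD reN imD imN /=.
  by apply: lerD; [exact: (btw_dist w0 x1 x2 zr)|exact: (btw_dist v0 y1 y2 zi)].
rewrite /g opprD addrA; apply: le_trans (hdl z (le_lt_trans zn wv)) _.
by rewrite ler_pM2l.
Qed.

End Goursat.

(** * Exceptional points and primitives on discs *)

Section GoursatException.
Context {R : realType}.
Local Notation nm := (@normc R).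
Local Notation ii := ((0 +i* 1) : R[i]).
Implicit Types (h k F G : R[i] -> R[i]) (a b c d x y t r rho : R) (l z w p : R[i]).

Lemma goursat h a b c d : (forall z, ccont h z) ->
  (forall z, inrect a b c d z -> exists l, cderiv h z l) -> rect h a b c d = 0.
Proof.
move=> hc; wlog ab : a b / a <= b.
  move=> H hd; have [/H|/ltW ba] := leP a b; first exact.
  rewrite -[LHS]opprK -rect_swapx H ?oppr0 // => z; rewrite /inrect btwC; exact: hd.
wlog cd : c d / c <= d.
  move=> H hd; have [/H|/ltW dc] := leP c d; first exact.
  rewrite -[LHS]opprK -rect_swapy H ?oppr0 // => z; rewrite /inrect (btwC d); exact: hd.
exact: goursat_le.
Qed.

Lemma btw_left a b s t : 0 <= s <= 1 -> btw a (a + s * (b - a)) t ->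
  btw a b t /\ `|t - a| <= s * `|b - a|.
Proof.
move=> /andP[s0 s1]; rewrite /btw; have [ab|ba] := leP a b.
  rewrite (ger0_norm (_ : 0 <= b - a)) ?subr_ge0 // ler_norml.
  by move=> /orP[] /andP[h1 h2]; (split; [apply/orP; left|]; apply/andP; split); nra.
rewrite (ltr0_norm (_ : b - a < 0)) ?subr_lt0 // ler_norml.
by move=> /orP[] /andP[h1 h2]; (split; [apply/orP; right|]; apply/andP; split); nra.
Qed.

Lemma btw_right a b s t : 0 < s <= 1 -> a != b -> btw (a + s * (b - a)) b t ->
  btw a b t /\ t != a.
Proof.
move=> /andP[s0 s1] nab; rewrite /btw; have [ab|ba] := leP a b.
  have {nab}ab : a < b by rewrite lt_neqAle nab.
  by move=> /orP[] /andP[h1 h2]; (split; [apply/orP; left; apply/andP; split; nra|]);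
     rewrite gt_eqF //; nra.
by move=> /orP[] /andP[h1 h2]; (split; [apply/orP; right; apply/andP; split; nra|]);
     rewrite lt_eqF //; nra.
Qed.

(** By Goursat's theorem only a small rectangle at the corner contributes. There [h] is bounded by
    continuity, so the contribution tends to 0 with the perimeter. *)
Lemma goursat_corner h x y b d : (forall z, ccont h z) ->
  (forall z, inrect x b y d z -> z != x +i* y -> exists l, cderiv h z l) ->
  rect h x b y d = 0.
Proof.
move=> hc hd; have [->|bx] := eqVneq x b; first exact: rectxx.
have [->|dy] := eqVneq y d; first exact: rectyy.
apply/eqP; rewrite -nm_eq0; apply/negPn/negP => n0.
set N := nm _ in n0; have N0 : 0 < N by rewrite lt_def n0 nm_ge0.
have [dl dl0 hB] := ccont_bound (hc (x +i* y)).
set B := nm _ + 1 in hB; have B0 : 0 < B by have := nm_ge0 (h (x +i* y)); rewrite /B; lra.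
pose L := `|b - x| + `|d - y|.
have L0 : 0 < L by rewrite /L ltr_pwDl // normr_gt0 subr_eq0 eq_sym.
(* Both sides are scaled by [s]: s L < dl keeps the small rectangle where |h| < B, and 2 B s L < N
   makes its integral too small. *)
pose s := Num.min 1 (Num.min (dl / (2 * L)) (N / (4 * B * L))).
have s0 : 0 < s by rewrite !lt_min ltr01 /= !divr_gt0 ?mulr_gt0.
have s1 : s <= 1 by rewrite ge_min lexx.
have s2 : s * L < dl.
  have : s <= dl / (2 * L) by rewrite !ge_min lexx /= orbT.
  rewrite ler_pdivlMr ?mulr_gt0 //; move: (s * L) (mulrCA s 2 L) => k ->; lra.
have s3 : 2 * B * (s * L) < N.
  have : s <= N / (4 * B * L) by rewrite !ge_min lexx /= !orbT.
  rewrite ler_pdivlMr ?mulr_gt0 // (_ : s * (4 * B * L) = 2 * (2 * B * (s * L))); last by ring.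
  lra.
have s01 : 0 < s <= 1 by rewrite s0.
have s01' : 0 <= s <= 1 by rewrite ltW.
pose xs := x + s * (b - x); pose ys := y + s * (d - y).
have e1 : rect h xs b y d = 0.
  apply: goursat => // z /andP[z1 z2].
  have [z3 z4] := btw_right s01 bx z1.
  apply: hd; first by rewrite /inrect z3.
  by apply: contra z4 => /eqP ->.
have e2 : rect h x xs ys d = 0.
  apply: goursat => // z /andP[z1 z2].
  have [z3 _] := btw_left s01' z1; have [z4 z5] := btw_right s01 dy z2.
  apply: hd; first by rewrite /inrect z3.
  by apply: contra z5 => /eqP ->.
have : nm (rect h x xs y ys) <= 2 * B * (`|xs - x| + `|ys - y|).
  apply: rect_bound => // z /andP[/(btw_left s01')[_ z1] /(btw_left s01')[_ z2]].
  apply/ltW/hB; apply: le_lt_trans (nm_ReIm _) _; rewrite reD reN imD imN /=.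
  apply: le_lt_trans (lerD z1 z2) _; by rewrite -mulrDr.
rewrite /xs /ys !(addrAC _ _ (- _)) !subrr !add0r !normrM (gtr0_norm s0) -mulrDr -/L.
rewrite leNgt => /negP; apply; apply: (lt_le_trans s3).
by rewrite /N (rect_splitx _ xs) e1 addr0 (rect_splity _ ys) e2 addr0.
Qed.

Lemma btw_trans a b x t : btw a b x -> btw x b t -> btw a b t.
Proof.
rewrite /btw => /orP[] /andP[h1 h2] /orP[] /andP[h3 h4]; apply/orP.
- by left; rewrite h4 (le_trans h1 h3).
- by left; rewrite (le_trans h1 (le_trans h2 h3)) (le_trans h4 h2).
- by right; rewrite (le_trans h1 h3) (le_trans h4 (le_trans h1 h2)).
- by right; rewrite h3 (le_trans h4 h2).
Qed.

(* The exceptional point [p], where [h] is only assumed continuous, is what allows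
   difference quotients in Cauchy's formula. *)
Lemma goursat_except h p a b c d : (forall z, ccont h z) ->
  (forall z, inrect a b c d z -> z != p -> exists l, cderiv h z l) ->
  rect h a b c d = 0.
Proof.
move=> hc hd; have [/andP[pr pi]|np] := boolP (inrect a b c d p); last first.
  by apply: goursat => // z iz; apply: hd => //; apply: contra np => /eqP <-.
case: p pr pi hd => px py /= pr pi hd.
have pr' : btw b a px by rewrite btwC.
have pi' : btw d c py by rewrite btwC.
rewrite (rect_splitx _ px) (rect_splity _ py a) (rect_splity _ py px).
rewrite (rect_swapx _ px a) (rect_swapx _ px a) (rect_swapy _ _ _ py c) (rect_swapy _ px b py c).
rewrite !goursat_corner ?oppr0 ?addr0 // => z /andP[zr zi] zp; apply: hd => //; rewrite /inrect.
- by rewrite (btw_trans pr zr) (btw_trans pi zi).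
- by rewrite (btw_trans pr zr) btwC (btw_trans pi' zi).
- by rewrite (btw_trans pi zi) btwC (btw_trans pr' zr).
- by rewrite btwC (btw_trans pr' zr) btwC (btw_trans pi' zi).
Qed.

Lemma nm_complex_mono x y x' y' : `|x| <= `|x'| -> `|y| <= `|y'| -> nm (x +i* y) <= nm (x' +i* y').
Proof.
move=> h1 h2; rewrite -(@ler_pXn2r _ 2) ?nnegrE ?nm_ge0 // !nm_sqr /=.
rewrite -(real_normK (num_real x)) -(real_normK (num_real y)).
rewrite -(real_normK (num_real x')) -(real_normK (num_real y')).
by apply: lerD; rewrite ler_pXn2r ?nnegrE.
Qed.

Lemma primitive_disc_cont h rho p : (forall z, ccont h z) ->
  (forall z, nm z < rho -> z != p -> exists l, cderiv h z l) ->
  exists F, forall z, nm z < rho -> cderiv F z (h z).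
Proof.
move=> hc hd.
pose F z := cint (fun t => h (t +i* 0)) 0 (complex.Re z) +
  ii * cint (fun t => h (complex.Re z +i* t)) 0 (complex.Im z).
exists F => z zr e e0.
have e2 : 0 < e / 2 by lra.
have [d d0 hde] := hc z _ e2.
have r0 : 0 < rho - nm z by rewrite subr_gt0.
exists (Num.min (d / 2) (rho - nm z)); first by rewrite lt_min r0 andbT; lra.
case: z zr d d0 hde r0 => x y zr d d0 hde r0 [u v]; rewrite lt_min => /andP[h1 h2].
have hx : `|u - x| <= nm ((u +i* v) - (x +i* y)) by exact: (nm_Re ((u +i* v) - (x +i* y))).
have hy : `|v - y| <= nm ((u +i* v) - (x +i* y)) by exact: (nm_Im ((u +i* v) - (x +i* y))).
(* This rectangle turns the path defining [F (u +i* v)] into one through [x +i* y]. It lies in the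
   disc, because its points are no farther from 0 than the points [s +i* y] with [s] between [x] and
   [u]. *)
have E : rect h x u 0 y = 0.
  apply: (@goursat_except _ p) => // -[s t] /andP[/= s1 t1]; apply: hd.
  have st : nm (s +i* t) <= nm (s +i* y).
    apply: nm_complex_mono => //; move: t1; rewrite /btw => /orP[] /andP[k1 k2].
      by rewrite !ger0_norm // (le_trans k1).
    by rewrite !ler0_norm ?lerN2 // (le_trans k1).
  apply: (le_lt_trans st); have := nm_lerB (s +i* y) (x +i* y).
  have -> : nm ((s +i* y) - (x +i* y)) = `|s - x|.
    by rewrite -nmR; congr nm; apply: complex_eq => /=; ring.
  have : `|s - x| <= `|u - x|.
    move: s1; rewrite /btw => /orP[] /andP[k1 k2].
      by rewrite !ger0_norm ?subr_ge0 ?lerD2r // (le_trans k1).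
    by rewrite !ler0_norm ?subr_le0 ?lerN2 ?lerD2r // (le_trans k1).
  lra.
rewrite /= .
have -> : F (u +i* v) - F (x +i* y) = cint (fun t => h (t +i* y)) x u + ii * cint (fun t => h (u +i* t)) y v.
  move: E; rewrite /F /rect /= (@cint_chasles _ (fun t => h (t +i* 0)) x 0 u).
  rewrite (@cint_chasles _ (fun t => h (u +i* t)) y 0 v).
  move: (cint _ x u) (cint _ x u) (cint _ 0 y) (cint _ 0 x) (cint _ y v) (cint (fun t => h (x +i* t)) _ _) => c1 c2 c3 c4 c5 c6.
  move=> /eqP; rewrite subr_eq add0r subr_eq => /eqP E.
  have -> : c2 = ii * c6 + c1 - ii * c3 by rewrite -E; ring.
  by ring.
have -> : h (x +i* y) * ((u +i* v) - (x +i* y)) =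
   cint (fun=> h (x +i* y)) x u + ii * cint (fun => h (x +i* y)) y v.
  rewrite !cint_cst (_ : (u +i* v) - (x +i* y) = (u - x)%:C + ii * (v - y)%:C); first by ring.
  by apply: complex_eq => /=; ring.
have -> (c1 c2 c3 c4 : R[i]) : c1 + ii * c2 - (c3 + ii * c4) = (c1 - c3) + ii * (c2 - c4) by ring.
rewrite -!cintB; [|exact: pcont_vline|exact: pcont_cst|exact: pcont_hline|exact: pcont_cst].
have i1 : nm ii = 1 by rewrite /normc expr0n /= add0r expr1n sqrtr1.
apply: (le_trans (nmD _ _)); rewrite nmM i1 mul1r.
set D := nm ((u +i* v) - (x +i* y)) in h1 h2 hx hy *.
have k1 : nm (cint (fun t => h (t +i* y) - h (x +i* y)) x u) <= (e / 2) * `|u - x|.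
  apply: cint_nm_bound.
    apply: (pcontD (pcont_hline y hc)); exact: pcont_cst.
  move=> t tb; apply/ltW/hde.
  have -> : (t +i* y) - (x +i* y) = (t - x)%:C by apply: complex_eq => /=; ring.
  rewrite nmR.
  have : `|t - x| <= `|u - x|.
    move: tb; rewrite /btw => /orP[] /andP[q1 q2].
      by rewrite !ger0_norm ?subr_ge0 ?lerD2r // (le_trans q1).
    by rewrite !ler0_norm ?subr_le0 ?lerN2 ?lerD2r // (le_trans q1).
  lra.
have k2 : nm (cint (fun t => h (u +i* t) - h (x +i* y)) y v) <= (e / 2) * `|v - y|.
  apply: cint_nm_bound.
    apply: (pcontD (pcont_vline u hc)); exact: pcont_cst.
  move=> t tb; apply/ltW/hde; apply: (le_lt_trans (nm_ReIm _)).
  rewrite reD reN imD imN /=.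
  have : `|t - y| <= `|v - y|.
    move: tb; rewrite /btw => /orP[] /andP[q1 q2].
      by rewrite !ger0_norm ?subr_ge0 ?lerD2r // (le_trans q1).
    by rewrite !ler0_norm ?subr_le0 ?lerN2 ?lerD2r // (le_trans q1).
  lra.
nra.
Qed.

(* Composing with this retraction onto the disc of radius [r] makes a function that is
   continuous near the disc continuous everywhere. *)
Definition clamp r z := z * (r / Num.max r (nm z))%:C.

Lemma clamp_le r z : 0 < r -> nm (clamp r z) <= r.
Proof.
move=> r0; have m0 : 0 < Num.max r (nm z) by rewrite lt_max r0.
rewrite /clamp nmM nmR ger0_norm ?divr_ge0 // ?(ltW r0) ?(ltW m0) //.
by rewrite mulrA ler_pdivrMr // mulrC ler_pM2l // le_max lexx orbT.
Qed.

Lemma clamp_id r z : nm z <= r -> 0 < r -> clamp r z = z.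
Proof. by move=> zr r0; rewrite /clamp max_l // divff ?gt_eqF // mulr1. Qed.

Lemma ccont_clamp r z : 0 < r -> ccont (clamp r) z.
Proof.
move=> r0 e e0; exists (e / 2); first by lra.
move=> w wz.
suff : nm (clamp r w - clamp r z) <= nm (w - z) + nm (w - z) by lra.
rewrite /clamp; set M := Num.max r (nm w); set M' := Num.max r (nm z).
have m0 : 0 < M by rewrite lt_max r0.
have m0' : 0 < M' by rewrite lt_max r0.
have mr : r <= M by rewrite le_max lexx.
have zm : nm z <= M' by rewrite le_max lexx orbT.
have -> : w * (r / M)%:C - z * (r / M')%:C = (w - z) * (r / M)%:C + z * (r / M - r / M')%:C.
  by rewrite realC_B; ring.
apply: (le_trans (nmD _ _)); apply: lerD; rewrite nmM nmR.
  rewrite ger0_norm ?divr_ge0 // ?(ltW r0) ?(ltW m0) // ler_piMr ?nm_ge0 //.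
  by rewrite ler_pdivrMr // mul1r.
have -> : r / M - r / M' = r * (M' - M) / (M * M') by field; rewrite !gt_eqF.
have Mn : `|M' - M| <= nm (w - z).
  rewrite distrC; apply: le_trans (nm_dist_norm _ _); rewrite /M /M'.
  case: (leP r (nm w)) => q1; case: (leP r (nm z)) => q2; rewrite ?subrr ?normr0 //.
    by rewrite !ger0_norm; lra.
  by rewrite !ler0_norm; lra.
rewrite normrM (normrM r) gtr0_norm // normfV (gtr0_norm (_ : 0 < M * M')) ?mulr_gt0 //.
rewrite mulrA ler_pdivrMr ?mulr_gt0 //.
have := normr_ge0 (M' - M); move: (`|M' - M|) Mn => q qn q0.
have n0 := nm_ge0 z.
apply: (@le_trans _ _ (M' * (M * q))).
  by apply: ler_pM => //; [rewrite mulr_ge0 // ltW|rewrite ler_wpM2r].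
rewrite mulrA mulrC (mulrC M'); apply: ler_wpM2r => //; by rewrite mulr_ge0 // ltW.
Qed.

Lemma primitive_disc h rho r p : 0 < r -> r < rho -> (forall z, nm z < rho -> ccont h z) ->
  (forall z, nm z < rho -> z != p -> exists l, cderiv h z l) ->
  exists F, forall z, nm z < r -> cderiv F z (h z).
Proof.
move=> r0 rr hc hd.
have [||F dF] := @primitive_disc_cont (fun z => h (clamp r z)) r p.
- move=> z; apply: ccont_comp; first exact: ccont_clamp.
  by apply: hc; apply: le_lt_trans rr; exact: clamp_le.
- move=> z zr zp; have [l dl] := hd z (lt_trans zr rr) zp; exists l.
  apply: cderiv_near dl; exists (r - nm z); first by rewrite subr_gt0.
  by move=> w wz; rewrite clamp_id //; have := nm_lerB w z; lra.
by exists F => z zr; rewrite -[h z](congr1 h (clamp_id (ltW zr) r0)); exact: dF.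
Qed.

End GoursatException.

(** * Cauchy's formula and entire functions *)

Section CauchyFormula.
Context {R : realType}.
Local Notation nm := (@normc R).
Local Notation ii := ((0 +i* 1) : R[i]).
Implicit Types (h k F G : R[i] -> R[i]) (a b c d x y t r rho : R) (l z w p : R[i]).

Lemma nm_nat n : nm n%:R = n%:R.
Proof. by rewrite -[n%:R](rmorph_nat (real_complex R)) nmR normr_nat. Qed.

Definition circ r t : R[i] := r%:C * cexp (0 +i* t).

Lemma circE r t : circ r t = (r * cos t) +i* (r * sin t).
Proof. by rewrite /circ /cexp /= expR0; apply: complex_eq => /=; ring. Qed.

Lemma nm_circ r t : 0 <= r -> nm (circ r t) = r.
Proof.
move=> r0; rewrite circE /normc !exprMn -mulrDr cos2Dsin2 mulr1 sqrtr_sqr.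
by rewrite ger0_norm.
Qed.

Lemma circ_neq0 r t : 0 < r -> circ r t != 0.
Proof. by move=> r0; rewrite -nm_gt0 nm_circ // ltW. Qed.

Lemma circ2pi r : circ r (2 * pi) = circ r 0.
Proof.
rewrite !circE; have -> : 2 * pi = pi *+ 2 :> R by rewrite mulr_natl.
by rewrite cos2pi sin2pi cos0 sin0.
Qed.

Lemma pderiv_circ r t : pderiv (circ r) t (ii * circ r t).
Proof.
rewrite circE; apply: pderiv_ReIm.
  have -> : complex.Re (ii * (r * cos t +i* (r * sin t))) = r * (- sin t) by rewrite /=; ring.
  rewrite (_ : (fun s => _) = (fun s => r * cos s)); last by apply/funext => s; rewrite circE.
  by apply: rderivZ; apply/rderivP.
have -> : complex.Im (ii * (r * cos t +i* (r * sin t))) = r * cos t by rewrite /=; ring.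
rewrite (_ : (fun s => _) = (fun s => r * sin s)); last by apply/funext => s; rewrite circE.
by apply: rderivZ; apply/rderivP.
Qed.

Lemma pcont_circ r : pcont (circ r).
Proof. by apply: pderiv_pcont => t; exact: pderiv_circ. Qed.

Definition cmean (u : R -> R[i]) : R[i] := ((2 * pi)^-1)%:C * cint u 0 (2 * pi).
Definition rmean (u : R -> R) : R := (2 * pi)^-1 * rint u 0 (2 * pi).

Lemma twopi_gt0 : 0 < 2 * pi :> R.
Proof. by rewrite mulr_gt0 // pi_gt0. Qed.

Lemma cmean_ext u v : u =1 v -> cmean u = cmean v.
Proof. by move=> /funext ->. Qed.

Lemma cmeanD u v : pcont u -> pcont v -> cmean (fun t => u t + v t) = cmean u + cmean v.
Proof. by move=> uc vc; rewrite /cmean cintD // mulrDr. Qed.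

Lemma cmeanB u v : pcont u -> pcont v -> cmean (fun t => u t - v t) = cmean u - cmean v.
Proof. by move=> uc vc; rewrite /cmean cintB // mulrBr. Qed.

Lemma cmeanZ (c : R[i]) u : pcont u -> cmean (fun t => c * u t) = c * cmean u.
Proof. by move=> uc; rewrite /cmean cintZ // mulrCA. Qed.

Lemma cmean_cst (c : R[i]) : cmean (fun=> c) = c.
Proof.
rewrite /cmean cint_cst subr0 mulrCA -realC_M mulVf ?mulr1 //.
by rewrite gt_eqF // twopi_gt0.
Qed.

Lemma cmean_Re u : complex.Re (cmean u) = rmean (fun t => complex.Re (u t)).
Proof. by rewrite /cmean /rmean reM /= mul0r subr0. Qed.

Lemma cmean_Im u : complex.Im (cmean u) = rmean (fun t => complex.Im (u t)).
Proof. by rewrite /cmean /rmean imM /= mul0r addr0. Qed.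

Lemma rmean_ext (u v : R -> R) : u =1 v -> rmean u = rmean v.
Proof. by move=> /funext ->. Qed.

Lemma rmeanD (u v : R -> R) : continuous u -> continuous v -> rmean (fun t => u t + v t) = rmean u + rmean v.
Proof. by move=> uc vc; rewrite /rmean rintD // mulrDr. Qed.

Lemma rmeanB (u v : R -> R) : continuous u -> continuous v -> rmean (fun t => u t - v t) = rmean u - rmean v.
Proof. by move=> uc vc; rewrite /rmean rintB // mulrBr. Qed.

Lemma rmeanZ c (u : R -> R) : continuous u -> rmean (fun t => c * u t) = c * rmean u.
Proof. by move=> uc; rewrite /rmean rintZ // mulrCA. Qed.

Lemma rmean_cst c : rmean (fun=> c) = c.
Proof.
rewrite /rmean rint_cst subr0 mulrCA mulVf ?mulr1 //.
by rewrite gt_eqF // twopi_gt0.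
Qed.

Lemma rmean_le (u v : R -> R) : continuous u -> continuous v -> (forall t, u t <= v t) -> rmean u <= rmean v.
Proof.
move=> uc vc uv; rewrite /rmean ler_pM2l ?invr_gt0 ?twopi_gt0 //.
by apply: rint_le => //; rewrite ltW // twopi_gt0.
Qed.

Lemma cmean_nm_le u (v : R -> R) : pcont u -> continuous v -> (forall t, nm (u t) <= v t) ->
  nm (cmean u) <= rmean v.
Proof.
move=> uc vc uv; rewrite /cmean /rmean nmM nmR ger0_norm ?invr_ge0 ?(ltW twopi_gt0) //.
rewrite ler_pM2l ?invr_gt0 ?twopi_gt0 //.
by apply: cint_nm_le => //; rewrite ltW // twopi_gt0.
Qed.

Lemma cmean_nm_bound u (B : R) : pcont u -> (forall t, nm (u t) <= B) -> nm (cmean u) <= B.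
Proof.
move=> uc uv; rewrite -[B]rmean_cst; apply: cmean_nm_le => //.
by move=> x; exact: cvg_cst.
Qed.

Lemma cmeanJ u : pcont u -> cmean (fun t => (u t)^*) = (cmean u)^*.
Proof.
move=> uc; apply: complex_eq.
  rewrite (_ : complex.Re ((cmean u)^*) = complex.Re (cmean u)); last by case: (cmean u).
  by rewrite !cmean_Re; apply: rmean_ext => t; case: (u t).
rewrite (_ : complex.Im ((cmean u)^*) = - complex.Im (cmean u)); last by case: (cmean u).
rewrite !cmean_Im -mulN1r -rmeanZ; last exact: pcont_Im.
by apply: rmean_ext => t; case: (u t) => x y /=; rewrite mulN1r.
Qed.

Definition hol rho G := forall z, nm z < rho -> exists l, cderiv G z l.

Lemma hol_ccont rho G z : hol rho G -> nm z < rho -> ccont G z.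
Proof. by move=> h /h [l]; exact: cderiv_cont. Qed.

Lemma pcont_circ_comp G r : (forall t, ccont G (circ r t)) -> pcont (fun t => G (circ r t)).
Proof. by move=> h; apply: pcont_comp => //; exact: pcont_circ. Qed.

(** Up to the factor i, the function averaged here is the integrand of h dz along the circle, and a
    primitive of [h] returns to its initial value. *)
Lemma cmean_prim h rho r p : 0 < r -> r < rho -> (forall z, nm z < rho -> ccont h z) ->
  (forall z, nm z < rho -> z != p -> exists l, cderiv h z l) ->
  cmean (fun t => h (circ r t) * circ r t) = 0.
Proof.
move=> r0 rr hc hd; pose r' := (r + rho) / 2.
have r1 : r < r' by rewrite /r'; lra.
have r2 : r' < rho by rewrite /r'; lra.
have r3 : 0 < r' by lra.
have [F dF] := @primitive_disc R h rho r' p r3 r2 hc hd.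
have hcc t : ccont h (circ r t) by apply: hc; rewrite nm_circ // ltW.
have pc : pcont (fun t => h (circ r t) * (ii * circ r t)).
  apply: pcontM; first exact: pcont_circ_comp.
  by apply: pcontM; [exact: pcont_cst|exact: pcont_circ].
have E : cint (fun t => h (circ r t) * (ii * circ r t)) 0 (2 * pi) = 0.
  rewrite (@cint_FTC _ _ (fun t => F (circ r t))) //; first by rewrite circ2pi subrr.
  move=> t _; apply: pderiv_comp; last exact: pderiv_circ.
  by apply: dF; rewrite nm_circ // ltW.
have -> : (fun t => h (circ r t) * circ r t) = (fun t => (- ii) * (h (circ r t) * (ii * circ r t))).
  apply/funext => t; have -> : - ii * (h (circ r t) * (ii * circ r t)) = - (ii * ii) * (h (circ r t) * circ r t) by ring.
  by have -> : - (ii * ii) = 1; [apply: complex_eq => /=; ring|rewrite mul1r].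
by rewrite cmeanZ // /cmean E !mulr0.
Qed.

Lemma circ_sub_neq0 r z t : nm z < r -> circ r t - z != 0.
Proof.
move=> zr; rewrite subr_eq0; apply/negP => /eqP e.
have r0 : 0 <= r by have := nm_ge0 z; lra.
by move: zr; rewrite -e nm_circ // ltxx.
Qed.

Lemma ccont_invB r z t : nm z < r -> ccont (fun w => (w - z)^-1) (circ r t).
Proof.
move=> zr; apply: ccontV; first exact: circ_sub_neq0.
by apply: ccontD; [exact: ccont_id|exact: ccont_cst].
Qed.

Lemma pcont_invB r z : nm z < r -> pcont (fun t => (circ r t - z)^-1).
Proof.
by move=> zr; apply: (@pcont_circ_comp (fun w => (w - z)^-1)) => t; exact: ccont_invB.
Qed.

(** The kernel is 1 + z / (circ r t - z). As the conjugate of w is r^2 / w on the circle, the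
    conjugate of the second term is [h (circ r t) * circ r t] with h(w) = z^* / (r^2 - z^* w). For z
    <> 0 this h is holomorphic up to radius r^2 / |z| > r, so the mean is 0. *)
Lemma cmean_kernel1 r z : nm z < r -> cmean (fun t => circ r t / (circ r t - z)) = 1.
Proof.
move=> zr; have r0 : 0 < r by have := nm_ge0 z; lra.
have pk : pcont (fun t => z / (circ r t - z)).
  by apply: pcontM; [exact: pcont_cst|exact: pcont_invB].
have -> : (fun t => circ r t / (circ r t - z)) = (fun t => 1 + z / (circ r t - z)).
  by apply/funext => t; have c0 := circ_sub_neq0 t zr; field.
rewrite cmeanD ?cmean_cst //; last exact: pcont_cst.
suff -> : cmean (fun t => z / (circ r t - z)) = 0 by rewrite addr0.
have [->|z0] := eqVneq z 0.
  by rewrite (cmean_ext (v := fun=> 0)) ?cmean_cst // => t; rewrite mul0r.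
suff E : cmean (fun t => (z / (circ r t - z))^*) = 0.
  by rewrite -[LHS]conjCK -cmeanJ // E rmorph0.
have zp : 0 < nm z by rewrite nm_gt0.
have den w : nm w < r ^+ 2 / nm z -> (r ^+ 2)%:C - z^* * w != 0.
  rewrite ltr_pdivlMr // => h; rewrite subr_eq0; apply/negP => /eqP e.
  by move: h; rewrite mulrC -(nmJ z) -nmM -e nmR ger0_norm ?sqr_ge0 // ltxx.
have dden w : nm w < r ^+ 2 / nm z -> exists l, cderiv (fun w => z^* * ((r ^+ 2)%:C - z^* * w)^-1) w l.
  move=> h; eexists; apply: cderivZ; apply: cderivV; first exact: den.
  by apply: cderivB; [exact: cderiv_cst|apply: cderivZ; exact: cderiv_id].
have rr : r < r ^+ 2 / nm z by rewrite ltr_pdivlMr // expr2 ltr_pM2l.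
rewrite -[RHS](@cmean_prim (fun w => z^* * ((r ^+ 2)%:C - z^* * w)^-1) (r ^+ 2 / nm z) r 0 r0 rr); first last.
- by move=> w /dden.
- by move=> w /dden [l]; exact: cderiv_cont.
apply/cmean_ext => t.
have c0 := circ_neq0 t r0; have c1 := circ_sub_neq0 t zr.
have cc : circ r t * (circ r t)^* = (r ^+ 2)%:C by rewrite mulJ nm_circ // ltW.
rewrite rmorphM fmorphV rmorphB /=.
have e1 : (circ r t)^* - z^* != 0 by rewrite -rmorphB conjC_eq0.
have e2 : (r ^+ 2)%:C - z^* * circ r t != 0 by apply: den; rewrite nm_circ // ltW.
rewrite -cc in e2 *; field; rewrite e1 /=.
by rewrite e2.
Qed.

(** The difference quotient of [G] at [z] is continuous at [z] and holomorphic elsewhere, so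
    [cmean_prim] applies with exceptional point [z]. What remains is [G z] times the mean in
    [cmean_kernel1]. *)
Lemma cauchy_formula G rho r z : hol rho G -> r < rho -> nm z < r ->
  cmean (fun t => G (circ r t) * circ r t / (circ r t - z)) = G z.
Proof.
move=> hG rr zr; have r0 : 0 < r by have := nm_ge0 z; lra.
have [l /cderivP [k [kc kz Gk]]] := hG z (lt_trans zr rr).
have kE w : w != z -> k w = (G w - G z) / (w - z).
  by move=> wz; rewrite Gk addrAC subrr add0r mulfK // subr_eq0.
have kd w : nm w < rho -> w != z -> exists m, cderiv k w m.
  move=> wr wz; have [m dm] := hG w wr.
  have wz0 : w - z != 0 by rewrite subr_eq0.
  eexists; apply: (@cderiv_near _ (fun w => (G w - G z) * (w - z)^-1)); last first.
    apply: cderivM; first by apply: cderivB dm _; exact: cderiv_cst.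
    by apply: cderivV => //; apply: cderivB; [exact: cderiv_id|exact: cderiv_cst].
  exists (nm (w - z)); first by rewrite nm_gt0.
  by move=> v vw; rewrite kE //; apply/negP => /eqP vz; move: vw; rewrite vz nm_distC ltxx.
have kcc w : nm w < rho -> ccont k w.
  move=> wr; have [->//|wz] := eqVneq w z.
  by have [m] := kd w wr wz; exact: cderiv_cont.
have cr t : nm (circ r t) < rho by rewrite nm_circ // ltW.
have E := @cmean_prim k rho r z r0 rr kcc kd.
have -> : (fun t => G (circ r t) * circ r t / (circ r t - z)) =
   (fun t => k (circ r t) * circ r t + G z * (circ r t / (circ r t - z))).
  apply/funext => t; rewrite kE; last by rewrite -subr_eq0; exact: circ_sub_neq0.
  by have c0 := circ_sub_neq0 t zr; field.
rewrite cmeanD.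
- by rewrite E add0r cmeanZ ?cmean_kernel1 ?mulr1 //; apply: pcontM; [exact: pcont_circ|exact: pcont_invB].
- by apply: pcontM; [apply: pcont_circ_comp => t; exact: kcc|exact: pcont_circ].
- by apply: pcontM; [exact: pcont_cst|apply: pcontM; [exact: pcont_circ|exact: pcont_invB]].
Qed.

Lemma mean_value G rho r : hol rho G -> 0 < r -> r < rho ->
  cmean (fun t => G (circ r t)) = G 0.
Proof.
move=> hG r0 rr; rewrite -(@cauchy_formula G rho r 0) ?nm0 //.
by apply: cmean_ext => t; rewrite subr0 mulfK // circ_neq0.
Qed.

Lemma cmean_param_deriv (K : R[i] -> R -> R[i]) (K' : R -> R[i]) (M : R -> R) z d :
  0 < d -> (forall w, nm (w - z) < d -> pcont (K w)) -> pcont K' -> continuous M ->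
  (forall w t, nm (w - z) < d -> nm (K w t - K z t - K' t * (w - z)) <= M t * nm (w - z) ^+ 2) ->
  cderiv (fun w => cmean (K w)) z (cmean K').
Proof.
move=> d0 Kc Kc' Mc hK e e0; pose B := rmean M.
pose d1 := Num.min d (e / (`|B| + 1)).
have B0 := normr_ge0 B; have B1 : 0 < `|B| + 1 by lra.
exists d1; first by rewrite lt_min d0 divr_gt0.
move=> w; rewrite lt_min ltr_pdivlMr // => /andP[wd we].
have zz : nm (z - z) < d by rewrite subrr nm0.
have pK : pcont (fun t => - (w - z) * K' t) by apply: pcontM => //; exact: pcont_cst.
have -> : cmean (K w) - cmean (K z) - cmean K' * (w - z) =
  cmean (fun t => K w t - K z t + (- (w - z)) * K' t).
  rewrite cmeanD ?cmeanB ?cmeanZ //; try exact: Kc; first by ring.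
  by apply: pcontD; [exact: Kc|rewrite (_ : (fun t => - K z t) = (fun t => (-1) * K z t)); [apply: pcontM; [exact: pcont_cst|exact: Kc]|apply/funext => t; ring]].
apply: (@le_trans _ _ (rmean (fun t => nm (w - z) ^+ 2 * M t))).
  apply: cmean_nm_le.
  - apply: pcontD => //; apply: pcontD; first exact: Kc.
    by rewrite (_ : (fun t => - K z t) = (fun t => (-1) * K z t)); [apply: pcontM; [exact: pcont_cst|exact: Kc]|apply/funext => t; ring].
  - by move=> x; apply: cvgMr; exact: Mc.
  - by move=> t; rewrite mulNr (mulrC _ (K' t)) [leRHS]mulrC; exact: hK.
rewrite rmeanZ // -/B; have n0 := nm_ge0 (w - z).
have := ler_norm B; rewrite expr2; nra.
Qed.

Lemma circ_sub_ge r z w t : 0 <= r -> nm (w - z) < (r - nm z) / 2 -> (r - nm z) / 2 <= nm (circ r t - w).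
Proof.
move=> r0 h; have := nm_lerB (circ r t) w; rewrite nm_circ //.
have := nm_lerB w z; lra.
Qed.

Lemma pcontV_circ (u : R -> R[i]) r z : pcont u -> nm z < r -> pcont (fun t => u t / (circ r t - z)).
Proof. by move=> uc zr; apply: pcontM => //; exact: pcont_invB. Qed.

Lemma cauchy_kernel_deriv (u : R -> R[i]) r z : pcont u -> nm z < r ->
  cderiv (fun z => cmean (fun t => u t / (circ r t - z))) z
     (cmean (fun t => u t / (circ r t - z) / (circ r t - z))).
Proof.
move=> uc zr; have r0 : 0 <= r by have := nm_ge0 z; lra.
pose d := (r - nm z) / 2; have d0 : 0 < d by rewrite /d; lra.
have wr w : nm (w - z) < d -> nm w < r by have := nm_lerB w z; rewrite /d; lra.
apply: (@cmean_param_deriv _ _ (fun t => (d ^+ 3)^-1 * nm (u t)) z d) => //.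
- by move=> w /wr h; exact: pcontV_circ.
- by do 2?apply: pcontV_circ.
- by move=> x; apply: cvgMr; exact: (pcont_nm uc).
move=> w t wd; have zz : nm (z - z) < d by rewrite subrr nm0.
have a1 := circ_sub_neq0 t zr; have a2 := circ_sub_neq0 t (wr _ wd).
have b1 := circ_sub_ge t r0 zz; have b2 := circ_sub_ge t r0 wd.
rewrite -/d in b1 b2.
set a := circ r t - z in a1 b1 *; set b := circ r t - w in a2 b2 *.
have -> : u t / b - u t / a - u t / a / a * (w - z) = u t * (w - z) ^+ 2 / (a ^+ 2 * b).
  have -> : w - z = a - b by rewrite /a /b; ring.
  by field; rewrite ?a1 ?a2.
rewrite !nmM !nmV !nmM -?expr2 ?nmX mulrAC ler_wpM2r ?exprn_ge0 ?nm_ge0 //.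
rewrite mulrC ler_wpM2r ?nm_ge0 // lef_pV2 ?posrE ?mulr_gt0 ?exprn_gt0 //; try lra.
rewrite exprSr; apply: ler_pM => //; rewrite ?exprn_ge0 ?(ltW d0) //.
by rewrite ler_pXn2r ?nnegrE ?nm_ge0 ?(ltW d0).
Qed.

Lemma cauchy_kernel_deriv2 (u : R -> R[i]) r z : pcont u -> nm z < r ->
  exists l, cderiv (fun z => cmean (fun t => u t / (circ r t - z) / (circ r t - z))) z l.
Proof.
move=> uc zr; have r0 : 0 <= r by have := nm_ge0 z; lra.
pose d := (r - nm z) / 2; have d0 : 0 < d by rewrite /d; lra.
have wr w : nm (w - z) < d -> nm w < r by have := nm_lerB w z; rewrite /d; lra.
have p1 w : nm w < r -> pcont (fun t => u t / (circ r t - w) / (circ r t - w)).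
  by move=> h; do 2?apply: pcontV_circ.
have p2 : pcont (fun t => 2 * (u t / (circ r t - z) / (circ r t - z) / (circ r t - z))).
  by apply: pcontM; [exact: pcont_cst|do 3?apply: pcontV_circ].
(* The second-order remainder has numerator factor 3 a - 2 (w - z), at most 3 (r + |z|) + 2 d, and
   denominator a^3 b^2, at least d^5. *)
pose C := (3 * (r + nm z) + 2 * d) / d ^+ 5.
exists (cmean (fun t => 2 * (u t / (circ r t - z) / (circ r t - z) / (circ r t - z)))).
apply: (@cmean_param_deriv _ _ (fun t => C * nm (u t)) z d) => //.
- by move=> w /wr; exact: p1.
- by move=> x; apply: cvgMr; exact: (pcont_nm uc).
move=> w t wd; have zz : nm (z - z) < d by rewrite subrr nm0.
have a1 := circ_sub_neq0 t zr; have a2 := circ_sub_neq0 t (wr _ wd).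
have b1 := circ_sub_ge t r0 zz; have b2 := circ_sub_ge t r0 wd.
rewrite -/d in b1 b2.
have a3 : nm (circ r t - z) <= r + nm z by rewrite (le_trans (nmB _ _)) // nm_circ.
set a := circ r t - z in a1 b1 a3 *; set b := circ r t - w in a2 b2 *.
have -> : u t / b / b - u t / a / a - 2 * (u t / a / a / a) * (w - z) =
  u t * (w - z) ^+ 2 * (3 * a - 2 * (w - z)) / (a ^+ 3 * b ^+ 2).
  have -> : w - z = a - b by rewrite /a /b; ring.
  by field; rewrite ?a1 ?a2.
have k1 : nm (3 * a - 2 * (w - z)) <= 3 * (r + nm z) + 2 * d.
  apply: (le_trans (nmB _ _)); rewrite !nmM !nm_nat; lra.
have k2 : (nm a ^+ 3 * nm b ^+ 2)^-1 <= (d ^+ 5)^-1.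
  rewrite lef_pV2 ?posrE ?mulr_gt0 ?exprn_gt0 //; try lra.
  rewrite (exprD d 3 2); apply: ler_pM; rewrite ?exprn_ge0 ?(ltW d0) //;
  by rewrite ler_pXn2r ?nnegrE ?nm_ge0 ?(ltW d0).
rewrite !nmM !nmV !nmM -?expr2 -?exprSr ?nmX.
have -> : C * nm (u t) * nm (w - z) ^+ 2 =
   nm (u t) * nm (w - z) ^+ 2 * (3 * (r + nm z) + 2 * d) / d ^+ 5 by rewrite /C; ring.
apply: ler_pM => //; rewrite ?invr_ge0 ?mulr_ge0 ?exprn_ge0 ?nm_ge0 //.
by rewrite ler_wpM2l // mulr_ge0 ?exprn_ge0 ?nm_ge0.
Qed.

End CauchyFormula.

(** * Entire functions *)

Section EntireFunctions.
Context {R : realType}.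
Local Notation nm := (@normc R).
Implicit Types (f g F G : R[i] -> R[i]) (a b c z w l : R[i]) (r rho B t : R).

Definition ent f := forall z, exists l, cderiv f z l.

Definition cder f z : R[i] := xget 0 [set l | cderiv f z l].

Lemma cderE f z l : cderiv f z l -> cder f z = l.
Proof.
by move=> h; apply: xget_unique => //= m hm; exact: cderiv_uniq hm h.
Qed.

Lemma cderP f z : ent f -> cderiv f z (cder f z).
Proof. by move=> /(_ z) [l hl]; rewrite (cderE hl). Qed.

Lemma ent_hol f rho : ent f -> hol rho f.
Proof. by move=> h z _; exact: h. Qed.

Lemma ent_cont f z : ent f -> ccont f z.
Proof. by move=> fe; exact: cderiv_cont (cderP z fe). Qed.

Lemma ent_pcont f r : ent f -> pcont (fun t => f (circ r t)).
Proof. by move=> fe; apply: pcont_circ_comp => t; exact: ent_cont. Qed.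

Lemma ent_pcontM f r : ent f -> pcont (fun t => f (circ r t) * circ r t).
Proof. by move=> fe; apply: pcontM; [exact: ent_pcont|exact: pcont_circ]. Qed.

Lemma cauchy_ent f r z : ent f -> nm z < r ->
  cmean (fun t => f (circ r t) * circ r t / (circ r t - z)) = f z.
Proof.
by move=> fe zr; apply: (@cauchy_formula _ f (r + 1)) => //; first [exact: ent_hol|by rewrite ltrDl].
Qed.

Lemma cauchy_der f r z : ent f -> nm z < r ->
  cder f z = cmean (fun t => f (circ r t) * circ r t / (circ r t - z) / (circ r t - z)).
Proof.
move=> fe zr; apply: cderE; apply: cderiv_near (cauchy_kernel_deriv (ent_pcontM r fe) zr).
exists (r - nm z); first by rewrite subr_gt0.
by move=> w wz; apply: cauchy_ent => //; have := nm_lerB w z; lra.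
Qed.

Lemma ent_cder f : ent f -> ent (cder f).
Proof.
move=> fe z; pose r := nm z + 1; have zr : nm z < r by rewrite /r ltrDl.
have [l hl] := cauchy_kernel_deriv2 (ent_pcontM r fe) zr.
exists l; apply: cderiv_near hl; exists 1 => // w wz.
by apply/esym/cauchy_der => //; have := nm_lerB w z; rewrite /r; lra.
Qed.

Lemma ent_cst c : ent (fun=> c).
Proof. by move=> z; exists 0; exact: cderiv_cst. Qed.

Lemma ent_id : ent id.
Proof. by move=> z; exists 1; exact: cderiv_id. Qed.

Lemma entD f g : ent f -> ent g -> ent (fun z => f z + g z).
Proof. by move=> fe ge z; eexists; apply: cderivD; exact: cderP. Qed.

Lemma entN f : ent f -> ent (fun z => - f z).
Proof. by move=> fe z; eexists; apply: cderivN; exact: cderP. Qed.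

Lemma entB f g : ent f -> ent g -> ent (fun z => f z - g z).
Proof. by move=> fe ge; apply: entD => //; exact: entN. Qed.

Lemma entM f g : ent f -> ent g -> ent (fun z => f z * g z).
Proof. by move=> fe ge z; eexists; apply: cderivM; exact: cderP. Qed.

Lemma entX f n : ent f -> ent (fun z => f z ^+ n).
Proof.
move=> fe; elim: n => [|n IH]; first exact: ent_cst.
by rewrite (_ : (fun z => _) = (fun z => f z * f z ^+ n)); [exact: entM|apply/funext => z; rewrite exprS].
Qed.

Lemma ent_comp f g : ent f -> ent g -> ent (fun z => g (f z)).
Proof. by move=> fe ge z; eexists; apply: cderiv_comp; exact: cderP. Qed.

Lemma ent_sum (I : Type) (s : seq I) (F : I -> R[i] -> R[i]) :
  (forall i, ent (F i)) -> ent (fun z => \sum_(i <- s) F i z).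
Proof.
move=> Fe; elim: s => [|i s IH].
  by rewrite (_ : (fun z => _) = (fun=> 0)); [exact: ent_cst|apply/funext => z; rewrite big_nil].
rewrite (_ : (fun z => _) = (fun z => F i z + \sum_(j <- s) F j z)).
  by apply: entD.
by apply/funext => z; rewrite big_cons.
Qed.

Lemma ent_prod (I : Type) (s : seq I) (F : I -> R[i] -> R[i]) :
  (forall i, ent (F i)) -> ent (fun z => \prod_(i <- s) F i z).
Proof.
move=> Fe; elim: s => [|i s IH].
  by rewrite (_ : (fun z => _) = (fun=> 1)); [exact: ent_cst|apply/funext => z; rewrite big_nil].
rewrite (_ : (fun z => _) = (fun z => F i z * \prod_(j <- s) F j z)).
  by apply: entM.
by apply/funext => z; rewrite big_cons.
Qed.

Lemma ent_shift f c : ent f -> ent (fun z => f (z + c)).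
Proof.
move=> fe; apply: (@ent_comp (fun z => z + c)) => //.
by apply: entD; [exact: ent_id|exact: ent_cst].
Qed.

Lemma cder_shift f c z : ent f -> cder (fun w => f (w + c)) z = cder f (z + c).
Proof.
move=> fe; apply: cderE; rewrite -[cder f _]mulr1.
apply: (@cderiv_comp _ (fun w => w + c)); last exact: cderP.
by rewrite -[1]addr0; apply: cderivD; [exact: cderiv_id|exact: cderiv_cst].
Qed.

(** The quotient, completed by [cder f a], agrees locally with the Cauchy integral of f(w) / (w - a)
    over a large circle, so it is differentiable at [a] as well. *)
Lemma ent_divide f a : ent f -> f a = 0 -> exists2 g, ent g & forall z, f z = (z - a) * g z.
Proof.
move=> fe fa; pose g z := if z == a then cder f a else f z / (z - a).
exists g; last first.
  move=> z; rewrite /g; have [->|za] := eqVneq z a; first by rewrite fa subrr mul0r.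
  by rewrite mulrCA divff ?mulr1 // subr_eq0.
move=> z; pose r := nm z + nm a + 1.
have n0 := nm_ge0 z; have n1 := nm_ge0 a.
have zr : nm z < r by rewrite /r; lra.
have ar : nm a < r by rewrite /r; lra.
pose u t := f (circ r t) * circ r t / (circ r t - a).
have uc : pcont u by apply: pcontV_circ => //; exact: ent_pcontM.
eexists; apply: cderiv_near (cauchy_kernel_deriv uc zr).
exists 1 => // w wz; have wr : nm w < r by have := nm_lerB w z; rewrite /r; lra.
rewrite /g; have [->|wa] := eqVneq w a; first by rewrite (cauchy_der fe ar).
have wa0 : w - a != 0 by rewrite subr_eq0.
apply: (mulIf wa0); rewrite mulfVK // mulrC.
transitivity (f w - f a); last by rewrite fa subr0.
rewrite -(cauchy_ent fe wr) -(cauchy_ent fe ar) -cmeanB; [|by apply: pcontV_circ => //; exact: ent_pcontM..].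
rewrite -cmeanZ; last by apply: pcontV_circ.
apply: cmean_ext => t; rewrite /u; have c1 := circ_sub_neq0 t ar; have c2 := circ_sub_neq0 t wr.
by field; rewrite c1 c2.
Qed.

(** The bound comes from Cauchy's formula on the circle of radius r + 1, whose points are at
    distance at least 1 from the disc. *)
Lemma ent_bounded f r : ent f -> exists2 B, 0 <= B & forall z, nm z <= r -> nm (f z) <= B.
Proof.
move=> fe; have [r0|r0] := leP 0 r; last first.
  by exists 0 => // z zr; have := nm_ge0 z; lra.
pose M := rmean (fun t => (r + 1) * nm (f (circ (r + 1) t))).
have Mc : continuous (fun t => (r + 1) * nm (f (circ (r + 1) t))).
  by move=> x; apply: cvgMr; apply: (pcont_nm (ent_pcont _ fe)).
have M0 : 0 <= M.
  rewrite -[0](@rmean_cst R); apply: rmean_le => //; first by move=> x; exact: cvg_cst.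
  by move=> t; rewrite mulr_ge0 ?nm_ge0 //; lra.
exists M => // z zr; have zr1 : nm z < r + 1 by lra.
rewrite -(cauchy_ent fe zr1); apply: cmean_nm_le => //.
  by apply: pcontV_circ => //; exact: ent_pcontM.
move=> t; have r1 : 0 <= r + 1 by lra.
move: (circ (r + 1) t) (nm_circ t r1) => w wr; rewrite !nmM nmV wr.
have := nm_lerB w z; rewrite wr.
move=> h; have h1 : 1 <= nm (w - z) by lra.
rewrite ler_pdivrMr; last by lra.
by rewrite (mulrC (nm (f w))) ler_peMr // mulr_ge0 ?nm_ge0.
Qed.

Lemma ent_max_center f r B : ent f -> 0 < r -> (forall z, nm z = r -> nm (f z) <= B) ->
  nm (f 0) <= B.
Proof.
move=> fe r0 hB; rewrite -(@mean_value R f (r + 1) r) //; try first [exact: ent_hol|by rewrite ltrDl].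
apply: cmean_nm_bound; first exact: ent_pcont.
by move=> t; apply: hB; rewrite nm_circ // ltW.
Qed.

Lemma cauchy_estimate f z B : ent f -> (forall c, nm c <= 1 -> nm (f (z + c)) <= B) ->
  nm (cder f z) <= B.
Proof.
move=> fe hB; have ge : ent (fun w => f (w + z)) by exact: ent_shift.
have z1 : nm 0 < 1 :> R by rewrite nm0.
rewrite -[z]add0r -cder_shift // (cauchy_der ge z1).
apply: cmean_nm_bound; first by apply: (pcontV_circ _ z1); apply: (pcontV_circ _ z1); exact: (ent_pcontM 1 ge).
move=> t; move: (circ 1 t) (nm_circ t (@ler01 R)) => w wr.
rewrite subr0 !nmM !nmV wr !invr1 !mulr1 addrC; apply: hB.
by rewrite wr.
Qed.

Lemma cderiv0_const F rho : (forall z, nm z < rho -> cderiv F z 0) -> forall z, nm z < rho -> F z = F 0.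
Proof.
move=> dF z zr; have E : cint (fun=> 0) 0 1 = F (0 + 1%:C * z) - F (0 + 0%:C * z).
  apply: (@cint_FTC _ _ (fun t => F (0 + t%:C * z))); first exact: pcont_cst.
  move=> t; rewrite /btw => tb; have {tb} : 0 <= t <= 1.
    by move: tb => /orP[//|/andP[h1 h2]]; apply/andP; split; lra.
  move=> /andP[t0 t1]; have tr : nm (0 + t%:C * z) < rho.
    rewrite add0r nmM nmR ger0_norm //; apply: le_lt_trans zr.
    by rewrite ler_piMl ?nm_ge0.
  by have h := pderiv_comp (dF _ tr) (pderiv_segment 0 z t); rewrite mul0r in h.
move: E; rewrite cint_cst mul0r mul1r mul0r !add0r => /esym/eqP.
by rewrite subr_eq0 => /eqP.
Qed.

Lemma ent_const F : (forall z, cderiv F z 0) -> forall z, F z = F 0.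
Proof. by move=> dF z; apply: (@cderiv0_const F (nm z + 1)) => //; rewrite ltrDl. Qed.

Lemma mean_value_ineq f B z : ent f -> (forall w, nm w <= nm z -> nm (cder f w) <= B) ->
  nm (f z - f 0) <= B * nm z.
Proof.
move=> fe hB; have pc : pcont (fun t => cder f (0 + t%:C * z) * z).
  apply: pcontM; last exact: pcont_cst.
  apply: pcont_comp; last by apply: pderiv_pcont => t; exact: pderiv_segment.
  by move=> t; apply/ent_cont/ent_cder.
have E : cint (fun t => cder f (0 + t%:C * z) * z) 0 1 = f (0 + 1%:C * z) - f (0 + 0%:C * z).
  apply: (@cint_FTC _ _ (fun t => f (0 + t%:C * z))) => // t _.
  by apply: pderiv_comp; [exact: cderP|exact: pderiv_segment].
move: E; rewrite mul1r mul0r !add0r => <-.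
rewrite -[leRHS]mulr1 -[X in _ * X](_ : `|1 - 0| = 1); last by rewrite subr0 normr1.
apply: cint_nm_bound => // t; rewrite /btw => tb; have {tb} /andP[t0 t1] : 0 <= t <= 1.
  by move: tb => /orP[//|/andP[h1 h2]]; apply/andP; split; lra.
rewrite nmM ler_wpM2r ?nm_ge0 //; apply: hB.
by rewrite add0r nmM nmR ger0_norm // ler_piMl ?nm_ge0.
Qed.

End EntireFunctions.

(** * Zeros and logarithms *)

Section ComplexExponential.
Context {R : realType}.
Local Notation nm := (@normc R).
Implicit Types (z w : R[i]).

Lemma cexpD z w : cexp (z + w) = cexp z * cexp w.
Proof.
case: z => a b; case: w => c d; rewrite /cexp /= expRD cosD sinD.
by apply: complex_eq => /=; ring.
Qed.

Lemma cexp0 : cexp (0 : R[i]) = 1.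
Proof. by rewrite /cexp /= expR0 cos0 sin0; apply: complex_eq => /=; ring. Qed.

Lemma nm_cexp z : nm (cexp z) = expR (complex.Re z).
Proof.
rewrite /cexp nmM nmR ger0_norm ?expR_ge0 //.
by rewrite /normc cos2Dsin2 sqrtr1 mulr1.
Qed.

Lemma cexp_neq0 z : cexp z != 0.
Proof. by rewrite -nm_gt0 nm_cexp expR_gt0. Qed.

Lemma cderiv_cexp0 : cderiv (@cexp R) 0 1.
Proof.
move=> e e0.
pose e1 := Num.min 1 (e / 10).
have e10 : 0 < e1 by rewrite lt_min ltr01 divr_gt0.
have e11 : e1 <= 1 by rewrite ge_min lexx.
have e12 : e1 * 10 <= e by rewrite -ler_pdivlMr // ge_min lexx orbT.
clearbody e1.
have /rderivP := (is_derive_expR (0 : R)) => /(_ _ e10) [d1 d1p h1].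
have /rderivP := (is_derive_cos (0 : R)) => /(_ _ e10) [d2 d2p h2].
have /rderivP := (is_derive_sin (0 : R)) => /(_ _ e10) [d3 d3p h3].
exists (Num.min (Num.min d1 d2) (Num.min d3 e1)); first by rewrite !lt_min d1p d2p d3p e10.
move=> [x y]; rewrite subr0 mul1r !lt_min => /andP[/andP[k1 k2] /andP[k3 k4]].
have hx := nm_Re (x +i* y); have hy := nm_Im (x +i* y); rewrite /= in hx hy.
set N := nm _ in k1 k2 k3 k4 hx hy *.
have {}h1 : `|expR x - 1 - x| <= e1 * `|x|.
  by have := h1 x; rewrite subr0 expR0 mul1r; apply; lra.
have {}h2 : `|cos y - 1| <= e1 * `|y|.
  by have := h2 y; rewrite subr0 cos0 sin0 oppr0 mul0r subr0; apply; lra.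
have {}h3 : `|sin y - y| <= e1 * `|y|.
  by have := h3 y; rewrite subr0 sin0 cos0 mul1r subr0; apply; lra.
have E1 : nm (cos y +i* sin y) = 1 by rewrite /normc cos2Dsin2 sqrtr1.
have -> : cexp (x +i* y) - cexp 0 - (x +i* y) =
  (expR x - 1 - x)%:C * (cos y +i* sin y) + x%:C * ((cos y - 1) +i* sin y)
  + ((cos y - 1) +i* (sin y - y)).
  by rewrite cexp0 /cexp /=; apply: complex_eq => /=; ring.
have s1 : `|sin y| <= 2 * `|y|.
  have : `|sin y| <= `|sin y - y| + `|y| by rewrite -{1}(subrK y (sin y)) ler_normD.
  have := normr_ge0 y; nra.
apply: (le_trans (nmD _ _)); apply: (le_trans (lerD (nmD _ _) (nm_ReIm _))).
rewrite !nmM !nmR E1 mulr1 /=.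
have t1 : nm ((cos y - 1) +i* sin y) <= 3 * e1.
  apply: (le_trans (nm_ReIm _)) => /=; have := normr_ge0 y; nra.
have x0 := normr_ge0 x; have y0 := normr_ge0 y; have N0 : 0 <= N by exact: nm_ge0.
have t2 : `|x| * nm ((cos y - 1) +i* sin y) <= N * (3 * e1) by apply: ler_pM => //; exact: nm_ge0.
have t3 : e1 * `|x| <= e1 * N by rewrite ler_pM2l.
have t4 : e1 * `|y| <= e1 * N by rewrite ler_pM2l.
nra.
Qed.

Lemma cderiv_cexp z : cderiv (@cexp R) z (cexp z).
Proof.
apply: (@cderiv_near _ (fun w => cexp z * cexp (w - z))).
  by exists 1 => // w _; rewrite -cexpD addrC subrK.
rewrite -[X in cderiv _ _ X]mulr1; apply: cderivZ; rewrite -[1]mulr1.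
apply: (@cderiv_comp _ (fun w => w - z)); last by rewrite subrr; exact: cderiv_cexp0.
by rewrite -[1]subr0; apply: cderivB; [exact: cderiv_id|exact: cderiv_cst].
Qed.

Lemma cderiv_cexpM a z : cderiv (fun w => cexp (a * w)) z (a * cexp (a * z)).
Proof.
have h := cderiv_comp (cderivZ a (cderiv_id z)) (cderiv_cexp (a * z)).
by rewrite mulr1 mulrC in h.
Qed.

Lemma ent_cexpM a : ent (fun z : R[i] => cexp (a * z)).
Proof. by move=> z; eexists; exact: cderiv_cexpM. Qed.

(** [G] is the primitive of q' / q that vanishes at 0, and q exp(- G) has derivative 0. *)
Lemma holomorphic_log q rho r : ent q -> 0 < r -> r < rho -> (forall z, nm z < rho -> q z != 0) ->
  exists G, [/\ hol r G, G 0 = 0 & forall z, nm z < r -> q z = q 0 * cexp (G z)].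
Proof.
move=> qe r0 rr q0.
have hd z : nm z < rho -> exists l, cderiv (fun w => cder q w * (q w)^-1) z l.
  move=> /q0 qz; eexists; apply: cderivM; first exact/cderP/ent_cder.
  by apply: cderivV => //; exact: cderP.
have hc z : nm z < rho -> ccont (fun w => cder q w * (q w)^-1) z.
  by move=> /hd [l]; exact: cderiv_cont.
have [F dF] := @primitive_disc R _ rho r 0 r0 rr hc (fun z zr _ => hd z zr).
have dG z : nm z < r -> cderiv (fun w => F w - F 0) z (cder q z / q z).
  by move=> /dF h; rewrite -[_ / _]subr0; apply: cderivB => //; exact: cderiv_cst.
exists (fun z => F z - F 0); split; rewrite ?subrr //.
  by move=> z /dG h; eexists; exact: h.
move=> z zr.
have D w : nm w < r -> cderiv (fun w => q w * cexp (- (F w - F 0))) w 0.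
  move=> wr; have qw := q0 w (lt_trans wr rr).
  have h := cderivM (cderP w qe) (cderiv_comp (cderivN (dG w wr)) (cderiv_cexp _)).
  have E : cder q w * cexp (- (F w - F 0)) + q w * (cexp (- (F w - F 0)) * (- (cder q w / q w))) = 0.
    by field.
  by rewrite E in h.
have := cderiv0_const D zr; rewrite subrr oppr0 cexp0 mulr1 => <-.
by rewrite -mulrA -cexpD addNr cexp0 mulr1.
Qed.

End ComplexExponential.

(** * Factorization by zeros and their reflection in a circle *)

Section Zeros.
Context {R : realType}.
Local Notation nm := (@normc R).
Implicit Types (f g q G : R[i] -> R[i]) (a c z w : R[i]) (r rho B t : R) (s : seq R[i]).

Definition zprod s z : R[i] := \prod_(a <- s) (z - a).

Lemma ent_zprod s : ent (zprod s).
Proof. by apply: ent_prod => a; apply: entB; [exact: ent_id|exact: ent_cst]. Qed.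

Lemma zprod_eq0 s z : (zprod s z == 0) = (z \in s).
Proof.
rewrite /zprod; elim: s => [|a s IH]; first by rewrite big_nil oner_eq0.
by rewrite big_cons mulf_eq0 IH subr_eq0 in_cons.
Qed.

(** Let n be the size of [s]. On |z| = 3 r every |z - a| is at least 2 r, so |g| <= B / (2 r)^n
    there and hence at 0, while the product of the |a| is at most r^n. *)
Lemma zeros_size_bound f g s r B : ent f -> ent g -> (forall z, f z = zprod s z * g z) ->
  0 < r -> (forall a, a \in s -> nm a <= r) ->
  (forall z, nm z <= 3 * r -> nm (f z) <= B) -> 2 ^+ size s * nm (f 0) <= B.
Proof.
move=> fe ge fg r0 hs hB; have r2 : 0 < 2 * r by lra.
have pn : 0 < (2 * r) ^+ size s by rewrite exprn_gt0.
have g0 : nm (g 0) <= B / (2 * r) ^+ size s.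
  apply: (@ent_max_center _ g (3 * r)) => //; first by lra.
  move=> z zr; rewrite ler_pdivlMr //; apply: le_trans (hB z _); last by rewrite zr.
  rewrite fg nmM mulrC ler_wpM2r ?nm_ge0 // /zprod nm_prod.
  elim: s hs {fg pn} => [|a s IH] hs; first by rewrite big_nil expr0.
  rewrite big_cons exprS; apply: ler_pM; rewrite ?exprn_ge0 ?(ltW r2) //.
    have := nm_lerB z a; have := hs a (mem_head _ _); lra.
  by apply: IH => b bs; apply: hs; rewrite in_cons bs orbT.
have p0 : nm (zprod s 0) <= r ^+ size s.
  rewrite /zprod nm_prod; elim: s hs {fg pn g0} => [|a s IH] hs; first by rewrite big_nil expr0.
  rewrite big_cons exprS; apply: ler_pM; rewrite ?nm_ge0 ?prodr_ge0 //; try by move=> *; exact: nm_ge0.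
    by rewrite sub0r nmN; apply: hs; exact: mem_head.
  by apply: IH => b bs; apply: hs; rewrite in_cons bs orbT.
rewrite fg nmM mulrA; apply: (@le_trans _ _ ((2 * r) ^+ size s * nm (g 0))).
  by rewrite ler_wpM2r ?nm_ge0 // exprMn ler_pM2l ?exprn_gt0.
by rewrite mulrC -ler_pdivlMr.
Qed.

(** Zeros are divided out one at a time, repeated ones repeatedly. By [zeros_size_bound] the list
    never reaches length [N], where 2^N > B / |f 0|; in [key], [m] is the number of divisions still
    allowed. *)
Lemma zeros_factor0 f r B : ent f -> f 0 != 0 -> 0 < r ->
  (forall z, nm z <= 3 * r -> nm (f z) <= B) ->
  exists s q, [/\ ent q, forall z, f z = zprod s z * q z, forall z, nm z <= r -> q z != 0 &
    2 ^+ size s * nm (f 0) <= B].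
Proof.
move=> fe f0 r0 hB.
have fp : 0 < nm (f 0) by rewrite nm_gt0.
have [N hN] := pow2_gt (B / nm (f 0)).
have key m : forall s g, ent g -> (forall z, f z = zprod s z * g z) -> (forall a, a \in s -> nm a <= r) ->
   (N <= size s + m)%N -> exists s q, [/\ ent q, forall z, f z = zprod s z * q z,
      forall z, nm z <= r -> q z != 0 & 2 ^+ size s * nm (f 0) <= B].
  elim: m => [|m IH] s g ge fg hs.
    rewrite addn0 => Ns; have := zeros_size_bound fe ge fg r0 hs hB.
    rewrite leNgt => /negP[]; rewrite -ltr_pdivrMr //; apply: (lt_le_trans hN).
    by rewrite ler_eXn2l ?ltr1n.
  move=> Ns; have [h|/existsNP [a /not_implyP [ar /negP]]] := pselect (forall z, nm z <= r -> g z != 0).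
    by exists s, g; split => //; exact: (zeros_size_bound fe ge fg r0 hs hB).
  rewrite negbK => /eqP ga; have [g1 g1e gg] := ent_divide ge ga.
  apply: (IH (a :: s) g1) => //.
  - by move=> z; rewrite fg gg /zprod big_cons; ring.
  - by move=> b; rewrite in_cons => /orP[/eqP ->|/hs].
  - by rewrite /= addSnnS.
by apply: (key N [::] f) => // z; rewrite /zprod big_nil mul1r.
Qed.

(** Recentring at [z0] admits a zero of [f] at 0. The disc of radius 2 r about [z0] contains that of
    radius r about 0, and 3 (2 r) + r = 7 r. *)
Lemma zeros_factor f z0 r : ent f -> f z0 != 0 -> 0 < r -> nm z0 <= r ->
  exists s q, [/\ ent q, forall z, f z = zprod s z * q z, forall z, nm z <= r -> q z != 0 &
    forall B, (forall z, nm z <= 7 * r -> nm (f z) <= B) -> 2 ^+ size s * nm (f z0) <= B].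
Proof.
move=> fe fz0 r0 z0r.
(* The factorization has to precede the bound [B], so it is made for the least bound, [sup S]. *)
pose S := [set x : R | exists2 z, nm z <= 7 * r & x = nm (f z)].
have [B1 B10 hB1] := ent_bounded (7 * r) fe.
have Sne : S !=set0 by exists (nm (f z0)), z0 => //; lra.
have hS : has_ubound S by exists B1 => _ [z zr ->]; exact: hB1.
have ge : ent (fun z => f (z + z0)) by exact: ent_shift.
have g0 : f (0 + z0) != 0 by rewrite add0r.
have r2 : 0 < 2 * r by lra.
have [|s [q [qe fq qn sb]]] := @zeros_factor0 (fun z => f (z + z0)) (2 * r) (sup S) ge g0 r2.
  move=> z zr; apply: ub_le_sup => //; exists (z + z0) => //.
  by have := nmD z z0; lra.
exists [seq a + z0 | a <- s], (fun z => q (z - z0)); split.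
- exact: (ent_shift (- z0)).
- move=> z; rewrite -{1}(subrK z0 z) fq /zprod big_map; congr (_ * _).
  by apply: eq_bigr => a _; ring.
- by move=> z zr; apply: qn; have := nmB z z0; lra.
- move=> B hB; rewrite size_map; move: sb; rewrite add0r => sb; apply: (le_trans sb).
  by apply: ge_sup => // _ [z zr ->]; exact: hB.
Qed.

(** [holomorphic_log] requires a zero-free disc larger than the one where the logarithm is wanted.
    Only finitely many zeros lie within r + 1, which leaves a gap beyond [r]. *)
Lemma zerofree_extend f r : ent f -> 0 < r -> (forall z, nm z <= r -> f z != 0) ->
  exists2 rho, r < rho & forall z, nm z < rho -> f z != 0.
Proof.
move=> fe r0 fn; have f0 : f 0 != 0 by apply: fn; rewrite nm0 ltW.
have r1 : 0 < r + 1 by lra.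
have [|s [q [qe fq qn _]]] := @zeros_factor f 0 (r + 1) fe f0 r1; first by rewrite nm0 ltW.
have hs a : a \in s -> r < nm a.
  move=> as_; rewrite ltNge; apply/negP => /fn; rewrite fq mulf_eq0 zprod_eq0 as_ //.
have [rho h1 [h2 h3]] : exists2 rho, r < rho & rho <= r + 1 /\ forall a, a \in s -> rho <= nm a.
  elim: s hs {fq} => [|a s IH] hs; first by exists (r + 1); [rewrite ltrDl|split].
  have [|rho h1 [h2 h3]] := IH; first by move=> b bs; apply: hs; rewrite in_cons bs orbT.
  exists (Num.min rho (nm a)); first by rewrite lt_min h1 hs // mem_head.
  split; first by rewrite ge_min h2.
  by move=> b; rewrite in_cons ge_min => /orP[/eqP ->|/h3 ->]; rewrite ?lexx ?orbT.
exists rho => // z zr; rewrite fq mulf_neq0 //; last by apply: qn; lra.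
by rewrite zprod_eq0; apply/negP => /h3; rewrite leNgt zr.
Qed.

(** For |a| < r this is (r^2 - a^* z) / r, which vanishes at the reflection of [a] in the circle (at
    infinity if a = 0); the quotient of [z - a] by it is a Blaschke factor. *)
Definition bfactor r a z : R[i] := if nm a < r then r%:C - a^* * z / r%:C else z - a.

Lemma ent_bfactor r a : ent (bfactor r a).
Proof.
rewrite (_ : bfactor r a = if nm a < r then (fun z => r%:C - a^* * z / r%:C) else (fun z => z - a)).
  case: ifP => _; apply: entB; try exact: ent_cst; try exact: ent_id.
  apply: entM; last exact: ent_cst.
  by apply: entM; [exact: ent_cst|exact: ent_id].
by apply/funext => z; rewrite /bfactor; case: ifP.
Qed.

(** The sign of the right-hand side yields the three properties below: domination in the disc,
    equality on the circle, absence of zeros. *)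
Lemma bfactor_sqr r a z : 0 < r -> nm a < r ->
  nm (bfactor r a z) ^+ 2 - nm (z - a) ^+ 2 = (r ^+ 2 - nm z ^+ 2) * (r ^+ 2 - nm a ^+ 2) / r ^+ 2.
Proof.
move=> r0 ar; rewrite /bfactor ar -realC_V !nm_sqr.
case: a ar => a b _; case: z => x y /=; field; exact: lt0r_neq0.
Qed.

Lemma bfactor_ge r a z : 0 < r -> nm z <= r -> nm (z - a) <= nm (bfactor r a z).
Proof.
move=> r0 zr; have [ar|ra] := ltP (nm a) r; last by rewrite /bfactor ltNge ra.
rewrite -(@ler_pXn2r _ 2) ?nnegrE ?nm_ge0 // -subr_ge0 bfactor_sqr //.
have a0 := nm_ge0 a; have z0 := nm_ge0 z.
apply: divr_ge0; last by rewrite exprn_ge0 // ltW.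
by apply: mulr_ge0; rewrite subr_ge0 ler_pXn2r ?nnegrE // ltW.
Qed.

Lemma bfactor_eq r a z : 0 < r -> nm z = r -> nm (bfactor r a z) = nm (z - a).
Proof.
move=> r0 zr; have [ar|ra] := ltP (nm a) r; last by rewrite /bfactor ltNge ra.
apply/eqP; rewrite -(@eqrXn2 _ 2) ?nm_ge0 // -subr_eq0 bfactor_sqr //.
by rewrite zr subrr !mul0r.
Qed.

Lemma bfactor_neq0 r a z : 0 < r -> nm a != r -> nm z <= r -> bfactor r a z != 0.
Proof.
move=> r0 nar zr; rewrite -nm_gt0; have [ar|ra] := ltP (nm a) r; last first.
  rewrite /bfactor; case: ifP => [|_]; first by rewrite ltNge ra.
  rewrite nm_gt0 subr_eq0; apply/negP => /eqP e.
  by move: nar; rewrite -e; move: ra; rewrite -e; case: ltgtP zr.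
rewrite lt_def nm_ge0 andbT; apply/negP => /eqP b0.
have := bfactor_sqr z r0 ar; rewrite b0 expr0n /= sub0r => E.
have [zr'|zr'] := ltP (nm z) r.
  have : 0 < (r ^+ 2 - nm z ^+ 2) * (r ^+ 2 - nm a ^+ 2) / r ^+ 2.
    rewrite divr_gt0 ?exprn_gt0 // mulr_gt0 // subr_gt0 ltr_pXn2r ?nnegrE ?nm_ge0 // ltW //.
  by rewrite -E ltNge oppr_le0 sqr_ge0.
have zr2 : nm z = r by apply/eqP; rewrite eq_le zr.
move: E; rewrite zr2 subrr !mul0r => /eqP; rewrite oppr_eq0 expf_eq0 /= nm_eq0 subr_eq0 => /eqP za.
by move: ar; rewrite -za zr2 ltxx.
Qed.

Lemma nm_bfactor0 r a : 0 < r -> nm (bfactor r a 0) = Num.max r (nm a).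
Proof.
move=> r0; rewrite /bfactor; case: ltP => h.
  by rewrite mulr0 mul0r subr0 nmR ger0_norm // ltW.
by rewrite sub0r nmN.
Qed.

(* Replacing the zeros [a] inside the circle by their reflections yields a zero-free
   function with the same modulus on the circle, hence a holomorphic logarithm [G]. *)
Lemma log_majorant s q r : ent q -> 0 < r -> (forall z, nm z <= r -> q z != 0) ->
  (forall a, a \in s -> nm a != r) ->
  exists G rho, [/\ r < rho, hol rho G,
    forall z, nm z <= r -> nm (zprod s z * q z) <= expR (complex.Re (G z)),
    forall z, nm z = r -> nm (zprod s z * q z) = expR (complex.Re (G z)) &
    complex.Re (G 0) = ln (nm (q 0)) + \sum_(a <- s) ln (Num.max r (nm a))].
Proof.
move=> qe r0 qn sn; pose F z := (\prod_(a <- s) bfactor r a z) * q z.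
have Fe : ent F by apply: entM => //; apply: ent_prod => a; exact: ent_bfactor.
have Fn z : nm z <= r -> F z != 0.
  move=> zr; rewrite mulf_neq0 ?qn // -nm_gt0 nm_prod big_seq prodr_gt0 // => a as_.
  by rewrite nm_gt0 bfactor_neq0 // sn.
have [rho0 r1 Fn0] := zerofree_extend Fe r0 Fn.
pose rho := (r + rho0) / 2.
have rr : r < rho by rewrite /rho; lra.
have [||G [hG G0 FG]] := @holomorphic_log R F rho0 rho Fe _ _ Fn0; rewrite /rho; try by lra.
have F0 : 0 < nm (F 0) by rewrite nm_gt0 Fn // nm0 ltW.
have nmF z : nm z <= r -> nm (F z) = expR (complex.Re (G z + (ln (nm (F 0)))%:C)).
  move=> zr; rewrite reD expRD /= lnK ?posrE // mulrC -nm_cexp -nmM -FG //; lra.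
exists (fun z => G z + (ln (nm (F 0)))%:C), rho; split => //.
- by move=> z /hG [l hl]; exists (l + 0); apply: cderivD => //; exact: cderiv_cst.
- move=> z zr; rewrite -nmF // /F !nmM ler_wpM2r ?nm_ge0 // !nm_prod.
  by apply: ler_prod => a _; rewrite nm_ge0 bfactor_ge.
- move=> z zr; rewrite -nmF ?zr // /F !nmM; congr (_ * _); rewrite !nm_prod.
  by apply: eq_bigr => a _; rewrite bfactor_eq.
- rewrite G0 add0r /= /F nmM nm_prod lnM ?posrE; last 2 first.
  + rewrite prodr_gt0 // => a _; rewrite nm_bfactor0 // lt_max r0 //.
  + by rewrite nm_gt0 qn // nm0 ltW.
  rewrite addrC; congr (_ + _); elim: s {sn F Fe Fn rho0 r1 Fn0 rho rr G hG G0 FG F0 nmF} => [|a s IH].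
    by rewrite !big_nil ln1.
  rewrite !big_cons lnM ?IH ?nm_bfactor0 ?posrE // ?lt_max ?r0 //.
  by rewrite prodr_gt0 // => b _; rewrite nm_bfactor0 // lt_max r0.
Qed.

End Zeros.

(** * Means over circles *)

Section CircleMeans.
Context {R : realType}.
Local Notation nm := (@normc R).
Implicit Types (f g q G : R[i] -> R[i]) (a c z w : R[i]) (r rho B t x y : R) (s : seq R[i]).

Lemma continuous_ln_comp (u : R -> R) : continuous u -> (forall t, 0 < u t) ->
  continuous (fun t => ln (u t)).
Proof.
by move=> uc u0 t; exact: (continuous_comp (uc t) (continuous_ln (u0 t))).
Qed.

(** In this form [ln] is applied only to numbers at least 1, where it is continuous. *)
Lemma logpE x : logp x = ln (Num.max 1 x).
Proof.
rewrite /logp; have [x1|x1] := leP 1 x.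
  by rewrite max_r // ln_ge0.
by rewrite ln1 max_l // ln_le0 // ltW.
Qed.

Lemma logp_ge0 x : 0 <= logp x.
Proof. by rewrite le_max lexx. Qed.

Lemma le_logp x y : x <= y -> logp x <= logp y.
Proof.
by move=> xy; rewrite !logpE ler_ln ?posrE ?lt_max ?ltr01 // ge_max le_max lexx /= le_max xy orbT.
Qed.

Lemma normr_ln x : `|ln x| = 2 * logp x - ln x.
Proof.
rewrite /logp; have [l0|l0] := leP 0 (ln x).
  by rewrite ger0_norm // ; ring.
by rewrite ltr0_norm //; ring.
Qed.

Lemma continuous_logp (p : R -> R[i]) : pcont p -> continuous (fun t => logp (nm (p t))).
Proof.
move=> pc; rewrite (_ : (fun t => _) = (fun t => ln (Num.max 1 (nm (p t))))); last first.
  by apply/funext => t; rewrite logpE.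
apply: continuous_ln_comp; last by move=> t; rewrite lt_max ltr01.
move=> t; apply: (@continuous_max _ _ (fun=> 1) (fun t => nm (p t))); first exact: cvg_cst.
exact: (pcont_nm pc).
Qed.

Definition lmean f r := rmean (fun t => ln (nm (f (circ r t)))).
(* m(r, f), see [proximityE]. *)
Definition pmean f r := rmean (fun t => logp (nm (f (circ r t)))).

Lemma proximityE f r : ent f -> proximity f r = pmean f r.
Proof.
move=> fe; rewrite /proximity /pmean /rmean -Rintegral_rint //.
  by apply: continuous_logp; exact: ent_pcont.
by rewrite ltW // twopi_gt0.
Qed.

Lemma continuous_lmean f r : ent f -> 0 <= r -> (forall z, nm z = r -> f z != 0) ->
  continuous (fun t => ln (nm (f (circ r t)))).
Proof.
move=> fe r0 fn; apply: continuous_ln_comp; first exact: pcont_nm (ent_pcont r fe).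
by move=> t; rewrite nm_gt0 fn // nm_circ.
Qed.

Lemma continuous_pmean f r : ent f -> continuous (fun t => logp (nm (f (circ r t)))).
Proof. by move=> fe; apply: continuous_logp; exact: ent_pcont. Qed.

Lemma rmean_abs_ln f r : ent f -> 0 <= r -> (forall z, nm z = r -> f z != 0) ->
  rmean (fun t => `|ln (nm (f (circ r t)))|) = 2 * pmean f r - lmean f r.
Proof.
move=> fe r0 fn; rewrite /pmean /lmean -rmeanZ; last exact: continuous_pmean.
rewrite -rmeanB; last 2 first.
- by move=> x; apply: cvgMr; exact: continuous_pmean.
- exact: continuous_lmean.
by apply: rmean_ext => t; rewrite normr_ln.
Qed.

(** On the circle, 2 Re G is the sum of G and its conjugate. The first part is Cauchy's formula. The
    kernel is the conjugate of k(w) = r^2 / (r^2 - z^* w), so the second part is the conjugate of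
    the mean of G k, which is the value of G k at 0, and k(0) = 1. *)
Lemma schwarz_formula G rho r z : hol rho G -> r < rho -> nm z < r ->
  cmean (fun t => (2 * complex.Re (G (circ r t)))%:C * circ r t / (circ r t - z)) = G z + (G 0)^*.
Proof.
move=> hG rr zr; have r0 : 0 < r by have := nm_ge0 z; lra.
have cr t : nm (circ r t) < rho by rewrite nm_circ // ltW.
have Gc : pcont (fun t => G (circ r t)) by apply: pcont_circ_comp => t; exact: hol_ccont hG (cr t).
have cJ (p : R -> R[i]) : pcont p -> pcont (fun t => (p t)^*).
  by move=> pc; apply: (@pcont_comp _ (fun z => z^*)) => // t; exact: ccont_conj.
pose k w := (r ^+ 2)%:C / ((r ^+ 2)%:C - z^* * w).
(* [k] is holomorphic while |z| |w| < r^2, which leaves room beyond [r] because |z| < r. *)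
have [rho' [r1 r2 r3]] : exists rho', [/\ r < rho', rho' <= rho & rho' * nm z <= r ^+ 2].
  have [->|z0] := eqVneq z 0.
    by exists rho; rewrite nm0 mulr0 sqr_ge0.
  have zp : 0 < nm z by rewrite nm_gt0.
  exists (Num.min rho (r ^+ 2 / nm z)).
  rewrite lt_min rr ltr_pdivlMr // expr2 ltr_pM2l // zr ge_min lexx; split=> //.
  by rewrite -ler_pdivlMr // ge_min lexx orbT.
have den w : nm w < rho' -> (r ^+ 2)%:C - z^* * w != 0.
  move=> h; rewrite subr_eq0; apply/negP => /eqP e.
  have : nm z * nm w = r ^+ 2 by rewrite -(nmJ z) -nmM -e nmR ger0_norm ?sqr_ge0.
  have [z0|z0] := eqVneq (nm z) 0.
    by rewrite z0 mul0r => /esym/eqP; rewrite expf_eq0 /= gt_eqF.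
  have zp : 0 < nm z by rewrite lt_def z0 nm_ge0.
  by apply/eqP; rewrite lt_eqF // mulrC; apply: lt_le_trans r3; rewrite ltr_pM2r.
have hH : hol rho' (fun w => G w * k w).
  move=> w wr; have [l dl] := hG w (lt_le_trans wr r2).
  eexists; apply: cderivM; first exact: dl.
  apply: cderivZ; apply: cderivV; first exact: den.
  by apply: cderivB; [exact: cderiv_cst|apply: cderivZ; exact: cderiv_id].
have E := mean_value hH r0 r1.
have Hc : pcont (fun t => G (circ r t) * k (circ r t)).
  by apply: (@pcont_circ_comp _ (fun w => G w * k w)) => t; apply: hol_ccont hH _; rewrite nm_circ // ltW.
have -> : (fun t => (2 * complex.Re (G (circ r t)))%:C * circ r t / (circ r t - z)) =
   (fun t => G (circ r t) * circ r t / (circ r t - z) + (G (circ r t) * k (circ r t))^*).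
  apply/funext => t; have c0 := circ_neq0 t r0; have c1 := circ_sub_neq0 t zr.
  have cc : circ r t * (circ r t)^* = (r ^+ 2)%:C by rewrite mulJ nm_circ // ltW.
  have e1 : (circ r t)^* - z^* != 0 by rewrite -rmorphB conjC_eq0.
  have e2 : (r ^+ 2)%:C - z^* * circ r t != 0 by apply: den; rewrite nm_circ // ltW.
  have cJ0 : (circ r t)^* != 0 by rewrite conjC_eq0.
  have -> : k (circ r t) = (circ r t)^* / ((circ r t)^* - z^*).
    by rewrite /k -cc in e2 *; field; rewrite e1 e2.
  have kk : ((circ r t)^* / ((circ r t)^* - z^*))^* = circ r t / (circ r t - z).
    by rewrite rmorphM fmorphV rmorphB /= !conjCK.
  have gg : (2 * complex.Re (G (circ r t)))%:C = G (circ r t) + (G (circ r t))^*.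
    by case: (G (circ r t)) => x y; apply: complex_eq => /=; ring.
  have -> : (G (circ r t) * ((circ r t)^* / ((circ r t)^* - z^*)))^* =
      (G (circ r t))^* * (circ r t / (circ r t - z)) by rewrite -kk -rmorphM.
  by rewrite gg; ring.
rewrite cmeanD.
- by rewrite (cauchy_formula hG rr zr) cmeanJ // E /k mulr0 subr0 divff ?mulr1 // realC_eq0 expf_neq0 // gt_eqF.
- apply: pcontV_circ => //; apply: pcontM => //; exact: pcont_circ.
- exact: cJ.
Qed.

(** Two Schwarz integrals are subtracted; their kernels differ by w' (z - w) / ((w' - z) (w' - w))
    at the point w' of the circle. The mean of |Re G| has the role that Re G(0) has for positive
    harmonic functions. *)
Lemma harnack G rho r z w : hol rho G -> r < rho -> nm z < r -> nm w < r ->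
  nm (G z - G w) <= rmean (fun t => `|complex.Re (G (circ r t))|) *
    (2 * r * nm (z - w) / ((r - nm z) * (r - nm w))).
Proof.
move=> hG rr zr wr; have r0 : 0 < r by have := nm_ge0 z; lra.
have cr t : nm (circ r t) < rho by rewrite nm_circ // ltW.
have Gc : pcont (fun t => G (circ r t)) by apply: pcont_circ_comp => t; exact: hol_ccont hG (cr t).
have uc := pcont_Re Gc.
have ac : continuous (fun t => `|complex.Re (G (circ r t))|).
  by move=> t; apply: continuous_comp; [exact: uc|exact: norm_continuous].
have vc : pcont (fun t => (2 * complex.Re (G (circ r t)))%:C * circ r t).
  apply: pcontM; last exact: pcont_circ.
  by apply: pcont_real => t; apply: cvgMr; exact: uc.
have -> : G z - G w = (G z + (G 0)^*) - (G w + (G 0)^*) by ring.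
rewrite -(schwarz_formula hG rr zr) -(schwarz_formula hG rr wr) -cmeanB; [|exact: pcontV_circ..].
set K := _ / _; rewrite mulrC -rmeanZ //; apply: cmean_nm_le.
- rewrite (_ : (fun t => _) = (fun t => (2 * complex.Re (G (circ r t)))%:C * circ r t * ((circ r t - z)^-1 * (circ r t - w)^-1 * (z - w)))).
    apply: pcontM => //; apply: pcontM; last exact: pcont_cst.
    by apply: pcontM; exact: pcont_invB.
  apply/funext => t; have c1 := circ_sub_neq0 t zr; have c2 := circ_sub_neq0 t wr.
  by field; rewrite c1 c2.
- by move=> t; apply: cvgMr; exact: ac.
move=> t; have c1 := circ_sub_neq0 t zr; have c2 := circ_sub_neq0 t wr.
have -> : (2 * complex.Re (G (circ r t)))%:C * circ r t / (circ r t - z) -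
  (2 * complex.Re (G (circ r t)))%:C * circ r t / (circ r t - w) =
  (2 * complex.Re (G (circ r t)))%:C * (circ r t * (z - w)) / ((circ r t - z) * (circ r t - w)).
  by field; rewrite c1 c2.
have r0' := ltW r0.
have k1 := nm_lerB (circ r t) z; have k2 := nm_lerB (circ r t) w.
move: (circ r t) (nm_circ t r0') c1 c2 k1 k2 => v vr c1 c2; rewrite vr => k1 k2.
rewrite nmM (nmM (_)%:C) (nmM v) vr nmR nmV nmM normrM ger0_norm //.
rewrite /K; have q1 : 0 < r - nm z by lra.
have q2 : 0 < r - nm w by lra.
rewrite [leRHS]mulrC.
rewrite (_ : _ * (2 * r * nm (z - w) / _) = 2 * `|complex.Re (G v)| * (r * nm (z - w)) / ((r - nm z) * (r - nm w))); last by ring.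
rewrite ler_wpM2l ?mulr_ge0 ?nm_ge0 //.
rewrite lef_pV2 ?posrE ?mulr_gt0 //; try lra.
by apply: ler_pM => //; exact: ltW.
Qed.

(** Re G is harmonic with boundary values ln |f|, so it is their Poisson integral and its mean over
    every smaller circle is [lmean f r]. The factor in the last clause is the mean of the absolute
    value of ln |f|, by [rmean_abs_ln]. *)
Lemma poisson_majorant f z0 r : ent f -> f z0 != 0 -> 0 < r -> (forall z, nm z = r -> f z != 0) ->
  exists G : R[i] -> R[i], [/\ forall z, nm z <= r -> nm (f z) <= expR (complex.Re (G z)),
    complex.Re (G 0) = lmean f r,
    forall r', 0 < r' -> r' < r -> pcont (fun t => G (circ r' t)) /\
       rmean (fun t => complex.Re (G (circ r' t))) = lmean f r &
    forall z w, nm z < r -> nm w < r -> nm (G z - G w) <=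
      (2 * pmean f r - lmean f r) * (2 * r * nm (z - w) / ((r - nm z) * (r - nm w)))].
Proof.
move=> fe fz0 r0 fn; pose r1 := Num.max r (nm z0).
have r10 : 0 < r1 by rewrite lt_max r0.
have zr1 : nm z0 <= r1 by rewrite le_max lexx orbT.
have rr1 : r <= r1 by rewrite le_max lexx.
have [s [q [qe fq qn _]]] := zeros_factor fe fz0 r10 zr1.
have sn a : a \in s -> nm a != r.
  by move=> as_; apply/negP => /eqP /fn; rewrite fq mulf_eq0 zprod_eq0 as_.
have [|G [rho [rr hG G1 G2 _]]] := log_majorant qe r0 _ sn.
  by move=> z zr; apply: qn; exact: le_trans zr rr1.
have cr r' t : 0 < r' -> r' <= r -> nm (circ r' t) < rho by move=> a b; rewrite nm_circ; lra.
have Gc r' : 0 < r' -> r' <= r -> pcont (fun t => G (circ r' t)).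
  by move=> a b; apply: pcont_circ_comp => t; apply: hol_ccont hG _; exact: cr.
have uE t : complex.Re (G (circ r t)) = ln (nm (f (circ r t))).
  by rewrite fq G2 ?nm_circ ?expRK // ltW.
have m r' : 0 < r' -> r' <= r -> rmean (fun t => complex.Re (G (circ r' t))) = complex.Re (G 0).
  by move=> a b; rewrite -cmean_Re; congr complex.Re; apply: (mean_value hG) => //; lra.
have J : complex.Re (G 0) = lmean f r by rewrite -(m r) //; exact: rmean_ext.
exists G; split => //.
- by move=> z /G1; rewrite -fq.
- by move=> r' a b; rewrite m ?J ?(ltW b) //; split=> //; apply: Gc => //; exact: ltW.
- move=> z w zr wr; rewrite -rmean_abs_ln // ?(ltW r0) //.
  have -> : rmean (fun t => `|ln (nm (f (circ r t)))|) = rmean (fun t => `|complex.Re (G (circ r t))|).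
    by apply: rmean_ext => t; rewrite uE.
  exact: (harnack hG rr zr wr).
Qed.

(** Jensen's formula in terms of the list of zeros, before the passage to [Ncount]. *)
Lemma lmean_sum s q f r : ent q -> (forall z, f z = zprod s z * q z) ->
  0 < r -> (forall z, nm z <= r -> q z != 0) -> (forall a, a \in s -> nm a != r) ->
  lmean f r = ln (nm (q 0)) + \sum_(a <- s) ln (Num.max r (nm a)).
Proof.
move=> qe fq r0 qn sn; have [G [rho [rr hG _ G2 <-]]] := log_majorant qe r0 qn sn.
rewrite -(mean_value hG r0 rr) cmean_Re; apply: rmean_ext => t.
by rewrite fq G2 ?nm_circ ?expRK // ltW.
Qed.

End CircleMeans.

(** * Multiplicities and the counting function *)

Section Bridge.
Context {R : realType}.
Local Notation nm := (@normc R).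
Implicit Types (f g q G : R[i] -> R[i]) (a c z w l : R[i]) (r rho t x y : R) (s : seq R[i]).

Lemma complex_gt0 (e : R[i]) : 0 < e -> exists2 e' : R, 0 < e' & e = e'%:C.
Proof.
by case: e => a b; rewrite ltcE /= => /andP[/eqP -> a0]; exists a.
Qed.

Lemma normc_norm z : `|z| = (nm z)%:C.
Proof. by []. Qed.

Lemma nearP (P : R[i] -> Prop) z :
  (\forall w \near (z : R[i]^o), P w) <-> exists2 d : R, 0 < d & forall w, nm (w - z) < d -> P w.
Proof.
rewrite nbhs_normP; split.
  move=> [e /= /complex_gt0 [d d0 ->] h]; exists d => // w wz; apply: h => /=.
  by rewrite distrC normc_norm ltcR.
move=> [d d0 h]; exists d%:C; first by rewrite /= ltcR.
by move=> w /=; rewrite distrC normc_norm ltcR => /h.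
Qed.

Lemma dnearP (P : R[i] -> Prop) z :
  (\forall w \near (z : R[i]^o)^', P w) <-> exists2 d : R, 0 < d & forall w, nm (w - z) < d -> w != z -> P w.
Proof.
split.
  by move=> /nearP.
by move=> h; apply/nearP.
Qed.

Lemma cderiv_derivable f z l : cderiv f z l ->
  derivable (f : R[i]^o -> R[i]^o) z 1 /\ derive1 (f : R[i]^o -> R[i]^o) z = l.
Proof.
move=> h.
suff k : ((h^-1 *: ((f (h *: 1 + z) : R[i]^o) - f z)) @[h --> (0 : R[i]^o)^'] --> (l : R[i]^o)).
  split; first exact: cvgP k.
  rewrite derive1E; exact: cvg_lim k.
apply/cvgrPdist_le => e /complex_gt0 [e' e'0 ->].
have [d d0 hd] := h _ e'0.
apply/dnearP; exists d => // w; rewrite subr0 => wd w0.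
have := hd (w + z); rewrite addrK => /(_ wd) {}hd.
rewrite normc_norm lecR.
have wp : 0 < nm w by rewrite nm_gt0.
rewrite -(ler_pM2r wp) -nmM; apply: le_trans hd; rewrite -nmN.
rewrite le_eqVlt; apply/orP; left; apply/eqP; congr (normc _).
have -> : (w *: (1 : R[i]^o) + z) = w + z by rewrite /GRing.scale /= mulr1.
have -> (u : R[i]) : w^-1 *: (u : R[i]^o) = w^-1 * u by [].
by field.
Qed.

Lemma derivable_cderiv f z : derivable (f : R[i]^o -> R[i]^o) z 1 ->
  cderiv f z (derive1 (f : R[i]^o -> R[i]^o) z).
Proof.
rewrite derive1E /derive; set L := lim _ => dp.
have kL : (h^-1 *: (((f : R[i]^o -> R[i]^o) \o shift z) (h *: (1 : R[i]^o)) - f z)) @[h --> (0 : R[i]^o)^'] --> L by exact: dp.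
move: L kL => L kL e e0.
have e0' : 0 < e%:C by rewrite ltcR.
have := kL; move=> /cvgrPdist_le /(_ _ e0') /dnearP [d d0 hd].
exists d => // w wd; have [->|wz] := eqVneq w z; first by rewrite !subrr mulr0 subrr nm0 mulr0.
have wz0 : w - z != 0 by rewrite subr_eq0.
have := hd (w - z); rewrite subr0 => /(_ wd wz0); rewrite normc_norm lecR.
have wp : 0 < nm (w - z) by rewrite nm_gt0.
rewrite -(ler_pM2r wp) -nmM; apply: le_trans; rewrite -nmN /=.
have -> : ((w - z) *: (1 : R[i]^o) + z) = w by rewrite /GRing.scale /= mulr1 subrK.
have -> (u : R[i]) : (w - z)^-1 *: (u : R[i]^o) = (w - z)^-1 * u by [].
rewrite le_eqVlt; apply/orP; left; apply/eqP; congr (normc _).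
by field.
Qed.

Lemma entire_ent f : entire f -> ent f.
Proof. by move=> h z; exists (derive1 (f : R[i]^o -> R[i]^o) z); exact/derivable_cderiv/h. Qed.

Lemma derive1_cder f z : ent f -> derive1 (f : R[i]^o -> R[i]^o) z = cder f z.
Proof. by move=> /(cderP z) /cderiv_derivable []. Qed.

(** Two different leading exponents at [z] would make one cofactor a positive power of [w - z] times
    the other. This lemma contradicts that, hence gives uniqueness of the exponent. *)
Lemma power_factor_eq0 g h z (k : nat) (d : R) : ccont g z -> ccont h z -> 0 < d ->
  (forall w, nm (w - z) < d -> w != z -> g w = (w - z) ^+ k.+1 * h w) -> g z = 0.
Proof.
move=> gc hc d0 gh.
pose F w := (w - z) ^+ k.+1 * h w.
have Fc : ccont F z.
  apply: ccontM => //; apply: cderiv_cont (cderP z _); apply: entX.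
  by apply: entB; [exact: ent_id|exact: ent_cst].
have Fz : F z = 0 by rewrite /F subrr expr0n mul0r.
apply/eqP; rewrite -nm_eq0; apply/negPn/negP => n0.
have e0 : 0 < nm (g z) / 2 by rewrite divr_gt0 // lt_def n0 nm_ge0.
have [d1 d1p h1] := gc _ e0; have [d2 d2p h2] := Fc _ e0.
pose dd := Num.min d (Num.min d1 d2).
have dd0 : 0 < dd by rewrite !lt_min d0 d1p.
have ddd : dd <= d by rewrite ge_min lexx.
have dd1 : dd <= d1 by rewrite !ge_min lexx orbT.
have dd2 : dd <= d2 by rewrite !ge_min lexx !orbT.
pose w := z + (dd / 2)%:C.
have wz : w - z = (dd / 2)%:C by rewrite /w addrAC subrr add0r.
have nw : nm (w - z) = dd / 2 by rewrite wz nmR ger0_norm; lra.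
have w0 : w != z by rewrite -subr_eq0 wz realC_eq0; lra.
have k1 : nm (g w - g z) < nm (g z) / 2 by apply: h1; rewrite nw; lra.
have k2 : nm (F w - F z) < nm (g z) / 2 by apply: h2; rewrite nw; lra.
have k3 : g w = F w by apply: gh => //; rewrite nw; lra.
rewrite Fz subr0 in k2; rewrite k3 in k1.
have := nm_lerB (g z) (F w); rewrite nm_distC; lra.
Qed.

Lemma near_derivable_ccont g z : (\forall w \near (z : R[i]^o), derivable (g : R[i]^o -> R[i]^o) w 1) -> ccont g z.
Proof.
move=> /nearP [d d0 h]; apply: cderiv_cont (derivable_cderiv (h z _)).
by rewrite subrr nm0.
Qed.

(** A positive exponent is excluded by [power_factor_eq0]. At a zero of [f] no exponent -n is
    admissible, and the value is the default 0 of [xget]. *)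
Lemma pole_mult_ent f z : ent f -> pole_mult f z = 0%N.
Proof.
move=> fe; rewrite /pole_mult; case: xgetP => // -[//|n] _ /= [g [gd gz /dnearP [d d0 h]]].
have g0 : g z = 0.
  apply: (@power_factor_eq0 g f z n d) => //; first exact: near_derivable_ccont.
    exact: ent_cont.
  move=> w wd wz; rewrite h // mulrA -exprnN mulfV ?mul1r //.
  by rewrite expf_neq0 // subr_eq0.
by rewrite g0 eqxx in gz.
Qed.

Lemma Ncount_ent f r : ent f -> Ncount f r = 0.
Proof.
move=> fe; have np t : npoles f t = 0.
  by rewrite /npoles; apply: fsbig1 => z _; rewrite pole_mult_ent.
rewrite /Ncount np mul0r addr0.
have -> : (fun t => (npoles f t - 0) / t) = (fun=> 0).
  by apply/funext => t; rewrite np subrr mul0r.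
by rewrite Rintegral_cst //= mul0r.
Qed.

Lemma Tchar_ent f r : ent f -> Tchar f r = pmean f r.
Proof. by move=> fe; rewrite /Tchar Ncount_ent // addr0 proximityE. Qed.

Lemma has_order_uniq (F : R[i] -> R[i]) z (n m : nat) : has_order F z (- n%:Z) ->
  has_order F z (- m%:Z) -> n = m.
Proof.
wlog nm_ : n m / (n < m)%N.
  by move=> H h1 h2; case: (ltngtP n m) => // h; [exact: H|apply/esym/H].
move=> [g [gd gz /dnearP [d d0 hg]]] [g' [gd' gz' /dnearP [d' d0' hg']]].
suff g0 : g' z = 0 by rewrite g0 eqxx in gz'.
have [k mk] : exists k, m = (n + k.+1)%N by exists (m - n.+1)%N; rewrite addnS -addSn subnKC.
apply: (@power_factor_eq0 g' g z k (Num.min d d')).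
- exact: near_derivable_ccont.
- exact: near_derivable_ccont.
- by rewrite lt_min d0.
move=> w; rewrite lt_min => /andP[wd wd'] wz.
have wz0 : w - z != 0 by rewrite subr_eq0.
have := hg w wd wz; rewrite hg' // -!exprnN mk => e.
have p0 : (w - z) ^+ (n + k.+1) != 0 by rewrite expf_neq0.
have q0 : (w - z) ^+ k.+1 != 0 by rewrite expf_neq0.
have q1 : (w - z) ^+ n != 0 by rewrite expf_neq0.
apply: (mulfI (invr_neq0 p0)); rewrite e exprD; field.
by rewrite q0 q1.
Qed.

Lemma pole_mult_inv f s q r z : ent q -> (forall z, f z = zprod s z * q z) ->
  (forall z, nm z <= r -> q z != 0) -> nm z <= r ->
  pole_mult (fun z => (f z)^-1) z = count_mem z s.
Proof.
move=> qe fq qn zr.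
suff H : has_order (fun z => (f z)^-1) z (- (count_mem z s)%:Z).
  by apply: xget_unique => // n /= hn; exact: has_order_uniq hn H.
pose s' := [seq a <- s | a != z].
have fs w : f w = (w - z) ^+ count_mem z s * (zprod s' w * q w).
  rewrite fq mulrA; congr (_ * _); rewrite /zprod /s'; elim: s {fq s'} => [|a s IH] /=.
    by rewrite !big_nil expr0 mulr1.
  rewrite big_cons IH; have [->|az] := eqVneq a z; first by rewrite /= add1n exprS mulrA.
  by rewrite /= big_cons add0n mulrCA.
pose h w := zprod s' w * q w.
have he : ent h by apply: entM => //; exact: ent_zprod.
have hz : h z != 0.
  by rewrite mulf_neq0 ?qn // zprod_eq0 mem_filter eqxx.
have hp : 0 < nm (h z) by rewrite nm_gt0.
have [d d0 hd] := ent_cont z he hp.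
have hn w : nm (w - z) < d -> h w != 0.
  by move=> /hd k; apply/negP => /eqP h0; move: k; rewrite h0 sub0r nmN ltxx.
exists (fun w => (h w)^-1); split.
- apply/nearP; exists d => // w /hn hw.
  by have [] := cderiv_derivable (cderivV hw (cderP w he)).
- by rewrite invr_eq0.
- by apply/dnearP; exists d => // w _ wz; rewrite fs invfM -exprnN.
Qed.

Lemma npoles_inv f s q r t : ent q -> (forall z, f z = zprod s z * q z) ->
  (forall z, nm z <= r -> q z != 0) -> t <= r ->
  npoles (fun z => (f z)^-1) t = \sum_(a <- s) ((nm a <= t)%R : nat)%:R.
Proof.
move=> qe fq qn tr; rewrite /npoles.
have pm z : nm z <= t -> pole_mult (fun z => (f z)^-1) z = count_mem z s.
  by move=> zt; apply: (pole_mult_inv qe fq qn); exact: le_trans tr.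
rewrite (fsbigE [seq a <- undup s | nm a <= t]); last 3 first.
- by rewrite filter_uniq // undup_uniq.
- by move=> z /=; rewrite mem_filter => /andP[].
- move=> z /= zt; rewrite mem_filter zt mem_undup /= => zs.
  by rewrite pm // (count_memPn zs).
rewrite big_filter_cond.
rewrite (eq_bigl (fun z => nm z <= t)); last first.
  by move=> z; apply/andP/idP => [[]//|h]; split => //; exact/mem_set.
rewrite [RHS](bigID (fun a => nm a <= t)) /= [X in _ + X]big1; last by move=> a /negbTE ->.
rewrite addr0 [RHS](eq_bigr (fun=> 1 : R)); last by move=> a ->.
(* A multiplicity is written as an iterated sum of ones, so that the sum over distinct zeros becomes
   a sum over the list with repetitions. *)
transitivity (\sum_(i <- undup s | nm i <= t) iterop (count_mem i s) +%R (1 : R) 0).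
  by apply: eq_bigr => a at_; rewrite pm // Monoid.iteropE iter_addr_0.
exact: (big_undup_iterop_count _ s (fun a => nm a <= t) (fun=> 1 : R)).
Qed.

End Bridge.

(** * The integrated counting function and Jensen's formula *)

Section CountingFunction.
Context {R : realType}.
Local Notation nm := (@normc R).
Local Notation mu := (@lebesgue_measure R).
Implicit Types (a b r t x y : R).

Lemma rint_inv b r : 0 < b -> b <= r -> rint (fun t => (Num.max b t)^-1) b r = ln r - ln b.
Proof.
move=> b0 br; have mp t : 0 < Num.max b t by rewrite lt_max b0.
have c : continuous (fun t => (Num.max b t)^-1).
  move=> t; apply: cvgV; first by rewrite gt_eqF.
  by apply: (@continuous_max _ _ (fun=> b) id); [exact: cvg_cst|exact: cvg_id].
apply: rint_FTC => // t; rewrite /btw => tb; have {tb}bt : b <= t.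
  by move: tb => /orP[/andP[]//|/andP[h1 h2]]; apply: le_trans br h1.
rewrite max_r //; apply/rderivP; apply: is_derive1_ln; exact: lt_le_trans bt.
Qed.

(** A jump function divided by t is replaced by a function continuous on the whole line, restricted
    to a segment; its integral is a logarithm. *)
Lemma step_inv_restrict b r : 0 < b ->
  (fun t => (b <= t)%R%:R / t) \_ `]0, r] = (fun t => (Num.max b t)^-1) \_ `[b, r].
Proof.
move=> b0; apply/funext => t; rewrite !patchE !mem_setE !in_itv /=.
case: (leP b t) => bt; last by rewrite /= mul0r; case: ifP.
by rewrite (lt_le_trans b0 bt) mul1r.
Qed.

Lemma cont_maxV b : 0 < b -> continuous (fun t => (Num.max b t)^-1).
Proof.
move=> b0 t; have mp : 0 < Num.max b t by rewrite lt_max b0.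
apply: cvgV; first by rewrite gt_eqF.
by apply: (@continuous_max _ _ (fun=> b) id); [exact: cvg_cst|exact: cvg_id].
Qed.

Lemma integrable_step b r : 0 < b -> mu.-integrable `]0, r] (EFin \o (fun t => (b <= t)%R%:R / t)).
Proof.
move=> b0; apply/integrable_mkcond => //.
have -> : (EFin \o (fun t => (b <= t)%R%:R / t)) \_ `]0, r] = (EFin \o (fun t => (Num.max b t)^-1)) \_ `[b, r].
  apply/funext => t; have := congr1 (fun h => h t) (step_inv_restrict r b0).
  by rewrite !patchE; case: ifP => _; case: ifP => _ //= h; [rewrite h|rewrite h|rewrite -h].
by apply/(integrable_mkcond _ _).1 => //; apply: cont_integrable; exact: cont_maxV.
Qed.

Lemma Rintegral_step b r : 0 < b ->
  (\int[mu]_(t in `]0, r]) ((b <= t)%R%:R / t) = if b <= r then ln (r / b) else 0)%R.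
Proof.
move=> b0; rewrite Rintegral_mkcond step_inv_restrict // -Rintegral_mkcond.
case: leP => br.
  rewrite Rintegral_rint //; last exact: cont_maxV.
  by rewrite rint_inv // ln_div ?posrE //; exact: lt_le_trans br.
by rewrite set_itv_ge ?Rintegral_set0 // bnd_simp -ltNge.
Qed.

Lemma Rintegral_step_sum (s : seq R[i]) r : 0 < r ->
  mu.-integrable `]0, r] (EFin \o (fun t => \sum_(a <- s | a != 0) ((nm a <= t)%R%:R / t))) /\
  (\int[mu]_(t in `]0, r]) (\sum_(a <- s | a != 0) ((nm a <= t)%R%:R / t)) =
  \sum_(a <- s | a != 0) (ln (Num.max r (nm a)) - ln (nm a)))%R.
Proof.
move=> r0; elim: s => [|a s [IH1 IH2]].
  have -> : (fun t => \sum_(a <- [::] | a != 0) ((nm a <= t)%R%:R / t)) = (fun=> 0 : R).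
    by apply/funext => t; rewrite big_nil.
  split; last by rewrite big_nil Rintegral_cst //= mul0r.
  exact: integrable0.
have [a0|a0] := eqVneq a 0.
  have -> : (fun t => \sum_(b <- a :: s | b != 0) ((nm b <= t)%R%:R / t)) =
     (fun t => \sum_(b <- s | b != 0) ((nm b <= t)%R%:R / t)).
    by apply/funext => t; rewrite big_cons a0 eqxx.
  by split => //; rewrite IH2 big_cons a0 eqxx.
have ap : 0 < nm a by rewrite nm_gt0.
have -> : (fun t => \sum_(b <- a :: s | b != 0) ((nm b <= t)%R%:R / t)) =
     (fun t => (nm a <= t)%R%:R / t + \sum_(b <- s | b != 0) ((nm b <= t)%R%:R / t)).
  by apply/funext => t; rewrite big_cons a0.
split.
  have -> : EFin \o (fun t => (nm a <= t)%R%:R / t + \sum_(b <- s | b != 0) ((nm b <= t)%R%:R / t)) =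
    ((EFin \o (fun t => ((nm a <= t)%R%:R / t)%R)) \+ (EFin \o (fun t => (\sum_(b <- s | b != 0) ((nm b <= t)%R%:R / t))%R)))%E.
    by apply/funext => t.
  by apply: integrableD => //; exact: integrable_step.
rewrite RintegralD //; last exact: integrable_step.
rewrite IH2 big_cons a0 Rintegral_step //; congr (_ + _).
case: leP => ar; last by rewrite subrr.
by rewrite ln_div // posrE.
Qed.

Lemma Ncount_inv (f q : R[i] -> R[i]) (s : seq R[i]) r : ent q -> (forall z, f z = zprod s z * q z) ->
  0 < r -> (forall z, nm z <= r -> q z != 0) ->
  Ncount (fun z => (f z)^-1) r =
  \sum_(a <- s | a != 0) (ln (Num.max r (nm a)) - ln (nm a)) + \sum_(a <- s | a == 0) ln r.
Proof.
move=> qe fq r0 qn; rewrite /Ncount.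
have np t : t <= r -> npoles (fun z => (f z)^-1) t = \sum_(a <- s) ((nm a <= t)%R : nat)%:R.
  by move=> tr; exact: (npoles_inv qe fq qn).
rewrite (np 0) ?(ltW r0) //.
rewrite (@eq_Rintegral _ _ _ mu _ (fun t => \sum_(a <- s | a != 0) ((nm a <= t)%R%:R / t))); last first.
  move=> t; rewrite inE /= in_itv /= => /andP[t0 tr]; rewrite np // -sumrB mulr_suml.
  rewrite [RHS]big_mkcond /=; apply: eq_bigr => a _.
  have [->|a0] := eqVneq a 0; first by rewrite nm0 lexx (ltW t0) subrr mul0r.
  by rewrite [nm a <= 0]leNgt nm_gt0 a0 subr0.
rewrite (Rintegral_step_sum s r0).2; congr (_ + _).
rewrite mulr_suml [RHS]big_mkcond; apply: eq_bigr => a _.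
have [->|a0] := eqVneq a 0; first by rewrite nm0 lexx mul1r.
by rewrite [nm a <= 0]leNgt nm_gt0 a0 mul0r.
Qed.

(** Jensen's formula. The constant is the logarithm of the modulus of the first nonzero Taylor
    coefficient of [f] at 0. *)
Lemma lmean_Ncount (f q : R[i] -> R[i]) (s : seq R[i]) r : ent q -> (forall z, f z = zprod s z * q z) ->
  0 < r -> (forall z, nm z <= r -> q z != 0) -> (forall c : R[i], c \in s -> nm c != r) ->
  lmean f r = Ncount (fun z => (f z)^-1) r + (ln (nm (q 0)) + \sum_(a <- s | a != 0) ln (nm a)).
Proof.
move=> qe fq r0 qn sn; rewrite (lmean_sum qe fq r0 qn sn) (Ncount_inv qe fq r0 qn).
rewrite (bigID (fun a : R[i] => a != 0)) /= sumrB.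
rewrite [\sum_(i <- s | ~~ (i != 0)) _](eq_bigr (fun=> ln r)); last first.
  by move=> a /negPn /eqP ->; rewrite nm0 max_l // ltW.
rewrite [\sum_(i <- s | ~~ (i != 0)) _](eq_bigl (fun a : R[i] => a == 0)); last by move=> a; rewrite negbK.
by ring.
Qed.

End CountingFunction.

(** * Radii without zeros and growth *)

Section ZeroFreeRadii.
Context {R : realType}.
Local Notation nm := (@normc R).
Implicit Types (f g q G : R[i] -> R[i]) (a c z w : R[i]) (r rho B t x y : R) (s : seq R[i]).

Definition zerofree f r := forall z, nm z = r -> f z != 0.

Lemma avoid_seq (l : seq R) x y : x < y -> exists r, [/\ x < r, r < y & r \notin l].
Proof.
elim: l x y => [|u l IH] x y xy; first by exists ((x + y) / 2); split; rewrite ?in_nil; lra.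
have [uy|yu] := ltP u y.
  have m : Num.max x u < y by rewrite gt_max xy.
  have [r [r1 r2 r3]] := IH _ _ m; exists r; rewrite gt_max in r1; case/andP: r1 => r1 r1'.
  by split=> //; rewrite in_cons negb_or r3 gt_eqF.
have [r [r1 r2 r3]] := IH _ _ xy; exists r; split => //.
by rewrite in_cons negb_or r3 lt_eqF // (lt_le_trans r2).
Qed.

Lemma zerofree_dense f z0 x y : ent f -> f z0 != 0 -> 0 < x -> x < y ->
  exists r, [/\ x < r, r < y & zerofree f r].
Proof.
move=> fe f0 x0 xy; pose r1 := Num.max y (nm z0).
have r10 : 0 < r1 by rewrite lt_max (lt_trans x0 xy).
have zr1 : nm z0 <= r1 by rewrite le_max lexx orbT.
have [s [q [qe fq qn _]]] := zeros_factor fe f0 r10 zr1.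
have [r [h1 h2 h3]] := avoid_seq [seq nm a | a <- s] xy.
exists r; split => // z zr; rewrite fq mulf_neq0 //.
  by rewrite zprod_eq0; apply: contra h3 => zs; rewrite -zr map_f.
by apply: qn; rewrite zr le_max ltW.
Qed.

Lemma zerofree_countable f z0 : ent f -> f z0 != 0 ->
  countable [set r : R | ~ zerofree f r].
Proof.
move=> fe f0.
have /choice [S hS] : forall n : nat, exists l : seq R, forall r, r <= n%:R -> ~ zerofree f r -> r \in l.
  move=> n; pose r1 := Num.max (n%:R + 1) (nm z0).
  have r10 : 0 < r1 by rewrite lt_max ltr_wpDl.
  have zr1 : nm z0 <= r1 by rewrite le_max lexx orbT.
  have [s [q [qe fq qn _]]] := zeros_factor fe f0 r10 zr1.
  exists [seq nm a | a <- s] => r rn /existsNP [z /not_implyP [zr /negP]].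
  rewrite negbK fq mulf_eq0 zprod_eq0 => /orP[zs|]; first by rewrite -zr map_f.
  move=> /eqP q0; have zr2 : nm z <= r1 by rewrite zr le_max (le_trans rn) // lerDl.
  by have := qn z zr2; rewrite q0 eqxx.
apply: (@sub_countable _ _ _ (\bigcup_(n in setT) [set` S n])).
  apply: subset_card_le => r hr; exists (Num.bound `|r|) => //=.
  by apply: hS => //; apply: le_trans (ler_norm _) (ltW (archi_boundP _)).
by apply: bigcup_countable => // n _; apply: finite_set_countable; exact: finite_seq.
Qed.

Lemma ln_max_diff x y a : 0 < x -> x <= y -> 0 <= ln (Num.max y (nm a)) - ln (Num.max x (nm a)) <= ln (y / x).
Proof.
move=> x0 xy; have y0 : 0 < y by exact: lt_le_trans xy.
rewrite ln_div ?posrE // subr_ge0 ler_ln ?posrE ?lt_max ?x0 ?y0 //.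
rewrite ge_max !le_max xy lexx orbT /=.
have [ya|ay] := leP y (nm a).
  rewrite max_r ?(le_trans xy) // subrr subr_ge0 ler_ln ?posrE //.
suff h : ln x <= ln (Num.max x (nm a)) by lra.
by rewrite ler_ln ?posrE ?lt_max ?x0 // le_max lexx.
Qed.

(** In Jensen's formula each zero contributes between 0 and ln (r2 / r1), and by [zeros_factor]
    there are at most log_2 (B / |f z0|) zeros. *)
Lemma lmean_diff f z0 r1 r2 B : ent f -> f z0 != 0 -> 0 < r1 -> r1 <= r2 -> nm z0 <= r2 ->
  zerofree f r1 -> zerofree f r2 -> (forall z, nm z <= 7 * r2 -> nm (f z) <= B) ->
  0 <= lmean f r2 - lmean f r1 <= ln (B / nm (f z0)) / ln 2 * ln (r2 / r1).
Proof.
move=> fe f0 r10 r12 z0r zf1 zf2 hB.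
have r20 : 0 < r2 by lra.
have [s [q [qe fq qn sb]]] := zeros_factor fe f0 r20 z0r.
have sn r a : zerofree f r -> a \in s -> nm a != r.
  by move=> zf as_; apply/negP => /eqP /zf; rewrite fq mulf_eq0 zprod_eq0 as_.
rewrite (@lmean_sum _ s q f r1) //; last 2 first.
- by move=> z zr; apply: qn; lra.
- by move=> a; exact: sn.
rewrite (@lmean_sum _ s q f r2) //; last by move=> a; exact: sn.
have -> : ln (nm (q 0)) + \sum_(a <- s) ln (Num.max r2 (nm a)) -
    (ln (nm (q 0)) + \sum_(a <- s) ln (Num.max r1 (nm a))) =
    \sum_(a <- s) (ln (Num.max r2 (nm a)) - ln (Num.max r1 (nm a))).
  by rewrite sumrB; ring.
have f0p : 0 < nm (f z0) by rewrite nm_gt0.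
have {}sb := sb _ hB.
have B0 : 0 < B by apply: lt_le_trans sb; rewrite mulr_gt0 // exprn_gt0.
have l2 : 0 < ln 2 :> R by rewrite ln_gt0 // ltr1n.
have l12 : 0 <= ln (r2 / r1) by rewrite ln_ge0 // ler_pdivlMr // mul1r.
apply/andP; split.
  by apply: sumr_ge0 => a _; case/andP: (ln_max_diff a r10 r12).
apply: (@le_trans _ _ (\sum_(a <- s) ln (r2 / r1))).
  by apply: ler_sum => a _; case/andP: (ln_max_diff a r10 r12).
have -> : \sum_(a <- s) ln (r2 / r1) = (size s)%:R * ln (r2 / r1).
  by rewrite big_const_seq count_predT iter_addr_0 mulr_natl.
apply: ler_wpM2r => //; rewrite ler_pdivlMr // mulr_natl -lnXn // ler_ln ?posrE ?exprn_gt0 ?divr_gt0 //.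
by rewrite ler_pdivlMr.
Qed.

Lemma continuous_abs (u : R -> R) : continuous u -> continuous (fun t => `|u t|).
Proof. by move=> uc t; apply: continuous_comp; [exact: uc|exact: norm_continuous]. Qed.

Lemma pmean_lmean_ge0 f r : ent f -> 0 <= r -> zerofree f r -> 0 <= 2 * pmean f r - lmean f r.
Proof.
move=> fe r0 zf; rewrite -rmean_abs_ln // -[0](@rmean_cst R); apply: rmean_le => //.
  by move=> t; exact: cvg_cst.
by apply: continuous_abs; exact: continuous_lmean.
Qed.

(** By [lmean_diff], [lmean f] is nondecreasing along zero-free radii, so its value at a first such
    radius is a lower bound. *)
Lemma lmean_ge f z0 : ent f -> f z0 != 0 -> exists r1 C, [/\ 0 < r1, zerofree f r1, nm z0 <= r1 &
  forall r, r1 <= r -> zerofree f r -> - C <= lmean f r].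
Proof.
move=> fe f0; have m0 : 0 < nm z0 + 1 by have := nm_ge0 z0; lra.
have [r1 [h1 h2 zf]] := @zerofree_dense f z0 (nm z0 + 1) (nm z0 + 2) fe f0 m0 ltac:(lra).
have z0n := nm_ge0 z0.
exists r1, (- lmean f r1); split => //; try lra.
move=> r r1r zfr; rewrite opprK.
have [B B0 hB] := ent_bounded (7 * r) fe.
have /andP[+ _] := @lmean_diff f z0 r1 r B fe f0 ltac:(lra) r1r ltac:(lra) zf zfr hB.
by rewrite subr_ge0.
Qed.

(** Write P and L for [pmean f r] and [lmean f r]. For |z| <= r / 2 the Harnack factor is at most 2,
    so ln |f z| <= L + 2 (2 P - L) = 4 P - L, and - L <= C by [lmean_ge]. *)
Lemma max_modulus_pmean f z0 : ent f -> f z0 != 0 -> exists r1 C, 0 < r1 /\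
  forall r, r1 <= r -> zerofree f r -> forall z, nm z <= r / 2 -> nm (f z) <= expR (4 * pmean f r + C).
Proof.
move=> fe f0; have [r1 [C [r10 _ zr1 hC]]] := lmean_ge fe f0.
exists r1, C; split => // r r1r zf z zr; have r0 : 0 < r by lra.
have [G [G1 G2 _ G4]] := poisson_majorant fe f0 r0 zf.
apply: le_trans (G1 z _) _; first by lra.
rewrite ler_expR.
have := G4 z 0 ltac:(lra) ltac:(by rewrite nm0).
rewrite subr0 nm0 subr0 => h.
have h2 := le_trans (nm_Re _) h.
have h3 := le_trans (ler_norm _) h2; rewrite reD reN G2 in h3.
have p0 := pmean_lmean_ge0 fe (ltW r0) zf.
have : 2 * r * nm z / ((r - nm z) * r) <= 2.
  have q0 : 0 < r - nm z by lra.
  rewrite ler_pdivrMr ?mulr_gt0 //; nra.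
move: h3 (hC r r1r zf) p0; set X := 2 * r * _ / _.
set P := pmean f r; set L := lmean f r; move=> h3 h4 p0 Xl.
have : (2 * P - L) * X <= (2 * P - L) * 2 by rewrite ler_wpM2l.
lra.
Qed.

End ZeroFreeRadii.

(** * The maximum modulus and its growth for a solution *)

Section MaximumModulus.
Context {R : realType}.
Local Notation nm := (@normc R).
Implicit Types (f g : R[i] -> R[i]) (a c z w : R[i]) (r B t x y : R).

Definition maxmod f r := sup [set x : R | exists2 z, nm z <= r & x = nm (f z)].

Lemma maxmod_ge f r z : ent f -> nm z <= r -> nm (f z) <= maxmod f r.
Proof.
move=> fe zr; have [B _ hB] := ent_bounded r fe.
by apply: ub_le_sup; [exists B => _ [w wr ->]; exact: hB|exists z].
Qed.

Lemma maxmod_le f r B : 0 <= r -> (forall z, nm z <= r -> nm (f z) <= B) -> maxmod f r <= B.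
Proof.
move=> r0 hB; apply: ge_sup; first by exists (nm (f 0)), 0 => //; rewrite nm0.
by move=> _ [w wr ->]; exact: hB.
Qed.

Lemma maxmod_ge0 f r : ent f -> 0 <= r -> 0 <= maxmod f r.
Proof. by move=> fe r0; apply: le_trans (nm_ge0 (f 0)) (maxmod_ge fe _); rewrite nm0. Qed.

Lemma maxmod_cder f z r : ent f -> nm z + 1 <= r -> nm (cder f z) <= maxmod f r.
Proof.
move=> fe zr; apply: cauchy_estimate => // c c1; apply: maxmod_ge => //.
by have := nmD z c; lra.
Qed.

Lemma nm_cexpM_le a z : nm (cexp (a * z)) <= expR (nm a * nm z).
Proof.
by rewrite nm_cexp ler_expR -nmM (le_trans (ler_norm _)) // nm_Re.
Qed.

Lemma pmean_le f r B : ent f -> 0 <= r -> maxmod f r <= expR B -> 0 <= B -> pmean f r <= B.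
Proof.
move=> fe r0 hB B0; rewrite -[B](@rmean_cst R); apply: rmean_le.
- exact: continuous_pmean.
- by move=> t; exact: cvg_cst.
move=> t; have : nm (f (circ r t)) <= expR B.
  by apply: le_trans hB; apply: maxmod_ge; rewrite ?nm_circ.
by move=> /le_logp /le_trans; apply; rewrite logpE max_r ?expRK // -expR0 ler_expR.
Qed.

End MaximumModulus.

(** Here N = M(r), N' = M(r + K), X = exp(A0 r), Y = exp(c r). The constant [c] makes Y at least 6 D
    r and at least 2 (F + 3 P r). Hence F + 3 r P X <= X Y / 2 < N / 2 <= N^3 / 2, so that N^3 <= 6
    D r N' <= N N'. *)
Lemma square_le_of_cube_le {R : realType} (X Y N N' r F P D c : R) : 1 <= r -> 0 <= F -> 0 <= P -> 1 <= D ->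
  c = 2 * (F + 3 * P + 6 * D + 1) -> 1 <= X -> 1 + c * r <= Y -> X * Y < N -> 0 <= N' ->
  N ^+ 3 <= F + 3 * r * (P * X + D * N') -> N ^+ 2 <= N'.
Proof.
move=> r1 F0 P0 D1 cE X1 cY XYN N'0 h.
have PR : 0 <= P * (r - 1) by rewrite mulr_ge0 ?subr_ge0.
have FR : 0 <= F * (r - 1) by rewrite mulr_ge0 ?subr_ge0.
have DR : 1 <= D * r by nra.
have crE : c * r = 2 * (F * r) + 6 * (P * r) + 12 * (D * r) + 2 * r by rewrite cE; ring.
have Y6 : 6 * (D * r) <= Y by rewrite crE in cY; nra.
have Y2 : 2 * (F + 3 * (P * r)) <= Y by rewrite crE in cY; nra.
have Y1 : 1 < Y by lra.
have YN : Y < N by nra.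
have PrX : 0 <= P * r by rewrite mulr_ge0 //; lra.
have XY2 : 2 * (F + 3 * (P * r) * X) <= X * Y.
  have k1 : 0 <= X * (Y - 2 * (F + 3 * (P * r))) by rewrite mulr_ge0 //; lra.
  have k2 : 0 <= F * (X - 1) by rewrite mulr_ge0 //; lra.
  lra.
have N1 : 1 < N by lra.
have n3 : N <= N ^+ 3 by rewrite -[leLHS]expr1 ler_eXn2l.
have DrN : 0 <= D * r * N' by rewrite mulr_ge0 //; lra.
have h7 : N ^+ 3 <= 6 * (D * r) * N' by lra.
have h8 : N * N ^+ 2 <= N * N'.
  rewrite -exprS; apply: (le_trans h7); rewrite ler_wpM2r //; lra.
by rewrite ler_pM2l // in h8; lra.
Qed.

Section GrowthOfSolution.
Context {R : realType}.
Local Notation nm := (@normc R).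
Variables (p1 p2 g1 g2 : R[i]) (m : nat) (d k : 'I_m.+1 -> R[i]) (f : R[i] -> R[i]).
Hypothesis (p1_neq0 : p1 != 0) (p2_neq0 : p2 != 0) (g1_neq0 : g1 != 0) (g2_neq0 : g2 != 0).
Hypothesis (g12 : g1 != g2) (fe : ent f).
Hypothesis (f_eq : forall z, f z ^+ 2 * cder f z + linear_difference d k f z =
  p1 * cexp (g1 * z) + p2 * cexp (g2 * z)).

(** As [K] exceeds the modulus of every shift, one enlargement of the radius serves all of them; the
    summand 1 gives [K >= 1] and [D >= 1]. *)
Let K := 1 + \sum_(j < m.+1) nm (k j).
Let D := 1 + \sum_(j < m.+1) nm (d j).
Let M := maxmod f.

Lemma K_ge1 : 1 <= K.
Proof. by rewrite lerDl sumr_ge0 // => i _; exact: nm_ge0. Qed.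

Lemma D_ge1 : 1 <= D.
Proof. by rewrite lerDl sumr_ge0 // => i _; exact: nm_ge0. Qed.

Lemma shift_le_K j : nm (k j) <= K.
Proof.
rewrite /K (bigD1 j) //= addrCA lerDl addr_ge0 // sumr_ge0 // => i _; exact: nm_ge0.
Qed.

Lemma difference_bound z r : nm z <= r -> nm (linear_difference d k f z) <= D * M (r + K).
Proof.
move=> zr; have r0 := le_trans (nm_ge0 z) zr; have K1 := K_ge1.
apply: (le_trans (nm_sum _ _)).
apply: (@le_trans _ _ (\sum_(j < m.+1) nm (d j) * M (r + K))).
  apply: ler_sum => j _; rewrite nmM ler_wpM2l ?nm_ge0 //; apply: maxmod_ge => //.
  by apply: (le_trans (nmD _ _)); rewrite lerD // shift_le_K.
rewrite -mulr_suml ler_wpM2r ?maxmod_ge0 //; first by lra.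
by rewrite lerDr.
Qed.

Lemma rhs_bound z r : nm z <= r ->
  nm (p1 * cexp (g1 * z) + p2 * cexp (g2 * z)) <= (nm p1 + nm p2) * expR ((nm g1 + nm g2) * r).
Proof.
move=> zr; have z0 := nm_ge0 z; rewrite mulrDl.
apply: (le_trans (nmD _ _)); rewrite (nmM p1) (nmM p2).
apply: lerD; apply: ler_wpM2l; rewrite ?nm_ge0 //; apply: (le_trans (nm_cexpM_le _ _));
by rewrite ler_expR; apply: ler_pM; rewrite ?nm_ge0 // ?lerDl ?lerDr nm_ge0.
Qed.

Lemma maxmod_cube r : 0 <= r -> M r ^+ 3 <= nm (f 0) ^+ 3 +
  3 * r * ((nm p1 + nm p2) * expR ((nm g1 + nm g2) * r) + D * M (r + K)).
Proof.
move=> r0; set Q := (nm p1 + nm p2) * _ + _.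
have K1 := K_ge1; have D1 := D_ge1.
have Q0 : 0 <= Q.
  have h1 : 0 <= nm p1 + nm p2 by rewrite addr_ge0 ?nm_ge0.
  have h2 : 0 <= M (r + K) by apply: maxmod_ge0 => //; lra.
  by rewrite /Q addr_ge0 // mulr_ge0 ?expR_ge0 //; lra.
have key z : nm z <= r -> nm (f z) ^+ 3 <= nm (f 0) ^+ 3 + 3 * r * Q.
  move=> zr; pose F z := f z * (f z * f z).
  have Fe : ent F by do 2!apply: entM => //.
  have dF w : cder F w = 3 * (f w ^+ 2 * cder f w).
    apply: cderE; have h := cderivM (cderP w fe) (cderivM (cderP w fe) (cderP w fe)).
    have -> : 3 * (f w ^+ 2 * cder f w) =
       cder f w * (f w * f w) + f w * (cder f w * f w + f w * cder f w) by ring.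
    exact: h.
  have : nm (F z - F 0) <= 3 * Q * nm z.
    apply: mean_value_ineq => // w wz; rewrite dF nmM nm_nat ler_pM2l //.
    have -> : f w ^+ 2 * cder f w = p1 * cexp (g1 * w) + p2 * cexp (g2 * w) - linear_difference d k f w.
      by rewrite -f_eq; ring.
    apply: (le_trans (nmB _ _)); apply: lerD; first by apply: rhs_bound; exact: le_trans wz zr.
    by apply: difference_bound; exact: le_trans wz zr.
  have := nm_lerB (F z) (F 0); rewrite /F !nmM -!expr2 -!exprS => h1 h2.
  have : 3 * Q * nm z <= 3 * r * Q by nra.
  lra.
have c0 : 0 <= nm (f 0) ^+ 3 + 3 * r * Q.
  by rewrite addr_ge0 ?exprn_ge0 ?nm_ge0 // !mulr_ge0.
pose c := nm (f 0) ^+ 3 + 3 * r * Q.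
rewrite -/c in key c0 *.
(* The cube root of [c] is written with [expR] and [ln], which requires c > 0; the case c = 0 is
   separate. *)
have [c1|c1] := leP c 0.
  have cz : c = 0 by apply/eqP; rewrite eq_le c1.
  rewrite cz in key *; suff : M r <= 0 by have := maxmod_ge0 fe r0; rewrite -/M => h1 h2; have -> : M r = 0; [lra|rewrite expr0n].
  apply: maxmod_le => // z /key h; rewrite leNgt; apply/negP => h2.
  by have := lt_le_trans (exprn_gt0 3 h2) h; rewrite ltxx.
pose s := expR (ln c / 3).
have s3 : s ^+ 3 = c by rewrite -expRM_natl (_ : 3 * (ln c / 3) = ln c); [rewrite lnK ?posrE|field].
have s0 : 0 < s by rewrite expR_gt0.
rewrite -s3; apply: lerXn2r; rewrite ?nnegrE ?maxmod_ge0 ?(ltW s0) //.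
apply: maxmod_le => // z /key; rewrite -s3 ler_pXn2r ?nnegrE ?nm_ge0 ?(ltW s0) //.
Qed.

(* Above the threshold [expR (A * r)], the exponential term in [maxmod_cube] is negligible. *)
Lemma maxmod_step : exists A r1, [/\ 1 <= A, K <= r1 &
  forall r, r1 <= r -> expR (A * r) < M r -> M r ^+ 2 <= M (r + K)].
Proof.
have K1 := K_ge1; have D1 := D_ge1.
pose A0 := nm g1 + nm g2; pose P := nm p1 + nm p2; pose F0 := nm (f 0) ^+ 3.
have A00 : 0 <= A0 by rewrite addr_ge0 ?nm_ge0.
have P0 : 0 <= P by rewrite addr_ge0 ?nm_ge0.
have F00 : 0 <= F0 by rewrite exprn_ge0 ?nm_ge0.
pose c := 2 * (F0 + 3 * P + 6 * D + 1).
have c1 : 1 <= c by rewrite /c; lra.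
exists (A0 + c), K; split => //; first lra.
move=> r rK; set N := M r => hN.
have r1 : 1 <= r by lra.
have r0 : 0 <= r by lra.
have e1 : expR (A0 * r) >= 1 by rewrite -expR0 ler_expR mulr_ge0.
have e2 : 1 + c * r <= expR (c * r) by exact: expR_ge1Dx.
have eE : expR ((A0 + c) * r) = expR (A0 * r) * expR (c * r) by rewrite mulrDl expRD.
rewrite eE in hN.
have h := maxmod_cube r0; rewrite -/N -/A0 -/P -/F0 in h.
have N'0 : 0 <= M (r + K) by apply: maxmod_ge0 => //; lra.
exact: (square_le_of_cube_le r1 F00 P0 D1 erefl e1 e2 hN N'0 h).
Qed.

(** The induction carries the hypothesis of [maxmod_step] along. At r' = r + n K squaring gives
    exp(2 A r'), and 2 r' >= r' + K because r' >= r1 >= K. *)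
Lemma maxmod_tower : exists A r1, [/\ 1 <= A, K <= r1 &
  forall r n, r1 <= r -> expR (A * r) < M r -> expR (2 ^+ n) <= M (r + n%:R * K)].
Proof.
have [A [r1 [A1 Kr1 h]]] := maxmod_step; exists A, r1; split => // r n rr hr.
have K1 := K_ge1.
suff [] : expR (A * (r + n%:R * K)) < M (r + n%:R * K) /\ expR (2 ^+ n) <= M (r + n%:R * K) by [].
elim: n => [|n [IH1 IH2]].
  rewrite mul0r addr0 expr0; split => //; apply/ltW; apply: le_lt_trans hr; rewrite ler_expR; nra.
pose r' := r + n%:R * K; rewrite -/r' in IH1 IH2.
have nK : 0 <= n%:R * K by rewrite mulr_ge0 //; lra.
have -> : r + n.+1%:R * K = r' + K by rewrite -addn1 natrD /r'; ring.
have r'r : r <= r' by rewrite /r'; lra.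
have hh : M r' ^+ 2 <= M (r' + K) by apply: h => //; lra.
split.
  apply: lt_le_trans hh; have e0 := expR_gt0 (A * r').
  apply: (@le_lt_trans _ _ (expR (A * r') ^+ 2)).
    by rewrite -expRM_natl ler_expR; nra.
  by rewrite ltrXn2r ?nnegrE ?(ltW e0) //.
apply: le_trans hh; rewrite exprSr mulrC expRM_natl; apply: lerXn2r; rewrite ?nnegrE ?expR_ge0 //.
by apply: le_trans IH2; exact: expR_ge0.
Qed.

End GrowthOfSolution.

(** * The order of a solution *)

Section OrderLimits.
Context {R : realType}.
Local Notation nm := (@normc R).
Implicit Types (f : R[i] -> R[i]) (x r : R).

Lemma hyper_order_lt1 f : ent f -> (hyper_order f < 1%:E)%E ->
  exists rho M0 : R, [/\ 0 <= rho, rho < 1, 1 <= M0 &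
    forall x, M0 < x -> ln (ln (pmean f x)) <= rho * ln x].
Proof.
move=> fe; rewrite /hyper_order limf_esupE => /ereal_inf_lt [_ [V [M [_ MV]] <-]] s1.
have h x : Num.max M 1 < x -> ((ln (ln (pmean f x)) / ln x)%:E <= ereal_sup [set (ln (ln (Tchar f x)) / ln x)%:E | x in V])%E.
  rewrite gt_max => /andP[Mx _]; apply: ereal_sup_ubound; exists x; first exact: MV.
  by rewrite Tchar_ent.
(* If the supremum is -oo, the inequality [h] is absurd, so any [rho] will do; radii above 1 keep
   [ln x] positive. *)
move: s1 h; set s := ereal_sup _; case: s => [s||] //= s1 h.
- exists (Num.max s 0), (Num.max M 1); split; rewrite ?le_max ?lexx ?orbT //.
    by rewrite gt_max ltr01 andbT -lte_fin.
  move=> x Mx; have x1 : 1 < x by move: Mx; rewrite gt_max => /andP[].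
  have := h x Mx; rewrite lee_fin ler_pdivrMr ?ln_gt0 // => /le_trans; apply.
  by rewrite ler_wpM2r ?le_max ?lexx // ltW // ln_gt0.
- exists 0, (Num.max M 1); split; rewrite ?le_max ?lexx ?orbT //.
  by move=> x /h; rewrite leeNy_eq.
Qed.

(** The lower bound is asked only at arbitrarily large radii, which is enough for an upper limit; it
    is going to be known on zero-free circles. *)
Lemma growth_order_eq1 f (A c r0 : R) : ent f -> 0 < A -> 0 < c ->
  (forall r, r0 <= r -> pmean f r <= A * r) ->
  (forall r, exists2 r', r < r' & c * r' <= pmean f r') -> growth_order f = 1%:E.
Proof.
move=> fe A0 c0 hA hc; rewrite /growth_order limf_esupE; apply/eqP; rewrite eq_le; apply/andP; split.
  apply/lee_addgt0Pr => e e0.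
  (* Beyond exp(|ln A| / e) the constant [A] costs at most e ln x. *)
  pose M := Num.max (Num.max r0 1) (expR (`|ln A| / e)).
  apply: le_trans (ereal_inf_lbound _) _; first by exists [set x | M < x] => //; exists M; split; rewrite ?num_real.
  apply: ge_ereal_sup => _ [x /= Mx <-].
  move: Mx; rewrite !gt_max => /andP[/andP[r0x x1] ex].
  have lx : 0 < ln x by rewrite ln_gt0.
  rewrite Tchar_ent // -EFinD lee_fin ler_pdivrMr //.
  have lA : `|ln A| <= e * ln x.
    rewrite mulrC -ler_pdivrMr //; have := ltW ex.
    by rewrite -{1}(lnK (_ : x \is Num.pos)) ?posrE ?ler_expR //; lra.
  have T0 : 0 <= pmean f x.
    rewrite -[0](@rmean_cst R); apply: rmean_le; last by move=> t; exact: logp_ge0.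
      by move=> t; exact: cvg_cst.
    exact: continuous_pmean.
  have lA0 := ler_norm (ln A); have lAn := normr_ge0 (ln A).
  (* If the characteristic is 0, the convention ln 0 = 0 makes the quotient 0. *)
  move: T0; rewrite le_eqVlt => /orP[/eqP <-|Tp].
    by rewrite ln0 //; nra.
  have := hA x (ltW r0x).
  have Ax : 0 < A * x by rewrite mulr_gt0 //; lra.
  rewrite -(ler_ln (x := pmean f x)) ?posrE // lnM ?posrE //; last by lra.
  lra.
apply/ereal_infP => _ [V [M [_ MV]] <-].
apply/lee_subgt0Pr => e e0.
pose M' := Num.max (Num.max M 1) (expR (`|ln c| / e)).
have [x + hx] := hc M'; rewrite !gt_max => /andP[/andP[Mx x1] ex].
have lx : 0 < ln x by rewrite ln_gt0.
have lc : `|ln c| <= e * ln x.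
  rewrite mulrC -ler_pdivrMr //; have := ltW ex.
  by rewrite -{1}(lnK (_ : x \is Num.pos)) ?posrE ?ler_expR //; lra.
apply: (@le_trans _ _ (ln (Tchar f x) / ln x)%:E); last first.
  by apply: ereal_sup_ubound; exists x => //; exact: MV.
rewrite Tchar_ent // -EFinB lee_fin ler_pdivlMr //.
have cx : 0 < c * x by rewrite mulr_gt0 //; lra.
have : ln (c * x) <= ln (pmean f x) by rewrite ler_ln ?posrE //; exact: lt_le_trans hx.
rewrite lnM ?posrE //; last by lra.
have := ler_norm (- ln c); rewrite normrN; lra.
Qed.

End OrderLimits.

Lemma ln_pow2_over8 {R : realType} n : ln (2 ^+ n / 8) = n%:R * ln 2 - 3 * ln 2 :> R.
Proof.
have p (j : nat) : 0 < (2 : R) ^+ j by rewrite exprn_gt0.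
have -> : 8 = 2 ^+ 3 :> R by rewrite -natrX.
rewrite ln_div ?posrE; [|exact: p|exact: p].
have lX (j : nat) : ln (2 ^+ j) = j%:R * ln 2 :> R by rewrite lnXn ?mulr_natl.
by rewrite (lX n) (lX 3%N).
Qed.

Lemma Re_mulJ_lt {R : realType} (u v : R[i]) : 0 < normc (v - u) ^+ 2 ->
  normc v ^+ 2 <= normc u ^+ 2 -> complex.Re (v * u^*) < normc u ^+ 2.
Proof.
rewrite !nm_sqr; case: u => a b; case: v => a' b' /=; nra.
Qed.

(** * Exponential type and a linear lower bound for the characteristic *)

Section ExponentialType.
Context {R : realType}.
Local Notation nm := (@normc R).
Variables (p1 p2 g1 g2 : R[i]) (m : nat) (d k : 'I_m.+1 -> R[i]) (f : R[i] -> R[i]) (z0 : R[i]).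
Hypothesis (fe : ent f) (fz0 : f z0 != 0).
Hypothesis (f_eq : forall z, f z ^+ 2 * cder f z + linear_difference d k f z =
  p1 * cexp (g1 * z) + p2 * cexp (g2 * z)).
Let K := 1 + \sum_(j < m.+1) nm (k j).
Let D := 1 + \sum_(j < m.+1) nm (d j).

Lemma exponential_type : (hyper_order f < 1%:E)%E -> exists A r1, [/\ 1 <= A, 1 <= r1 &
  forall r, r1 <= r -> maxmod f r <= expR (A * r)].
Proof.
move=> /(hyper_order_lt1 fe) [rho [M0 [rho0 rho1 M01 hrho]]].
have [A [r1 [A1 Kr1 tower]]] := maxmod_tower fe f_eq.
have K1 : 1 <= K by exact: K_ge1.
rewrite -/K in Kr1 tower.
exists A, r1; split => //; first by lra.
move=> r rr1; rewrite leNgt; apply/negP => hr.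
have [r2 [C [r20 hmax]]] := max_modulus_pmean fe fz0.
pose Q := 3 * (r + K).
have Q1 : 1 <= Q by rewrite /Q; lra.
have l2 : 0 < ln 2 :> R by rewrite ln_gt0 // ltr1n.
(* Write x for [n]. The tower and [max_modulus_pmean] at a zero-free R0 <= Q x give 2^n <= 8 T(R0,
   f), hence ln ln T(R0, f) >= ln x + ln (ln 2 / 2). The hyper-order bounds the same quantity by rho
   (ln Q + ln x). Together (1 - rho) ln x <= E, which fails for large [n]. *)
pose E := rho * ln Q - ln (ln 2 / 2).
have [n hn] : exists n : nat, 6 + 2 * `|C| + r2 + M0 + expR (`|E| / (1 - rho)) < n%:R.
  by exists (Num.bound `|6 + 2 * `|C| + r2 + M0 + expR (`|E| / (1 - rho))|);
     apply: le_lt_trans (ler_norm _) (archi_boundP _).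
have C0 := normr_ge0 C; have e0 := expR_gt0 (`|E| / (1 - rho)).
set x := n%:R in hn.
have x6 : 6 < x by lra.
have xe : expR (`|E| / (1 - rho)) < x by lra.
have x0 : 0 < x by exact: lt_trans x6.
pose s := r + x * K.
have xs : x <= s by rewrite /s; nra.
have [R0 [hR1 hR2 zf]] := @zerofree_dense _ f z0 (2 * s) (3 * s) fe fz0 ltac:(lra) ltac:(lra).
have sx : s <= x * (r + K) by rewrite /s; nra.
have RQ : R0 <= Q * x by rewrite /Q; nra.
have T1 : expR (2 ^+ n) <= expR (4 * pmean f R0 + C).
  apply: le_trans (tower r n rr1 hr) _; apply: maxmod_le; first by rewrite -/x -/s; lra.
  by move=> z zs; apply: hmax => //; rewrite -/x -/s in zs; lra.
rewrite ler_expR in T1.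
have xn : x <= 2 ^+ n by rewrite /x -natrX ler_nat ltnW // ltn_expl.
have CC := ler_norm C.
have T2 : 2 ^+ n / 8 <= pmean f R0 by lra.
have p2n : 0 < 2 ^+ n / 8 :> R by rewrite divr_gt0 // exprn_gt0.
have T3 : (x - 3) * ln 2 <= ln (pmean f R0).
  apply: (@le_trans _ _ (ln (2 ^+ n / 8))); last first.
    by rewrite ler_ln ?posrE //; exact: lt_le_trans T2.
  by rewrite ln_pow2_over8 mulrBl.
have T4 : x * (ln 2 / 2) <= ln (pmean f R0) by nra.
have T5 : ln x + ln (ln 2 / 2) <= ln (ln (pmean f R0)).
  have h0 : 0 < x * (ln 2 / 2) by rewrite mulr_gt0 ?divr_gt0 //; lra.
  rewrite -lnM ?posrE ?divr_gt0 //.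
  by rewrite ler_ln ?posrE //; exact: lt_le_trans T4.
have T6 : ln (ln (pmean f R0)) <= rho * ln R0 by apply: hrho; lra.
have T7 : ln R0 <= ln Q + ln x.
  have Q0 : 0 < Q by exact: lt_le_trans Q1.
  have R00 : 0 < R0 by apply: lt_trans hR1; rewrite mulr_gt0 //; exact: lt_le_trans xs.
  by rewrite -lnM ?posrE // ler_ln ?posrE // mulr_gt0.
have T8 : (1 - rho) * ln x <= `|E|.
  have := ler_norm E; rewrite /E => h.
  have : rho * ln R0 <= rho * (ln Q + ln x) by rewrite ler_wpM2l.
  lra.
have r1' : 0 < 1 - rho by rewrite subr_gt0.
have T9 : ln x <= `|E| / (1 - rho) by rewrite ler_pdivlMr // mulrC.
have : x <= expR (`|E| / (1 - rho)) by rewrite -{1}(lnK (_ : x \is Num.pos)) ?posrE // ler_expR.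
by rewrite leNgt xe.
Qed.

(** At z = (r / N) h1^* with N = |h1|, the exponent h1 z is real and equals N r, while Re (h2 z) =
    sg r. Here sg < N, strictly because h2 differs from h1 and is not larger in modulus. *)
Lemma rhs_lower_half (q1 q2 h1 h2 : R[i]) : q1 != 0 -> h1 != 0 -> h1 != h2 -> nm h2 <= nm h1 ->
  exists c r1, 0 < c /\ forall r, r1 <= r -> exists2 z, nm z = r &
    expR (c * r) <= nm (q1 * cexp (h1 * z) + q2 * cexp (h2 * z)).
Proof.
move=> q10 h10 h12 hle; pose N := nm h1.
have N0 : 0 < N by rewrite nm_gt0.
pose sg := complex.Re (h2 * h1^*) / N.
have sgN : sg < N.
  rewrite ltr_pdivrMr // -expr2.
  have h : 0 < nm (h2 - h1) ^+ 2 by rewrite exprn_gt0 // nm_gt0 subr_eq0 eq_sym.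
  have : nm h2 ^+ 2 <= N ^+ 2 by rewrite ler_pXn2r ?nnegrE ?nm_ge0.
  exact: Re_mulJ_lt.
have q1p : 0 < nm q1 by rewrite nm_gt0.
(* The first threshold makes the second term at most half of the first; the second makes the
   remaining half at least exp(N r / 2). *)
pose r1 := Num.max 0 (Num.max (2 * nm q2 / nm q1 / (N - sg)) (2 / nm q1 / (N / 2))).
exists (N / 2), r1; split; first by lra.
move=> r; rewrite !ge_max => /andP[r0 /andP[ra rb]].
pose z := (r / N)%:C * h1^*.
have zr : nm z = r.
  by rewrite /z nmM nmR nmJ -/N ger0_norm ?divr_ge0 ?(ltW N0) // mulfVK // gt_eqF.
have Nsg : 0 < N - sg by lra.
exists z => //.
have R1 : complex.Re (h1 * z) = N * r.
  rewrite /z mulrCA mulJ -realC_M /= -/N; field; lra.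
have R2 : complex.Re (h2 * z) = sg * r.
  rewrite /z mulrCA reM /= mul0r subr0 /sg; field; lra.
have a1 : nm q2 * expR (sg * r) <= nm q1 / 2 * expR (N * r).
  have -> : expR (N * r) = expR ((N - sg) * r) * expR (sg * r) by rewrite -expRD; congr expR; ring.
  rewrite mulrA ler_wpM2r ?expR_ge0 //.
  have := expR_ge1Dx ((N - sg) * r).
  rewrite ler_pdivrMr // ler_pdivrMr // in ra.
  nra.
have a2 : expR (N / 2 * r) <= nm q1 / 2 * expR (N * r).
  have -> : expR (N * r) = expR (N / 2 * r) * expR (N / 2 * r) by rewrite -expRD; congr expR; field.
  rewrite mulrA ler_peMl ?expR_ge0 //.
  have := expR_ge1Dx (N / 2 * r).
  rewrite ler_pdivrMr ?ler_pdivrMr ?divr_gt0 // in rb.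
  nra.
apply: le_trans (nm_lerBD _ _); rewrite (nmM q1) (nmM q2) !nm_cexp R1 R2.
lra.
Qed.

Lemma rhs_lower : p1 != 0 -> p2 != 0 -> g1 != 0 -> g2 != 0 -> g1 != g2 ->
  exists c r1, 0 < c /\ forall r, r1 <= r -> exists2 z, nm z = r &
    expR (c * r) <= nm (p1 * cexp (g1 * z) + p2 * cexp (g2 * z)).
Proof.
move=> p10 p20 g10 g20 g12; have [h|h] := leP (nm g2) (nm g1).
  exact: rhs_lower_half.
have [||||c [r1 [c0 hc]]] := @rhs_lower_half p2 p1 g2 g1 => //.
- by rewrite eq_sym.
- exact: ltW.
by exists c, r1; split => // r /hc [z zr hz]; exists z => //; rewrite addrC.
Qed.

(** By the equation the right-hand side is at most (1 + D) N'^3, where N' is the maximum of 1 and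
    M(r + K). Half of the exponent c r absorbs 1 + D; the other half is the cube of exp(c r / 6). *)
Lemma maxmod_lower : p1 != 0 -> p2 != 0 -> g1 != 0 -> g2 != 0 -> g1 != g2 ->
  exists c r1, [/\ 0 < c, 0 < r1 & forall r, r1 <= r -> expR (c * r) <= maxmod f (r + K)].
Proof.
move=> p10 p20 g10 g20 g12; have [c [r1 [c0 hc]]] := rhs_lower p10 p20 g10 g20 g12.
have K1 : 1 <= K by exact: K_ge1.
have D1 : 1 <= D by exact: D_ge1.
exists (c / 6), (Num.max 1 (Num.max r1 (2 * (1 + D) / c))); split; first by lra.
  by rewrite lt_max ltr01.
move=> r; rewrite !ge_max => /andP[r0 /andP[rr1 rD]].
have [z zr hz] := hc r rr1.
set N := maxmod f (r + K).
have N0 : 0 <= N by apply: maxmod_ge0 => //; lra.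
pose N' := Num.max 1 N.
have N'1 : 1 <= N' by rewrite le_max lexx.
have NN' : N <= N' by rewrite le_max lexx orbT.
have h1 : nm (p1 * cexp (g1 * z) + p2 * cexp (g2 * z)) <= (1 + D) * N' ^+ 3.
  rewrite -f_eq; apply: (le_trans (nmD _ _)); rewrite mulrDl mul1r; apply: lerD.
    rewrite nmM nmX (exprSr N' 2); apply: ler_pM; rewrite ?exprn_ge0 ?nm_ge0 //.
      rewrite ler_pXn2r ?nnegrE ?nm_ge0 //; last by lra.
      by apply: le_trans NN'; apply: maxmod_ge => //; lra.
    by apply: le_trans NN'; apply: maxmod_cder => //; lra.
  apply: (@le_trans _ _ (D * N)); first by apply: (difference_bound _ _ fe); rewrite zr.
  rewrite ler_wpM2l //; first by lra.
  by apply: (le_trans NN'); rewrite -[leLHS]expr1 ler_weXn2l.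
have h2 := le_trans hz h1.
have eh : expR (c * r) = expR (c / 2 * r) * expR (c / 6 * r) ^+ 3.
  by rewrite -expRM_natl -expRD; congr expR; field.
have h3 : 1 + D <= expR (c / 2 * r).
  have := expR_ge1Dx (c / 2 * r); rewrite ler_pdivrMr // in rD; nra.
have h4 : expR (c / 6 * r) ^+ 3 <= N' ^+ 3.
  have e3 : 0 <= expR (c / 6 * r) ^+ 3 by rewrite exprn_ge0 ?expR_ge0.
  rewrite eh in h2.
  have h5 : (1 + D) * expR (c / 6 * r) ^+ 3 <= (1 + D) * N' ^+ 3.
    by apply: le_trans h2; rewrite ler_wpM2r.
  by rewrite ler_pM2l // in h5; lra.
rewrite ler_pXn2r ?nnegrE ?expR_ge0 // in h4; last by lra.
have h6 : expR 0 < expR (c / 6 * r) by rewrite ltr_expR mulr_gt0 //; lra.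
rewrite expR0 in h6.
move: h4; rewrite /N' le_max => /orP[h|//].
by have := lt_le_trans h6 h; rewrite ltxx.
Qed.

Lemma characteristic_lower : p1 != 0 -> p2 != 0 -> g1 != 0 -> g2 != 0 -> g1 != g2 ->
  exists c r1, 0 < c /\ forall r, r1 <= r -> zerofree f r -> c * r <= pmean f r.
Proof.
move=> p10 p20 g10 g20 g12; have [c [r1 [c0 r10 hc]]] := maxmod_lower p10 p20 g10 g20 g12.
have [r2 [C [r20 hmax]]] := max_modulus_pmean fe fz0.
have K1 : 1 <= K by exact: K_ge1.
(* Comparison at radius r / 2 gives c (r / 2 - K) <= 4 P + C with P = [pmean f r]. The last
   threshold makes c K + |C| at most c r / 4, which leaves c r / 4 <= 4 P. *)
exists (c / 16), (Num.max (2 * (r1 + K)) (Num.max r2 (4 * (c * K + `|C|) / c))); split; first by lra.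
move=> r; rewrite !ge_max => /andP[ra /andP[rb rc]] zf.
have h1 := hc (r / 2 - K) ltac:(lra).
rewrite subrK in h1.
have h2 : expR (c * (r / 2 - K)) <= expR (4 * pmean f r + C).
  apply: (le_trans h1); apply: maxmod_le; first lra.
  by move=> z zr; apply: hmax.
rewrite ler_expR in h2; rewrite ler_pdivrMr // in rc.
have := ler_norm C; nra.
Qed.

End ExponentialType.

(** * Exponential polynomials and zero-free solutions *)

Section Exponentials.
Context {R : realType}.
Local Notation nm := (@normc R).
Implicit Types (f g u y : R[i] -> R[i]) (a b c z w l : R[i]) (r A : R).

Lemma cderiv_sum (I : Type) (s : seq I) (F F' : I -> R[i] -> R[i]) z :
  (forall i, cderiv (F i) z (F' i z)) ->
  cderiv (fun w => \sum_(i <- s) F i w) z (\sum_(i <- s) F' i z).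
Proof.
move=> h; elim: s => [|i s IH].
  rewrite big_nil (_ : (fun w => _) = (fun=> 0)); first exact: cderiv_cst.
  by apply/funext => w; rewrite big_nil.
rewrite big_cons (_ : (fun w => _) = (fun w => F i w + \sum_(j <- s) F j w)).
  exact: cderivD.
by apply/funext => w; rewrite big_cons.
Qed.

(** The operator D - l0 kills the first term and multiplies each other coefficient by the nonzero
    difference of its exponent and l0. As this changes the list, the induction is on a bound for its
    size. *)
Lemma cexpM_independent (s : seq (R[i] * R[i])) : uniq (map snd s) ->
  (forall z, \sum_(p <- s) p.1 * cexp (p.2 * z) = 0) -> forall p, p \in s -> p.1 = 0.
Proof.
move: {2}(size s) (leqnn (size s)) => n; elim: n s => [|n IH] [|[c0 l0] s] //= sn.
case/andP => l0s us h.
have h' z : \sum_(p <- [seq (p.1 * (p.2 - l0), p.2) | p <- s]) p.1 * cexp (p.2 * z) = 0.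
  pose S z := \sum_(p <- (c0, l0) :: s) p.1 * cexp (p.2 * z).
  have S0 : S = fun=> 0 by apply/funext.
  have d1 : cderiv S z (\sum_(p <- (c0, l0) :: s) p.1 * (p.2 * cexp (p.2 * z))).
    apply: (@cderiv_sum _ _ (fun p w => p.1 * cexp (p.2 * w)) (fun p w => p.1 * (p.2 * cexp (p.2 * w)))) => p.
    by apply: cderivZ; exact: cderiv_cexpM.
  have d2 : cderiv S z 0 by rewrite S0; exact: cderiv_cst.
  have E := cderiv_uniq d1 d2.
  have E2 : l0 * S z = 0 by rewrite S0 mulr0.
  rewrite big_map /=.
  transitivity (\sum_(p <- (c0, l0) :: s) p.1 * (p.2 * cexp (p.2 * z)) - l0 * S z); last by rewrite E E2 subrr.
  rewrite /S !big_cons /= mulrDr mulr_sumr.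
  have -> (a b a' b' : R[i]) : a + b - (a' + b') = (a - a') + (b - b') by ring.
  rewrite -sumrB (_ : c0 * _ - _ = 0) ?add0r; last by ring.
  by apply: eq_bigr => p _; ring.
have us' : uniq (map snd [seq (p.1 * (p.2 - l0), p.2) | p <- s]).
  by rewrite -map_comp (eq_map (g := snd)).
have sn' : leq (size [seq (p.1 * (p.2 - l0), p.2) | p <- s]) n by rewrite size_map.
have key p : p \in s -> p.1 = 0.
  move=> ps; have /= := IH _ sn' us' h' (p.1 * (p.2 - l0), p.2) (map_f _ ps).
  move=> /eqP; rewrite mulf_eq0 subr_eq0 => /orP[/eqP //|/eqP pl].
  by move: l0s; rewrite -pl map_f.
move=> p; rewrite in_cons => /orP[/eqP ->|/key //] /=.
have := h 0; rewrite big_cons /= mulr0 cexp0 mulr1 big_seq big1 ?addr0 //.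
by move=> q /key ->; rewrite mul0r.
Qed.

Lemma ode1 y a : ent y -> (forall z, cder y z = a * y z) -> forall z, y z = y 0 * cexp (a * z).
Proof.
move=> ye h z.
have D w : cderiv (fun w => y w * cexp (- a * w)) w 0.
  have := cderivM (cderP w ye) (cderiv_cexpM (- a) w); rewrite h.
  by rewrite (_ : _ + _ = 0) //; ring.
have := ent_const D z; rewrite mulr0 cexp0 mulr1 => <-.
by rewrite -mulrA -cexpD mulNr addNr cexp0 mulr1.
Qed.

Lemma ent_inv f : ent f -> (forall z, f z != 0) -> ent (fun z => (f z)^-1).
Proof. by move=> fe f0 z; eexists; apply: cderivV => //; exact: cderP. Qed.

(** This is the kernel of the differentiated Schwarz formula, compared with its value at 0. The
    constant is 3 r |z| / (r (r / 2)^2) = 12 |z| / r^2. *)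
Lemma kernel2_diff (v z : R[i]) r : nm v = r -> 0 < r -> nm z <= r / 2 ->
  nm (v / (v - z) / (v - z) - v / v / v) <= 12 * nm z / r ^+ 2.
Proof.
move=> vr r0 zr; have z0 := nm_ge0 z.
have d := nm_lerB v z; rewrite vr in d.
have v0 : v != 0 by rewrite -nm_gt0 vr.
have vz0 : v - z != 0 by rewrite -nm_gt0; lra.
have -> : v / (v - z) / (v - z) - v / v / v = z * (v + (v - z)) / (v * (v - z) ^+ 2).
  by field; rewrite v0 vz0.
rewrite (nmM _ (_)^-1) (nmM z) nmV (nmM v) nmX vr.
have h1 : nm (v + (v - z)) <= 3 * r.
  apply: (le_trans (nmD _ _)); have := nmB v z; rewrite vr; lra.
have h2 : (r / 2) ^+ 2 <= nm (v - z) ^+ 2.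
  by rewrite ler_pXn2r ?nnegrE ?nm_ge0 //; lra.
rewrite ler_pdivrMr; last by rewrite mulr_gt0 // exprn_gt0 // nm_gt0.
have h3 : nm z * nm (v + (v - z)) <= nm z * (3 * r) by rewrite ler_wpM2l.
have h4 : 12 * nm z / r ^+ 2 * (r * (r / 2) ^+ 2) <= 12 * nm z / r ^+ 2 * (r * nm (v - z) ^+ 2).
  by rewrite ler_wpM2l ?ler_pM2l // divr_ge0 ?mulr_ge0 ?exprn_ge0 // ltW.
apply: (le_trans h3); apply: le_trans h4.
rewrite le_eqVlt; apply/orP; left; apply/eqP; field; lra.
Qed.

Lemma le0_of_linear_over_square (x C1 C2 : R) : 0 <= C1 -> 0 <= C2 ->
  (exists r1, forall r, r1 <= r -> 0 < r -> x <= (C1 * r + C2) / r ^+ 2) -> x <= 0.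
Proof.
move=> c1 c2 [r1 h]; rewrite leNgt; apply/negP => x0.
pose r := Num.max r1 (Num.max 1 ((C1 + C2 + 1) / x)).
have r1r : r1 <= r by rewrite le_max lexx.
have r1' : 1 <= r by rewrite !le_max lexx orbT.
have r2 : (C1 + C2 + 1) / x <= r by rewrite !le_max lexx !orbT.
have := h r r1r ltac:(lra); rewrite ler_pdivlMr; last by rewrite exprn_gt0 //; lra.
rewrite ler_pdivrMr // in r2; rewrite expr2; nra.
Qed.

(** u = f' / f is the derivative of a logarithm G of f / f(0), hence given by the differentiated
    Schwarz formula on |z| = r. The mean of |Re G| is O(r) and the kernels at z and 0 differ by O(1
    / r^2), so u(z) - u(0) tends to 0 and [u] is constant. *)
Lemma zerofree_exponential f A r1 : ent f -> (forall z, f z != 0) -> 0 <= A ->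
  (forall r, r1 <= r -> maxmod f r <= expR (A * r)) -> exists a, forall z, f z = f 0 * cexp (a * z).
Proof.
move=> fe f0 A0 hA; pose u z := cder f z * (f z)^-1.
have ue : ent u by apply: entM; [exact: ent_cder|exact: ent_inv].
pose C0 := `|ln (nm (f 0))|.
have C00 : 0 <= C0 by exact: normr_ge0.
have key z r : Num.max 0 r1 <= r -> 0 < r -> nm z <= r / 2 ->
   nm (u z - u 0) <= (2 * A * r + 2 * C0) * (24 * nm z / r ^+ 2).
  rewrite ge_max => /andP[_ rr1] r0 zr.
  have fn w : nm w < r + 2 -> f w != 0 by [].
  have [G [hG G0 fG]] := @holomorphic_log R f (r + 2) (r + 1) fe ltac:(lra) ltac:(lra) fn.
  have dG w : nm w < r + 1 -> cderiv G w (u w).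
    move=> wr; have [l dl] := hG w wr; suff -> : u w = l by [].
    have d1 : cderiv f w (f 0 * (cexp (G w) * l)).
      apply: (@cderiv_near _ (fun w => f 0 * cexp (G w))).
        exists (r + 1 - nm w); first by rewrite subr_gt0.
        by move=> v vw; rewrite -fG //; have := nm_lerB v w; lra.
      by apply: cderivZ; apply: cderiv_comp dl _; exact: cderiv_cexp.
    rewrite /u (cderE d1) mulrA -fG // mulrAC divff ?mul1r //.
  have zf : zerofree f r by move=> w _.
  have wr1 w t : w = circ r t -> nm w < r + 1 by move=> ->; rewrite nm_circ; lra.
  pose h t := (2 * complex.Re (G (circ r t)))%:C * circ r t.
  have Gc : pcont (fun t => G (circ r t)).
    by apply: pcont_circ_comp => t; apply: hol_ccont hG _; apply: wr1.
  have uc := pcont_Re Gc.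
  have hc : pcont h.
    apply: pcontM; last exact: pcont_circ.
    by apply: pcont_real => t; apply: cvgMr; exact: uc.
  have rr : r < r + 1 by rewrite ltrDl.
  have uE w : nm w < r -> u w = cmean (fun t => h t / (circ r t - w) / (circ r t - w)).
    move=> wr; apply: (cderiv_uniq (dG w _)); first lra.
    apply: (@cderiv_near _ (fun w => cmean (fun t => h t / (circ r t - w)) - (G 0)^*)).
      exists (r - nm w); first by rewrite subr_gt0.
      move=> v vw; rewrite (schwarz_formula hG rr); first by rewrite addrK.
      by have := nm_lerB v w; lra.
    rewrite -[cmean _]subr0; apply: cderivB; last exact: cderiv_cst.
    exact: cauchy_kernel_deriv.
  have z0r : nm 0 < r :> R by rewrite nm0.
  have zr' : nm z < r by lra.
  have aG : continuous (fun t => `|complex.Re (G (circ r t))|) by exact: continuous_abs.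
  have GR t : complex.Re (G (circ r t)) = ln (nm (f (circ r t))) - ln (nm (f 0)).
    rewrite fG; last by apply: wr1.
    rewrite nmM nm_cexp lnM ?posrE ?expR_gt0 ?nm_gt0 // expRK; ring.
  have aL : continuous (fun t => `|ln (nm (f (circ r t)))|).
      by apply: continuous_abs; apply: continuous_lmean => //; exact: ltW.
  have b1 : rmean (fun t => `|complex.Re (G (circ r t))|) <= 2 * A * r + 2 * C0.
    apply: (@le_trans _ _ (rmean (fun t => `|ln (nm (f (circ r t)))| + C0))).
      apply: rmean_le => //.
        move=> t; apply: cvgD; last exact: cvg_cst.
        exact: aL.
      by move=> t; rewrite GR; exact: ler_normB.
    rewrite rmeanD ?rmean_cst //; last first.
    - by move=> t; exact: cvg_cst.
    rewrite rmean_abs_ln // ?(ltW r0) //.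
    have p1 : pmean f r <= A * r.
      by apply: pmean_le => //; [exact: ltW|exact: hA|rewrite mulr_ge0 // ltW].
    (* Without zeros the mean of ln |f| is its value at 0, so the mean of its absolute value is
       controlled by [pmean f r] alone. *)
    have l1 : lmean f r = ln (nm (f 0)).
      have mG : rmean (fun t => complex.Re (G (circ r t))) = 0.
        by rewrite -cmean_Re (mean_value hG r0 rr) G0.
      move: mG; rewrite (rmean_ext GR) rmeanB ?rmean_cst //; last 2 first.
      - by apply: continuous_lmean => //; exact: ltW.
      - by move=> t; exact: cvg_cst.
      by rewrite -/(lmean f r); lra.
    rewrite l1; have := ler_norm (- ln (nm (f 0))); rewrite normrN -/C0; lra.
  rewrite (uE z zr') (uE 0 z0r) -cmeanB; last 2 first.
  - by do 2!apply: (pcontV_circ _ zr').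
  - by do 2!apply: (pcontV_circ _ z0r).
  set Kz := 24 * nm z / r ^+ 2.
  apply: (@le_trans _ _ (rmean (fun t => Kz * `|complex.Re (G (circ r t))|))); last first.
    rewrite rmeanZ // mulrC ler_wpM2r // /Kz divr_ge0 ?mulr_ge0 ?nm_ge0 ?exprn_ge0 // ltW //.
  apply: cmean_nm_le.
  - apply: (@pcontD R _ (fun t => - (h t / (circ r t - 0) / (circ r t - 0)))).
      by do 2!apply: (pcontV_circ _ zr').
    rewrite (_ : (fun t => - _) = (fun t => (-1) * (h t / (circ r t - 0) / (circ r t - 0)))).
      by apply: pcontM; [exact: pcont_cst|do 2!apply: (pcontV_circ _ z0r)].
    by apply/funext => t; rewrite mulN1r.
  - by move=> t; apply: cvgMr; exact: aG.
  move=> t; rewrite /h subr0; set v := circ r t.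
  have vr : nm v = r by rewrite nm_circ // ltW.
  have -> : (2 * complex.Re (G v))%:C * v / (v - z) / (v - z) - (2 * complex.Re (G v))%:C * v / v / v =
    (2 * complex.Re (G v))%:C * (v / (v - z) / (v - z) - v / v / v) by ring.
  rewrite nmM nmR normrM ger0_norm // mulrC.
  have := kernel2_diff vr r0 zr; have gn := normr_ge0 (complex.Re (G v)).
  move=> kk; have : nm (v / (v - z) / (v - z) - v / v / v) * (2 * `|complex.Re (G v)|) <= 12 * nm z / r ^+ 2 * (2 * `|complex.Re (G v)|).
    by rewrite ler_wpM2r // mulr_ge0.
  by move=> /le_trans; apply; rewrite /Kz le_eqVlt; apply/orP; left; apply/eqP; ring.
have uconst z : u z = u 0.
  apply/eqP; rewrite -subr_eq0 -nm_eq0 eq_le nm_ge0 andbT.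
  have z0 := nm_ge0 z.
  apply: (@le0_of_linear_over_square _ (48 * A * nm z) (48 * C0 * nm z)).
  - by rewrite !mulr_ge0.
  - by rewrite !mulr_ge0.
  exists (Num.max (Num.max 0 r1) (2 * nm z)) => r; rewrite ge_max => /andP[ra rb] r0.
  apply: le_trans (key z r ra r0 _) _; first by lra.
  rewrite le_eqVlt; apply/orP; left; apply/eqP; ring.
exists (u 0); apply: ode1 => // z.
by rewrite -(uconst z) /u mulrVK // unitfE.
Qed.

End Exponentials.

(** * The case H = 0 *)

Section Degenerate.
Context {R : realType}.
Local Notation nm := (@normc R).
Implicit Types (f W : R[i] -> R[i]) (a b c z w l : R[i]).

(** Unlike [cexpM_independent], this admits repeated exponents: terms are first grouped by exponent.
    It is needed where the coincidences among the exponents are the unknowns. *)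
Lemma cexpM_coef (s : seq (R[i] * R[i])) : (forall z, \sum_(p <- s) p.1 * cexp (p.2 * z) = 0) ->
  forall l, \sum_(p <- s | p.2 == l) p.1 = 0.
Proof.
move=> h l; pose L := undup (map snd s).
pose s' := [seq (\sum_(p <- s | p.2 == x) p.1, x) | x <- L].
have us' : uniq (map snd s') by rewrite -map_comp map_id_in ?undup_uniq.
have h' z : \sum_(p <- s') p.1 * cexp (p.2 * z) = 0.
  rewrite big_map /= -[RHS](h z).
  transitivity (\sum_(x <- L) \sum_(p <- s | p.2 == x) p.1 * cexp (p.2 * z)).
    by apply: eq_bigr => x _; rewrite mulr_suml; apply: eq_bigr => p /eqP ->.
  rewrite (exchange_big_dep predT) //=; apply: eq_big_seq => p ps.
  under eq_bigl => x do rewrite eq_sym.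
  rewrite -big_filter (_ : seq.filter _ L = [:: p.2]) ?big_seq1 //.
  by apply: filter_pred1_uniq; rewrite ?undup_uniq // mem_undup map_f.
have [lL|lL] := boolP (l \in L).
  exact: (cexpM_independent us' h' (map_f _ lL)).
rewrite big_seq_cond big_pred0 // => p; apply/negP => /andP[ps /eqP pl].
by move: lL; rewrite mem_undup -pl map_f.
Qed.

Definition ode2 a b W z : R[i] := cder (cder W) z - (a + b) * cder W z + a * b * W z.

Lemma cder_ode2 W a b : ent W -> (forall z, ode2 a b W z = 0) ->
  exists A, forall z, cder W z - b * W z = A * cexp (a * z).
Proof.
move=> We h; have W'e := ent_cder We.
exists (cder W 0 - b * W 0); apply: (@ode1 _ (fun z => cder W z - b * W z)).
  by apply: entB => //; apply: entM => //; exact: ent_cst.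
move=> z; apply: cderE; have := cderivB (cderP z W'e) (cderivZ b (cderP z We)).
rewrite (_ : cder (cder W) z - b * cder W z = a * (cder W z - b * W z)) //.
by apply/eqP; rewrite -subr_eq0 -(h z) /ode2; apply/eqP; ring.
Qed.

(** Since [W] contains the factor f^2, both W and W' vanish at a zero of [f]. Thus (D - g2) W and (D
    - g1) W, being multiples of exponentials, are 0, and so is their difference (g1 - g2) W. As 3 W
    is the derivative of f^3, [f] would vanish everywhere. *)
Lemma ode2_zerofree f z0 (g1 g2 : R[i]) : ent f -> f z0 != 0 -> g1 != g2 ->
  let W := fun z => f z ^+ 2 * cder f z in
  (forall z, ode2 g1 g2 W z = 0) -> forall z, f z != 0.
Proof.
move=> fe fz0 g12 W h w; apply/eqP => fw; have f'e := ent_cder fe.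
have We : ent W by apply: entM => //; exact: entX.
have [A hA] := cder_ode2 We h.
have [B hB] : exists B, forall z, cder W z - g1 * W z = B * cexp (g2 * z).
  by apply: cder_ode2 => // z; rewrite /ode2 (addrC g2) (mulrC g2); exact: h.
have dF z : cderiv (fun z => f z ^+ 3) z (3 * W z).
  rewrite (_ : (fun z => _) = (fun z => f z * (f z * f z))); last by apply/funext => v; rewrite !exprS expr0 mulr1.
  have := cderivM (cderP z fe) (cderivM (cderP z fe) (cderP z fe)).
  by congr cderiv; rewrite /W; ring.
have Ww : W w = 0 by rewrite /W fw expr2 !mul0r.
have W'w : cder W w = 0.
  apply: cderE; rewrite (_ : W = (fun z => f z * (f z * cder f z))); last first.
    by apply/funext => v; rewrite /W expr2 mulrA.
  have := cderivM (cderP w fe) (cderivM (cderP w fe) (cderP w f'e)).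
  by congr cderiv; rewrite fw; ring.
have A0 : A = 0.
  by move/eqP: (hA w); rewrite Ww W'w mulr0 subrr eq_sym mulf_eq0 (negPf (cexp_neq0 _)) orbF => /eqP.
have B0 : B = 0.
  by move/eqP: (hB w); rewrite Ww W'w mulr0 subrr eq_sym mulf_eq0 (negPf (cexp_neq0 _)) orbF => /eqP.
have W0 z : W z = 0.
  have : (g1 - g2) * W z = (cder W z - g2 * W z) - (cder W z - g1 * W z) by ring.
  by rewrite hA hB A0 B0 !mul0r subrr => /eqP; rewrite mulf_eq0 subr_eq0 (negPf g12) => /eqP.
have F0 z : f z ^+ 3 = f 0 ^+ 3.
  by apply: (@ent_const R (fun z => f z ^+ 3)) => v; have := dF v; rewrite W0 mulr0.
by have /eqP := F0 z0; rewrite -(F0 w) fw expr0n /= expf_eq0 (negPf fz0).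
Qed.

Variables (p1 p2 g1 g2 : R[i]) (m : nat) (d k : 'I_m.+1 -> R[i]).

(** Since 3 a <> a and c^3 a <> 0, the exponent 3 a must be one of g1, g2. The other one carries a
    nonzero coefficient on the right, so it can only be matched by [a]. *)
Lemma exponential_solution c a : p1 != 0 -> p2 != 0 -> g1 != g2 -> c != 0 -> a != 0 ->
  (forall z, c ^+ 3 * a * cexp (3 * a * z) + (\sum_(j < m.+1) d j * c * cexp (a * k j)) * cexp (a * z) =
    p1 * cexp (g1 * z) + p2 * cexp (g2 * z)) ->
  [/\ 3 * a = g1, a = g2, c ^+ 3 * a = p1 & p2 = \sum_(j < m.+1) d j * c * cexp (a * k j)] \/
  [/\ 3 * a = g2, a = g1, c ^+ 3 * a = p2 & p1 = \sum_(j < m.+1) d j * c * cexp (a * k j)].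
Proof.
set B := \sum_(j < _) _ => p10 p20 g12 c0 a0 h.
have a3 : (3 * a == a) = false.
  by rewrite -subr_eq0 (_ : 3 * a - a = 2 * a) ?mulf_eq0 ?(negPf a0) ?orbF ?pnatr_eq0 //; ring.
have ca : c ^+ 3 * a != 0 by rewrite mulf_neq0 // expf_neq0.
pose s := [:: (c ^+ 3 * a, 3 * a); (B, a); (- p1, g1); (- p2, g2)].
have K l : \sum_(p <- s | p.2 == l) p.1 = 0.
  apply: cexpM_coef => z; rewrite /s !big_cons big_nil /=.
  by apply/eqP; rewrite addr0 addrA h !mulNr -opprD subrr.
(* Equality of the total coefficients of exp(l z) on both sides, for an arbitrary exponent [l]. *)
have E l : (if 3 * a == l then c ^+ 3 * a else 0) + (if a == l then B else 0) =
           (if g1 == l then p1 else 0) + (if g2 == l then p2 else 0).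
  apply/eqP; rewrite -subr_eq0 -[X in _ == X](K l) /s !big_cons big_nil /=; apply/eqP.
  by do 4!(case: ifP => _); ring.
have := E (3 * a); rewrite eqxx (eq_sym a) a3 addr0.
have [g1a|g1a] := eqVneq g1 (3 * a).
  have g2a : (g2 == 3 * a) = false by rewrite -g1a eq_sym; exact: negPf.
  rewrite g2a addr0 => cp; left.
  have := E g2; rewrite eqxx -g1a (negPf g12) !add0r.
  by have [ag BB|_ /esym/eqP] := eqVneq a g2; [split|rewrite (negPf p20)].
have [g2a|g2a] := eqVneq g2 (3 * a); last by rewrite addr0 => /eqP; rewrite (negPf ca).
rewrite add0r => cp; right.
have := E g1; rewrite eqxx -g2a (eq_sym g2) (negPf g12) add0r addr0.
by have [ag BB|_ /esym/eqP] := eqVneq a g1; [split|rewrite (negPf p10)].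
Qed.

End Degenerate.

(** * Solutions with zeros *)

Section Nondegenerate.
Context {R : realType}.
Local Notation nm := (@normc R).
Implicit Types (f V G : R[i] -> R[i]) (a b c z w : R[i]) (r x y B E : R).

Lemma ent_ode2 a b V : ent V -> ent (ode2 a b V).
Proof.
move=> Ve; apply: entD; last by apply: entM => //; exact: ent_cst.
by apply: entB; [exact/ent_cder/ent_cder|apply: entM; [exact: ent_cst|exact: ent_cder]].
Qed.

(** Cauchy's estimate at radius 1 is used twice for the second derivative, hence the neighbourhood
    of radius 2. *)
Lemma ode2_bound a b V z B : ent V -> (forall c, nm c <= 2 -> nm (V (z + c)) <= B) ->
  nm (ode2 a b V z) <= (1 + nm (a + b) + nm (a * b)) * B.
Proof.
move=> Ve hB; have V'e := ent_cder Ve.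
have h1 c : nm c <= 1 -> nm (cder V (z + c)) <= B.
  move=> c1; apply: cauchy_estimate => // c' c'1; rewrite -addrA; apply: hB.
  by have := nmD c c'; lra.
have h2 : nm (cder (cder V) z) <= B by exact: cauchy_estimate.
have nm00 : nm 0 <= 1 :> R by rewrite nm0.
have nm02 : nm 0 <= 2 :> R by rewrite nm0.
have h1' := h1 0 nm00; have h0' := hB 0 nm02; rewrite addr0 in h1' h0'.
apply: (le_trans (nmD _ _)); apply: (le_trans (lerD (nmB _ _) (lexx _))).
rewrite (nmM (a + b)) (nmM (a * b)).
have p1 := ler_wpM2l (nm_ge0 (a + b)) h1'; have p2 := ler_wpM2l (nm_ge0 (a * b)) h0'.
rewrite !mulrDl mul1r; apply: lerD => //; exact: lerD.
Qed.

Lemma cder_exp2 (q1 q2 a b : R[i]) z :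
  cder (fun w => q1 * cexp (a * w) + q2 * cexp (b * w)) z = q1 * a * cexp (a * z) + q2 * b * cexp (b * z).
Proof.
apply: cderE; rewrite -!(mulrA _ _ (cexp _)).
by apply: cderivD; apply: cderivZ; exact: cderiv_cexpM.
Qed.

Lemma ode2_opp (p1 p2 a b : R[i]) V U : ent U ->
  (forall z, V z + U z = p1 * cexp (a * z) + p2 * cexp (b * z)) -> forall z, ode2 a b V z = - ode2 a b U z.
Proof.
move=> Ue h z; have U'e := ent_cder Ue.
have rhse (q1 q2 : R[i]) : ent (fun w => q1 * cexp (a * w) + q2 * cexp (b * w)).
  by apply: entD; apply: entM; try exact: ent_cst; exact: ent_cexpM.
have dV w : cder V w = p1 * a * cexp (a * w) + p2 * b * cexp (b * w) - cder U w.
  rewrite (_ : V = fun z => p1 * cexp (a * z) + p2 * cexp (b * z) - U z); last first.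
    by apply/funext => v; rewrite -h addrK.
  by apply: cderE; rewrite -cder_exp2; apply: cderivB; exact: cderP.
have d2V : cder (cder V) z = p1 * a * a * cexp (a * z) + p2 * b * b * cexp (b * z) - cder (cder U) z.
  rewrite (_ : cder V = fun w => p1 * a * cexp (a * w) + p2 * b * cexp (b * w) - cder U w); last first.
    by apply/funext => v; rewrite dV.
  by apply: cderE; rewrite -cder_exp2; apply: cderivB; exact: cderP.
have V0 : V z = p1 * cexp (a * z) + p2 * cexp (b * z) - U z by rewrite -h addrK.
by rewrite /ode2 d2V dV V0; ring.
Qed.

(* [min (l, 3 l) = 3 l - 2 max (0, l)] for [l = ln x]. *)
Lemma ln_le_linear_cubic x y (C E : R) : 0 < x -> 0 < y -> 1 <= C -> 0 <= E ->
  y <= C * (x * expR E) -> y <= C * (x ^+ 3 * expR (3 * E)) ->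
  ln y <= ln C + 3 * E + 3 * ln x - 2 * logp x.
Proof.
move=> xp y0 C1 E0 h1 h2; have C0 : 0 < C by lra.
have e1 : ln y <= ln C + (ln x + E).
  apply: (@le_trans _ _ (ln (C * (x * expR E)))).
    by rewrite ler_ln ?posrE // !mulr_gt0 ?expR_gt0.
  by rewrite !lnM ?posrE ?mulr_gt0 ?expR_gt0 // expRK.
have e2 : ln y <= ln C + (3 * ln x + 3 * E).
  apply: (@le_trans _ _ (ln (C * (x ^+ 3 * expR (3 * E))))).
    by rewrite ler_ln ?posrE // !mulr_gt0 ?expR_gt0 ?exprn_gt0.
  have x3 : 0 < x ^+ 3 by rewrite exprn_gt0.
  by rewrite (lnM (x := C)) ?(lnM (x := x ^+ 3)) ?posrE ?mulr_gt0 ?expR_gt0 // expRK lnXn // -(mulr_natl (ln x)).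
rewrite /logp; have [l0|l0] := leP 0 (ln x); lra.
Qed.

(* [E] is [Re G - ln |f|] plus the oscillation that Harnack's inequality allows for the
   Poisson majorant [Re G] of [f] at radius [r']. *)
Lemma neighbourhood_majorant f z0 r r' K : ent f -> f z0 != 0 -> 0 < r -> 0 <= K -> r + K < r' ->
  zerofree f r -> zerofree f r' ->
  exists E : R -> R, [/\ continuous E, forall t, 0 <= E t,
    forall t c, nm c <= K -> nm (f (circ r t + c)) <= nm (f (circ r t)) * expR (E t) &
    rmean E = lmean f r' - lmean f r +
      (2 * pmean f r' - lmean f r') * (2 * r' * K / ((r' - r - K) * (r' - r)))].
Proof.
move=> fe fz0 r0 K0 rr' zf zf'; have r'0 : 0 < r' by lra.
have [G [G1 _ G3 G4]] := poisson_majorant fe fz0 r'0 zf'.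
have [Gc Gm] := G3 r r0 ltac:(lra).
have Q0 := pmean_lmean_ge0 fe (ltW r'0) zf'.
set Q := 2 * pmean f r' - lmean f r' in Q0 G4 *.
set dl := Q * _.
have lc : continuous (fun t => ln (nm (f (circ r t)))) by apply: continuous_lmean => //; exact: ltW.
have gc := pcont_Re Gc.
have dl0 : 0 <= dl.
  by rewrite mulr_ge0 // divr_ge0 ?mulr_ge0 //; lra.
exists (fun t => complex.Re (G (circ r t)) + dl - ln (nm (f (circ r t)))).
have fp t : 0 < nm (f (circ r t)) by rewrite nm_gt0 zf // nm_circ // ltW.
have cr t : nm (circ r t) = r by rewrite nm_circ // ltW.
have sc : continuous (fun t => complex.Re (G (circ r t)) + dl).
  by move=> t; apply: cvgD; [exact: gc|exact: cvg_cst].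
split.
- by move=> t; apply: cvgB; [exact: sc|exact: lc].
- move=> t; have : ln (nm (f (circ r t))) <= complex.Re (G (circ r t)).
    rewrite -ler_expR lnK ?posrE //; apply: G1; rewrite cr; lra.
  lra.
- move=> t c cK; have zc := nmD (circ r t) c; rewrite cr in zc.
  rewrite expRD expRN lnK ?posrE // mulrCA divff ?mulr1 ?gt_eqF //.
  apply: le_trans (G1 _ _) _; first lra.
  rewrite ler_expR.
  have := G4 (circ r t + c) (circ r t) ltac:(lra) ltac:(rewrite cr; lra).
  have -> : circ r t + c - circ r t = c by ring.
  rewrite cr => h.
  have := le_trans (ler_norm _) (le_trans (nm_Re _) h); rewrite reD reN.
  have : Q * (2 * r' * nm c / ((r' - nm (circ r t + c)) * (r' - r))) <= dl.
    have c0 := nm_ge0 c; rewrite /dl ler_wpM2l //; apply: ler_pM.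
    - by rewrite !mulr_ge0 // ltW.
    - by rewrite invr_ge0 mulr_ge0 //; lra.
    - by rewrite ler_wpM2l // mulr_ge0 // ltW.
    rewrite lef_pV2 ?posrE ?mulr_gt0 //; try lra.
    by rewrite ler_wpM2r; lra.
  lra.
rewrite rmeanB // rmeanD // ?rmean_cst ?Gm //; first by rewrite -/(lmean f r); lra.
by move=> t; exact: cvg_cst.
Qed.

(** From r' <= 2 r and C <= A r follows Q <= 5 A r. The factors of the denominator are at least e r
    / 4 and e r / 2, the numerator at most 4 r K. The powers of r cancel, so the bound depends on
    [e] only through e^-2. *)
Lemma harnack_increment_bound (A C K e r r' Q : R) : 1 <= A -> 0 <= C -> C <= A * r -> 0 <= K -> 0 < e -> e <= 1 -> 0 < r ->
  r + e * r / 2 < r' -> r' < r + e * r -> 4 * K < e * r -> 0 <= Q -> Q <= 2 * (A * r') + C ->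
  Q * (2 * r' * K / ((r' - r - K) * (r' - r))) <= 160 * A * K / e ^+ 2.
Proof.
move=> A1 C0 CA K0 e0 e1 r0 h1 h2 h3 Q0 hQ.
have er0 : 0 < e * r by rewrite mulr_gt0.
have er1 : e * r <= r by rewrite ler_piMl // ltW.
have Q1 : Q <= 5 * A * r.
  have : A * r' <= A * (2 * r) by rewrite ler_wpM2l; lra.
  lra.
have n1 : 2 * r' * K <= 4 * r * K by rewrite ler_wpM2r //; lra.
have X1 : (e * r / 4) * (e * r / 2) <= (r' - r - K) * (r' - r) by apply: ler_pM; lra.
have -> : 160 * A * K / e ^+ 2 = 5 * A * r * (4 * r * K / ((e * r / 4) * (e * r / 2))).
  by field; rewrite !gt_eqF.
apply: ler_pM => //.
  by rewrite divr_ge0 ?mulr_ge0 //; lra.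
apply: ler_pM => //.
- by rewrite !mulr_ge0 //; lra.
- by rewrite invr_ge0 mulr_ge0 //; lra.
by rewrite lef_pV2 ?posrE ?mulr_gt0 //; lra.
Qed.

(** The radius r' is removed from the two-radii estimate. Jensen's formula bounds the increment of
    [lmean f] by a multiple of e r, and everything else is bounded independently of [r]; each share
    is at most eps r / 2. *)
Lemma radii_comparison f (H : R[i] -> R[i]) z0 z1 (K L A r1 eps : R) : ent f -> f z0 != 0 -> ent H -> H z1 != 0 ->
  0 <= K -> (forall r r', 0 < r -> r + K < r' -> zerofree f r -> zerofree f r' -> zerofree H r ->
    2 * pmean f r <= 3 * lmean f r' + 3 * ((2 * pmean f r' - lmean f r') *
      (2 * r' * K / ((r' - r - K) * (r' - r)))) + L - lmean H r) ->
  1 <= A -> (forall r, r1 <= r -> maxmod f r <= expR (A * r)) ->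
  0 < eps -> exists r2, forall r, r2 <= r -> zerofree f r -> zerofree H r ->
    2 * pmean f r <= 3 * lmean f r + eps * r.
Proof.
move=> fe fz0 entH Hz1 K0 two A1 hA eps0.
have [rf [Cf [rf0 _ _ hf]]] := lmean_ge fe fz0.
have [rh [Ch [rh0 _ _ hh]]] := lmean_ge entH Hz1.
have l2 : 0 < ln 2 :> R by rewrite ln_gt0 // ltr1n.
(* Three times the increment of [lmean f] is going to be at most 45 A e r / ln 2, and 90 = 2 *
   45. *)
pose e := Num.min 1 (eps * ln 2 / (90 * A)).
have e0 : 0 < e by rewrite lt_min ltr01 /= divr_gt0 ?mulr_gt0 //; lra.
have e1 : e <= 1 by rewrite ge_min lexx.
have e2 : 45 * A * e / ln 2 <= eps / 2.
  have : e <= eps * ln 2 / (90 * A) by rewrite ge_min lexx orbT.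
  rewrite ler_pdivlMr ?mulr_gt0 //; last lra.
  rewrite ler_pdivrMr // => h; have -> : eps / 2 * ln 2 = (eps * ln 2) / 2 by ring.
  lra.
(* The part bounded in r: [L], the lower bound for [lmean H], and three times the bound 160 A K /
   e^2 of [harnack_increment_bound]. *)
pose C1 := L + Ch + 480 * A * K / e ^+ 2.
pose r2 := Num.max (Num.max (Num.max r1 rf) (Num.max rh (nm z0))) (Num.max (Num.max 1 `|Cf|)
  (Num.max (Num.max (4 * K / e + 1) `|ln (nm (f z0))|) (2 * C1 / eps))).
exists r2 => r; rewrite !ge_max => /andP[/andP[/andP[ra rb] /andP[rc rd]] /andP[/andP[re rg] /andP[/andP[ri rj] rk]]].
move=> zf zH; have r0 : 0 < r by clear -re; lra.
have er0 : 0 < e * r by rewrite mulr_gt0.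
have er1 : e * r <= r by rewrite ler_piMl // ltW.
have [r' [h1 h2 zf']] := @zerofree_dense R f z0 (r + e * r / 2) (r + e * r) fe fz0 ltac:(clear -r0 er0; lra) ltac:(clear -er0; lra).
have Ke : 4 * K < e * r.
  by rewrite [e * r]mulrC -ltr_pdivrMr //; clear -ri; lra.
have rr' : r + K < r' by clear -h1 Ke K0; lra.
have rr1 : r <= r' by clear -h1 er0; lra.
have r'0 : 0 < r' := lt_le_trans r0 rr1.
have r'2 : r' <= 2 * r by clear -h2 er1; lra.
have A0 : 0 <= A := le_trans ler01 A1.
have zr' := le_trans rd rr1.
have r1r' := le_trans ra rr1.
have p' : pmean f r' <= A * r'.
  by apply: pmean_le => //; [exact: ltW|exact: hA|by rewrite mulr_ge0 // ltW].
have l' := hf r' (le_trans rb rr1) zf'.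
have CA : `|Cf| <= A * r by apply: (le_trans rg); rewrite ler_peMl // ltW.
have Q0 := pmean_lmean_ge0 fe (ltW r'0) zf'.
have Q1 : 2 * pmean f r' - lmean f r' <= 2 * (A * r') + `|Cf|.
  by move: p' l' (ler_norm Cf); clear; lra.
have dl := @harnack_increment_bound A `|Cf| K e r r' (2 * pmean f r' - lmean f r') A1 (normr_ge0 _) CA K0
  e0 e1 r0 h1 h2 Ke Q0 Q1.
have hB z : nm z <= 7 * r' -> nm (f z) <= expR (A * (7 * r')).
  by move=> zr; apply: le_trans (maxmod_ge fe zr) _; apply: hA; move: r1r' r'0; clear; lra.
have [_] := andP (lmean_diff fe fz0 r0 rr1 zr' zf zf' hB).
have fz : 0 < nm (f z0) by rewrite nm_gt0.
rewrite (_ : ln (expR _ / _) = A * (7 * r') - ln (nm (f z0))); last first.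
  by rewrite ln_div ?posrE ?expR_gt0 // expRK.
move=> ld.
have lr0 : 0 <= ln (r' / r) by rewrite ln_ge0 // ler_pdivlMr // mul1r.
have lr1 : ln (r' / r) <= e.
  have -> : r' / r = 1 + (r' / r - 1) by ring.
  apply: le_trans (le_ln1Dx _) _.
    by rewrite ltrBrDl subrr divr_gt0.
  by rewrite lerBlDr ler_pdivrMr // mulrDl mul1r addrC; exact: ltW.
(* 14 comes from 7 r' <= 14 r, and one more from the logarithm of |f z0|, which is at most r in
   absolute value. *)
have lb : A * (7 * r') - ln (nm (f z0)) <= 15 * A * r.
  have h : A * (7 * r') <= A * (14 * r) by rewrite ler_wpM2l //; move: r'2; clear; lra.
  have h' : r <= A * r by rewrite ler_peMl // ltW.
  by move: h h' rj (ler_norm (- ln (nm (f z0)))); rewrite normrN; clear; lra.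
have ld2 : lmean f r' - lmean f r <= 15 * A * r / ln 2 * e.
  apply: (le_trans ld); apply: (@le_trans _ _ (15 * A * r / ln 2 * ln (r' / r))).
    by rewrite ler_wpM2r // ler_pM2r ?invr_gt0.
  by rewrite ler_wpM2l // divr_ge0 ?mulr_ge0 // ltW.
have ld3 : 3 * (15 * A * r / ln 2 * e) <= eps / 2 * r.
  have -> : 3 * (15 * A * r / ln 2 * e) = 45 * A * e / ln 2 * r by ring.
  by rewrite ler_wpM2r // ltW.
have hH := hh r rc zH.
have C1r : C1 <= eps / 2 * r.
  by move: rk; rewrite ler_pdivrMr //; clear; lra.
rewrite /C1 in C1r.
have X : 480 * A * K / e ^+ 2 = 3 * (160 * A * K / e ^+ 2) by ring.
move: C1r dl (two _ _ r0 rr' zf zf' zH) hH ld3 ld2; rewrite X.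
move: (_ * (_ / _)) (160 * _ * _ / _) (15 * A * r / ln 2 * e) => u v w; clear; lra.
Qed.

Variables (p1 p2 g1 g2 : R[i]) (m : nat) (d k : 'I_m.+1 -> R[i]) (f : R[i] -> R[i]) (z0 z1 : R[i]).
Hypothesis (fe : ent f) (fz0 : f z0 != 0).
Hypothesis (f_eq : forall z, f z ^+ 2 * cder f z + linear_difference d k f z =
  p1 * cexp (g1 * z) + p2 * cexp (g2 * z)).
Let K := 1 + \sum_(j < m.+1) nm (k j).
Let D := 1 + \sum_(j < m.+1) nm (d j).
Let W z := f z ^+ 2 * cder f z.
Let H := ode2 g1 g2 W.
Let C := (1 + nm (g1 + g2) + nm (g1 * g2)) * D.
Hypothesis Hz1 : H z1 != 0.

Let entW : ent W.
Proof. by apply: entM; [exact: entX|exact: ent_cder]. Qed.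

Let entH : ent H. Proof. exact: ent_ode2. Qed.

Let C_ge1 : 1 <= C.
Proof.
rewrite -[1]mulr1; apply: ler_pM => //; last exact: D_ge1.
have := nm_ge0 (g1 + g2); have := nm_ge0 (g1 * g2); lra.
Qed.

(** The linear bound uses H = - L(U) for the difference polynomial U: shifts of length up to K plus
    the radius 2 of [ode2_bound]. The cubic one uses the definition of H: radius 2 plus 1 for f',
    and 3 <= K + 2. *)
Lemma ode2_two_bounds z x E : 0 <= x -> (forall c, nm c <= K + 2 -> nm (f (z + c)) <= x * expR E) ->
  nm (H z) <= C * (x * expR E) /\ nm (H z) <= C * (x ^+ 3 * expR (3 * E)).
Proof.
move=> x0 hf; set B := x * expR E in hf *.
have K1 : 1 <= K := K_ge1 k; have D1 : 1 <= D := D_ge1 d.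
have B0 : 0 <= B by rewrite mulr_ge0 // expR_ge0.
have C0 : 0 <= 1 + nm (g1 + g2) + nm (g1 * g2).
  have := nm_ge0 (g1 + g2); have := nm_ge0 (g1 * g2); lra.
have U_e : ent (linear_difference d k f).
  by apply: ent_sum => j; apply: entM; [exact: ent_cst|exact: ent_shift].
split.
  rewrite /H (ode2_opp U_e f_eq) nmN /C -mulrA; apply: ode2_bound => // c c2.
  apply: (le_trans (nm_sum _ _)); apply: (@le_trans _ _ (\sum_(j < m.+1) nm (d j) * B)).
    apply: ler_sum => j _; rewrite nmM ler_wpM2l ?nm_ge0 // -addrA; apply: hf.
    have := nmD c (k j); have : nm (k j) <= K := shift_le_K k j; lra.
  by rewrite -mulr_suml ler_wpM2r // /D lerDr.
rewrite (_ : x ^+ 3 * _ = B ^+ 3); last by rewrite /B exprMn -expRM_natl.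
have B3 : 0 <= B ^+ 3 by rewrite exprn_ge0.
apply: (@le_trans _ _ ((1 + nm (g1 + g2) + nm (g1 * g2)) * B ^+ 3)).
  apply: ode2_bound => // c c2.
  have h1 : nm (f (z + c)) <= B by apply: hf; apply: (le_trans c2); rewrite lerDr (le_trans ler01 K1).
  have h2 : nm (cder f (z + c)) <= B.
    apply: cauchy_estimate => // c' c'1; rewrite -addrA; apply: hf.
    have := nmD c c'; lra.
  rewrite /W nmM nmX (exprSr B); apply: ler_pM; rewrite ?exprn_ge0 ?nm_ge0 //.
  by rewrite ler_pXn2r ?nnegrE ?nm_ge0.
by rewrite /C ler_wpM2r // -[X in X <= _]mulr1 ler_wpM2l.
Qed.

(** The pointwise bound of [ln_le_linear_cubic] is averaged over the circle. The mean of 3 E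
    contains - 3 [lmean f r], which cancels the term 3 ln |f| and leaves [lmean f r']. *)
Lemma two_radii_estimate r r' : 0 < r -> r + (K + 2) < r' -> zerofree f r -> zerofree f r' -> zerofree H r ->
  2 * pmean f r <= 3 * lmean f r' + 3 * ((2 * pmean f r' - lmean f r') *
     (2 * r' * (K + 2) / ((r' - r - (K + 2)) * (r' - r)))) + ln C - lmean H r.
Proof.
move=> r0 rr' zf zf' zH; have K1 : 1 <= K := K_ge1 k.
have K2 : 0 <= K + 2 by rewrite addr_ge0 // (le_trans ler01 K1).
have [E [Ec E0 hE mE]] := neighbourhood_majorant fe fz0 r0 K2 rr' zf zf'.
have cr t : nm (circ r t) = r by rewrite nm_circ // ltW.
have fp t : 0 < nm (f (circ r t)) by rewrite nm_gt0 zf.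
have Hp t : 0 < nm (H (circ r t)) by rewrite nm_gt0 zH.
have pt t : ln (nm (H (circ r t))) <=
    ln C + 3 * E t + 3 * ln (nm (f (circ r t))) - 2 * logp (nm (f (circ r t))).
  have [b1 b2] := ode2_two_bounds (ltW (fp t)) (hE t).
  exact: ln_le_linear_cubic.
have lc : continuous (fun t => ln (nm (f (circ r t)))) by apply: continuous_lmean => //; exact: ltW.
have Hc : continuous (fun t => ln (nm (H (circ r t)))) by apply: continuous_lmean => //; exact: ltW.
have pc := @continuous_pmean R f r fe.
have c3 (u : R -> R) (a : R) : continuous u -> continuous (fun t => a * u t).
  by move=> uc t; apply: cvgMr; exact: uc.
have cA (u v : R -> R) : continuous u -> continuous v -> continuous (fun t => u t + v t).
  by move=> uc vc t; apply: cvgD; [exact: uc|exact: vc].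
have cB (u v : R -> R) : continuous u -> continuous v -> continuous (fun t => u t - v t).
  by move=> uc vc t; apply: cvgB; [exact: uc|exact: vc].
have cC : continuous (fun _ : R => (ln C : R)) by move=> t; exact: cvg_cst.
have c1 := cA _ _ cC (c3 _ 3 Ec); have c2 := cA _ _ c1 (c3 _ 3 lc).
have := rmean_le Hc (cB _ _ c2 (c3 _ 2 pc)) pt.
rewrite (rmeanB c2 (c3 _ 2 pc)) (rmeanD c1 (c3 _ 3 lc)) (rmeanD cC (c3 _ 3 Ec)) !rmeanZ // rmean_cst mE.
by rewrite -/(lmean f r) -/(lmean H r) -/(pmean f r); lra.
Qed.

Lemma main_estimate (A r1 eps : R) : 1 <= A -> (forall r, r1 <= r -> maxmod f r <= expR (A * r)) ->
  0 < eps -> exists r2, forall r, r2 <= r -> zerofree f r -> zerofree H r ->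
    2 * pmean f r <= 3 * lmean f r + eps * r.
Proof.
have K2 : 0 <= K + 2 by rewrite addr_ge0 // (le_trans ler01 (K_ge1 k)).
exact: (radii_comparison fe fz0 entH Hz1 K2 two_radii_estimate).
Qed.

End Nondegenerate.

(** * Conclusion: the two kinds of solutions *)

Lemma lmean_eq_Ncount {R : realType} (f : R[i] -> R[i]) (z0 : R[i]) : ent f -> f z0 != 0 ->
  exists c r0 : R, forall r, r0 <= r -> zerofree f r -> lmean f r = Ncount (fun z => (f z)^-1) r + c.
Proof.
move=> fe fz0; have z0n := nm_ge0 z0.
have m0 : 0 < normc z0 + 1 by lra.
have m1 : normc z0 + 1 < normc z0 + 2 by lra.
have [r0 [h1 h2 zf0]] := zerofree_dense fe fz0 m0 m1.
(* The factorization depends on [r]. To make the constant independent of [r], the same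
   factorization, valid up to [r], is also used at the fixed radius [r0]. *)
exists (lmean f r0 - Ncount (fun z => (f z)^-1) r0), r0 => r r0r zf.
have r00 : 0 < r0 by lra.
have rp : 0 < r by lra.
have zr : normc z0 <= r by lra.
have [s [q [qe fq qn _]]] := zeros_factor fe fz0 rp zr.
have sn x : zerofree f x -> forall a, a \in s -> normc a != x.
  move=> zx a as_; apply/eqP => ax; move/eqP: (zx _ ax); apply; rewrite fq.
  by apply/eqP; rewrite mulf_eq0 zprod_eq0 as_.
have qn0 z : normc z <= r0 -> q z != 0 by move=> zr0; apply: qn; lra.
rewrite (lmean_Ncount qe fq rp qn (sn _ zf)) (lmean_Ncount qe fq r00 qn0 (sn _ zf0)); ring.
Qed.

Lemma exponential_parameters {R : realType} (p1 p2 g1 g2 : R[i]) (m : nat) (d k : 'I_m.+1 -> R[i])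
    (f : R[i] -> R[i]) (c a : R[i]) :
  p1 != 0 -> 3 * a = g1 -> a = g2 -> c ^+ 3 * a = p1 ->
  p2 = \sum_(j < m.+1) d j * c * cexp (a * k j) -> (forall z, f z = c * cexp (a * z)) ->
  exists c1 : R[i], [/\ c1 ^+ 3 = 3 * p1 / g1, forall z, f z = c1 * cexp (g1 * z / 3),
    p2 = \sum_(j < m.+1) d j * c1 * cexp (g1 * k j / 3) & g1 / g2 = 3].
Proof.
move=> p10 <- <- cp p2E fE; exists c.
have a0 : a != 0 by apply: contra_neq p10 => a0; rewrite -cp a0 mulr0.
have aM (z : R[i]) : 3 * a * z / 3 = a * z by field.
split.
- by rewrite -cp; field.
- by move=> z; rewrite aM.
- by rewrite p2E; apply: eq_bigr => j _; rewrite aM.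
- by field.
Qed.

Lemma zerofree_solution {R : realType} (p1 p2 g1 g2 : R[i]) (m : nat) (d k : 'I_m.+1 -> R[i])
    (f : R[i] -> R[i]) (A r1 : R) :
  p1 != 0 -> p2 != 0 -> g1 != g2 -> transcendental_entire f ->
  (forall z, f z ^+ 2 * cder f z + linear_difference d k f z = p1 * cexp (g1 * z) + p2 * cexp (g2 * z)) ->
  0 <= A -> (forall r, r1 <= r -> maxmod f r <= expR (A * r)) -> (forall z, f z != 0) ->
  (exists c1 : R[i], [/\ c1 ^+ 3 = 3 * p1 / g1, forall z, f z = c1 * cexp (g1 * z / 3),
    p2 = \sum_(j < m.+1) d j * c1 * cexp (g1 * k j / 3) & g1 / g2 = 3]) \/
  (exists c2 : R[i], [/\ c2 ^+ 3 = 3 * p2 / g2, forall z, f z = c2 * cexp (g2 * z / 3),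
    p1 = \sum_(j < m.+1) d j * c2 * cexp (g2 * k j / 3) & g2 / g1 = 3]).
Proof.
move=> p10 p20 g12 [/entire_ent fe fnp] f_eq A0 hA fn.
have [a fE] := zerofree_exponential fe fn A0 hA.
(* For a = 0 the function would be constant, hence a polynomial. *)
have a0 : a != 0.
  apply/eqP => a0; apply: fnp; exists (f 0)%:P => z.
  by rewrite hornerC fE a0 mul0r cexp0 mulr1.
have f'E z : cder f z = f 0 * (a * cexp (a * z)).
  apply: cderE; rewrite [X in cderiv X](_ : f = fun z => f 0 * cexp (a * z)); last exact/funext.
  by apply: cderivZ; exact: cderiv_cexpM.
have eqE z : f 0 ^+ 3 * a * cexp (3 * a * z) +
    (\sum_(j < m.+1) d j * f 0 * cexp (a * k j)) * cexp (a * z) = p1 * cexp (g1 * z) + p2 * cexp (g2 * z).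
  have c3 : cexp (3 * a * z) = cexp (a * z) ^+ 3.
    have -> : 3 * a * z = a * z + (a * z + a * z) by ring.
    by rewrite !cexpD; ring.
  rewrite -f_eq f'E (fE z) c3; congr (_ + _); first by ring.
  rewrite /linear_difference mulr_suml; apply: eq_bigr => j _.
  by rewrite (fE (z + _)) mulrDr cexpD; ring.
have [[e1 e2 e3 e4]|[e1 e2 e3 e4]] := exponential_solution p10 p20 g12 (fn 0) a0 eqE.
  by left; apply: (@exponential_parameters _ _ _ _ _ _ _ _ _ (f 0) a).
by right; apply: (@exponential_parameters _ _ _ _ _ _ _ _ _ (f 0) a).
Qed.

(** Taking the positive part of 2 T - 3 N for [S] makes the inequality hold at every radius. Only
    its smallness has to be proved, and only outside the countable set of radii where [f] or [H] has
    a zero. *)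
Lemma nondegenerate_solution {R : realType} (p1 p2 g1 g2 : R[i]) (m : nat) (d k : 'I_m.+1 -> R[i])
    (f : R[i] -> R[i]) (z0 z1 : R[i]) (A r1 c rc : R) : ent f -> f z0 != 0 ->
  (forall z, f z ^+ 2 * cder f z + linear_difference d k f z = p1 * cexp (g1 * z) + p2 * cexp (g2 * z)) ->
  ode2 g1 g2 (fun z => f z ^+ 2 * cder f z) z1 != 0 ->
  1 <= A -> (forall r, r1 <= r -> maxmod f r <= expR (A * r)) ->
  0 < c -> (forall r, rc <= r -> zerofree f r -> c * r <= pmean f r) ->
  exists S : R -> R, small_error f S /\
    forall r : R, 0 < r -> 2 * Tchar f r <= 3 * Ncount (fun z => (f z)^-1) r + S r.
Proof.
move=> fe fz0 f_eq; set H := ode2 _ _ _ => Hz1 A1 hA c0 hc.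
have He : ent H by apply: ent_ode2; apply: entM; [exact: entX|exact: ent_cder].
pose N r := Ncount (fun z => (f z)^-1) r.
pose S r := Num.max 0 (2 * Tchar f r - 3 * N r).
exists S; split; last by move=> r r0; rewrite -lerBlDl le_max lexx orbT.
pose X := [set r : R | ~ zerofree f r] `|` [set r : R | ~ zerofree H r].
have Xc : countable X.
  rewrite /X -bigcup2E; apply: bigcup_countable => // -[|[|i]] _ /=.
  - exact: (zerofree_countable fe fz0).
  - exact: (zerofree_countable He Hz1).
  - exact: countable0.
exists X; split; first exact: countable_measurable.
  by rewrite countable_lebesgue_measure0 // ltry.
move=> eps eps0.
have [C [rN hN]] := lmean_eq_Ncount fe fz0.
(* The estimate is applied with eps c / 2; the constant from Jensen's formula takes the other half
   of eps c r, and c r is at most the characteristic. *)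
have ec : 0 < eps * c / 2 by rewrite divr_gt0 ?mulr_gt0.
have [r2 h2] := main_estimate fe fz0 f_eq Hz1 A1 hA ec.
pose M := Num.max (Num.max rc rN) (Num.max r2 (6 * `|C| / (eps * c))).
exists M; split; first exact: num_real.
move=> r; rewrite !gt_max => /andP[/andP[ra rb] /andP[rd re]] rX.
have zf : zerofree f r by apply: contrapT => h; apply: rX; left.
have zH : zerofree H r by apply: contrapT => h; apply: rX; right.
rewrite ltr_pdivrMr ?mulr_gt0 // in re.
have est := h2 r (ltW rd) zf zH; rewrite (hN r (ltW rb) zf) -/(N r) in est.
have low : eps * (c * r) <= eps * pmean f r by rewrite ler_wpM2l ?(ltW eps0) // hc // ltW.
have C1 := ler_norm C; have C2 := normr_ge0 C.
have low0 : 0 <= eps * pmean f r by apply: le_trans low; lra.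
rewrite /S Tchar_ent // ger0_norm ?le_max ?lexx // ge_max low0 /=; lra.
Qed.

Theorem theorem3 (R : realType) (p1 p2 gamma1 gamma2 : R[i])
    (m : nat) (d k : 'I_m.+1 -> R[i]) (f : R[i] -> R[i])
    (p1_neq0 : p1 != 0) (p2_neq0 : p2 != 0)
    (gamma1_neq0 : gamma1 != 0) (gamma2_neq0 : gamma2 != 0)
    (gamma12 : gamma1 != gamma2)
    (f_transc : transcendental_entire f)
    (f_hyper : (hyper_order f < 1%:E)%E)
    (f_eq : forall z, f z ^+ 2 * derive1 (f : R[i]^o -> R[i]^o) z + linear_difference d k f z =
                      p1 * cexp (gamma1 * z) + p2 * cexp (gamma2 * z)) :
  growth_order f = 1%:E /\
  [\/ exists S : R -> R, small_error f S /\
        forall r : R, 0 < r ->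
          2 * Tchar f r <= 3 * Ncount (fun z => (f z)^-1) r + S r,
      exists c1 : R[i],
        [/\ c1 ^+ 3 = 3 * p1 / gamma1,
            forall z, f z = c1 * cexp (gamma1 * z / 3),
            p2 = \sum_(j < m.+1) d j * c1 * cexp (gamma1 * k j / 3) &
            gamma1 / gamma2 = 3]
    | exists c2 : R[i],
        [/\ c2 ^+ 3 = 3 * p2 / gamma2,
            forall z, f z = c2 * cexp (gamma2 * z / 3),
            p1 = \sum_(j < m.+1) d j * c2 * cexp (gamma2 * k j / 3) &
            gamma2 / gamma1 = 3]].
Proof.
have fe : ent f by exact: entire_ent f_transc.1.
have f_eq' z : f z ^+ 2 * cder f z + linear_difference d k f z =
    p1 * cexp (gamma1 * z) + p2 * cexp (gamma2 * z) by rewrite -f_eq derive1_cder.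
have [z0 fz0] : exists z0, f z0 != 0.
  apply: contrapT => h; apply: f_transc.2; exists 0 => z; rewrite horner0.
  by apply/eqP; apply: contra_notT h => fz; exists z.
have [A [r1 [A1 r11 hA]]] := exponential_type fe fz0 f_eq' f_hyper.
have [c [rc [c0 hc]]] := characteristic_lower fe fz0 f_eq' p1_neq0 p2_neq0 gamma1_neq0 gamma2_neq0 gamma12.
have A0 : 0 <= A by lra.
split.
  apply: (@growth_order_eq1 _ f A c r1) => //; first lra.
    move=> r rr; apply: pmean_le => //; first lra.
      exact: hA.
    by rewrite mulr_ge0 //; lra.
  (* Zero-free radii are dense, so the linear lower bound is available beyond any given radius. *)
  move=> r; have [h1 h2] : 0 < Num.max (Num.max r rc) 1 /\
      Num.max (Num.max r rc) 1 < Num.max (Num.max r rc) 1 + 1.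
    by rewrite lt_max ltr01 orbT ltrDl.
  have [r' [ra rb zf]] := zerofree_dense fe fz0 h1 h2.
  move: ra; rewrite !gt_max => /andP[/andP[ra rc'] _].
  by exists r' => //; apply: hc => //; exact: ltW.
have [h|[z1 Hz1]] : (forall z, ode2 gamma1 gamma2 (fun z => f z ^+ 2 * cder f z) z = 0) \/
   exists z1, ode2 gamma1 gamma2 (fun z => f z ^+ 2 * cder f z) z1 != 0.
- have [[z1 h]|h] := pselect (exists z1, ode2 gamma1 gamma2 (fun z => f z ^+ 2 * cder f z) z1 != 0).
    by right; exists z1.
  by left => z; apply/eqP; apply: contra_notT h => fz; exists z.
- have fn := ode2_zerofree fe fz0 gamma12 h.
  have [?|?] := zerofree_solution p1_neq0 p2_neq0 gamma12 f_transc f_eq' A0 hA fn.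
    exact: Or32.
  exact: Or33.
by apply: Or31; exact: nondegenerate_solution fe fz0 f_eq' Hz1 A1 hA c0 hc.
Qed.
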